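(* Let $X$ be a compact Hausdorff space, let $\gamma=\{\gamma_1,\ldots,\gamma_N\}$ be an iterated function system on $X$, and let $\mathbb{X}\subseteq X$ be a subset. Assume: (i) $\mathbb{X}$ is dense in $X$ and completely invariant under $\gamma$; (ii) the images $\gamma_1(\mathbb{X}),\ldots,\gamma_N(\mathbb{X})$ are pairwise disjoint; (iii) the restriction $\gamma_k|_{\mathbb{X}}$ is injective for all $k=1,\ldots,N$; (iv) the maps $\gamma_1,\ldots,\gamma_N$ are (topological) embeddings; (v) there is a dense open set $U$ in $X$ such that the images $\gamma_1(U),\ldots,\gamma_N(U)$ are pairwise disjoint open sets in $X$ contained in $U$, and $\mathbb{X}\subseteq U$; (vi) $\mathbb{X}$ is comeager in $X$. Let $\hat\rho=(\hat\rho_A,\hat\rho_E)$, $C^*(\hat\rho)$ and $\hat D\subseteq C^*(\hat\rho)$ be as constructed in the context. Then $\hat D$ is a masa in $C^*(\hat\rho)$ that contains $\hat\rho_A(A)$.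
   Context: An iterated function system on $X$ is a finite family $\gamma=\{\gamma_1,\ldots,\gamma_N\}$ (repetitions allowed) of continuous maps $X\to X$. Put $I=\{1,\ldots,N\}$. For $\boldsymbol k=(k_n,\ldots,k_1)\in I^n$ put $\gamma_{\boldsymbol k}=\gamma_{k_n}\circ\cdots\circ\gamma_{k_1}$ (the identity if $n=0$). For $S\subseteq X$ put $\gamma(S)=\bigcup_{k}\gamma_k(S)$, $\gamma^0(S)=S$, $\gamma^{n+1}(S)=\gamma(\gamma^n(S))$. $S$ is completely invariant under $\gamma$ if $\gamma_k(S)\subseteq S$ and $\gamma_k^{-1}(S)\subseteq S$ for all $k$. Let $M_{\mathbb{X}}$ be the C*-algebra of bounded operators on $\ell^2(\mathbb{X})$ (orthonormal basis $(e_x)_{x\in\mathbb{X}}$, inner products linear in the second variable) and $D_{\mathbb{X}}\subseteq M_{\mathbb{X}}$ the set of diagonal operators, i.e. those $\alpha$ with $\langle e_x|\alpha e_y\rangle=0$ for $x\ne y$. Let $G=\bigcup_{k}\{(\gamma_k(y),y):y\in X\}\subseteq X\times X$ be the graph of $\gamma$, $A=C(X)$, $E=C(G)$. Define $\rho_A:A\to M_{\mathbb{X}}$ and $\rho_E:E\to M_{\mathbb{X}}$ by $\rho_A(a)e_x=a(x)e_x$ and $\rho_E(f)e_y=\sum_{k=1}^N f(\gamma_k(y),y)\,e_{\gamma_k(y)}$. Let $\upsilon_n$ $(n\in\mathbb{Z})$ be the unitary $e_k\mapsto e_{n+k}$ on $\ell^2(\mathbb{Z})$ and $C^*(\mathbb{Z})$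 the C*-algebra generated by the $\upsilon_n$. Define $\hat\rho_A(a)=\rho_A(a)\otimes\upsilon_0$, $\hat\rho_E(f)=\rho_E(f)\otimes\upsilon_1$ in $M_{\mathbb{X}}\otimes C^*(\mathbb{Z})$, and let $C^*(\hat\rho)$ be the C*-subalgebra generated by $\hat\rho_A(A)\cup\hat\rho_E(E)$. For $n\in\mathbb{N}_0$ a $\gamma$-chain of length $n$ is a tuple $(x_n,\ldots,x_0)\in X^{n+1}$ such that for each $i$ there is $k\in I$ with $x_i=\gamma_k(x_{i-1})$; for $\boldsymbol k=(k_n,\ldots,k_1)\in I^n$ and $x\in X$ let $\boldsymbol\gamma_{\boldsymbol k}(x)=(\gamma_{k_n,\ldots,k_1}(x),\ldots,\gamma_{k_1}(x),x)$. Let $X_{m,n}$ be the compact space of pairs $(\boldsymbol x,\boldsymbol y)$ of $\gamma$-chains of lengths $m$ and $n$ with the same last entry $x_0=y_0$. Define a linear map $\rho_{m,n}:C(X_{m,n})\to M_{\mathbb{X}}$ as follows: for $y\in\gamma^n(\mathbb{X})$ there are unique $\boldsymbol k\in I^n$, $x\in\mathbb{X}$ with $y=\gamma_{\boldsymbol k}(x)$, and $\rho_{m,n}(f)e_y=\sum_{\boldsymbol j\in I^m}f(\boldsymbol\gamma_{\boldsymbol j}(x),\boldsymbol\gamma_{\boldsymbol k}(x))\,e_{\gamma_{\boldsymbol j}(x)}$; for $y\in\mathbb{X}\setminus\gamma^n(\mathbb{X})$, $\rho_{m,n}(f)e_y=0$. Let $E_{m,n}$ be the range of $\rho_{m,n}$.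 For $k\in\mathbb{Z}$ let $B_k$ be the norm-closed linear span of $\bigcup_{m-n=k}E_{m,n}$ ($m,n\in\mathbb{N}_0$), and $D_k=B_k\cap D_{\mathbb{X}}$. Let $\hat D=\bigoplus_{k\in\mathbb{Z}}D_k\otimes\upsilon_k$, meaning the norm-closed linear span of the subspaces $D_k\otimes\upsilon_k=\{\alpha\otimes\upsilon_k:\alpha\in D_k\}$; it is a closed commutative $*$-subalgebra of $C^*(\hat\rho)$. A masa is a maximal commutative $*$-subalgebra. *)

(* Defs.v *)
From HB Require Import structures.
From mathcomp Require Import all_boot all_order all_algebra complex ring lra.
From mathcomp Require Import all_classical all_reals.
From mathcomp Require Import ereal topology normedtype sequences esum.

Set Implicit Arguments.
Unset Strict Implicit.
Unset Printing Implicit Defensive.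

Import Order.TTheory GRing.Theory Num.Theory.
Import numFieldNormedType.Exports.

Local Open Scope classical_set_scope.
Local Open Scope ring_scope.

(* The bare type [R[i]] carries no topology; packed as a numeric field it gets
   the norm topology of [numFieldNormedType]. *)
Definition Cplx (R : realType) : numClosedFieldType := R[i]%C.

Definition normc2 (R : realType) (z : Cplx R) : R :=
  complex.Re z ^+ 2 + complex.Im z ^+ 2.

Lemma normc2_ge0 (R : realType) (z : Cplx R) : 0 <= normc2 z.
Proof. by rewrite addr_ge0 // sqr_ge0. Qed.

Lemma normc2M (R : realType) (z w : Cplx R) :
  normc2 (z * w) = normc2 z * normc2 w.
Proof.
by case: z w => [a b] [c d]; rewrite /normc2 /= !expr2; ring.
Qed.

Lemma normc2D (R : realType) (z w : Cplx R) :
  normc2 (z + w) <= 2 * normc2 z + 2 * normc2 w.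
Proof.
case: z w => [a b] [c d]; rewrite /normc2 /=.
have := sqr_ge0 (a - c); have := sqr_ge0 (b - d); rewrite !expr2; nra.
Qed.

Lemma esumZ (R : realType) (T : choiceType) (a : T -> \bar R) (c : R) :
  0 <= c -> (forall x, 0 <= a x)%E ->
  (\esum_(x in [set: T]) (c%:E * a x) <= c%:E * \esum_(x in [set: T]) a x)%E.
Proof.
move=> c0 a0; apply: ge_ereal_sup => _ [A [fA _] <-].
rewrite -ge0_mule_fsumr // lee_wpmul2l ?lee_fin //.
by apply: esum_ge; exists A.
Qed.

Section Vectors.
Variables (R : realType) (T : choiceType).

Definition sqsum (u : T -> Cplx R) : \bar R :=
  (\esum_(x in [set: T]) (normc2 (u x))%:E)%E.

Definition square_summable : {pred T -> Cplx R} :=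
  fun u => `[< (sqsum u < +oo)%E >].

Lemma square_summable_submod : GRing.submod_closed square_summable.
Proof.
split=> [|a u v /asboolP uoo /asboolP voo]; apply/asboolP.
  by rewrite /sqsum esum1 // => x _; rewrite /normc2 /= expr0n addr0.
apply: (@le_lt_trans _ _
  ((2 * normc2 a)%:E * sqsum u + 2%:E * sqsum v)%E); last first.
  by rewrite lte_add_pinfty // lte_mul_pinfty // lee_fin ?mulr_ge0 ?normc2_ge0.
apply: (@le_trans _ _ (\esum_(x in [set: T])
  ((2 * normc2 a)%:E * (normc2 (u x))%:E + 2%:E * (normc2 (v x))%:E))%E).
  apply: le_esum => x _; rewrite -!EFinM -EFinD lee_fin.
  by rewrite (le_trans (normc2D _ _)) // normc2M mulrA.
rewrite esumD; try by move=> x _; rewrite -EFinM lee_fin !mulr_ge0 ?normc2_ge0.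
by apply: leeD; apply: esumZ => *; rewrite ?lee_fin ?mulr_ge0 ?normc2_ge0.
Qed.

HB.instance Definition _ :=
  GRing.isSubmodClosed.Build _ _ square_summable square_summable_submod.

Record l2 : Type := L2 {
  l2_fun :> T -> Cplx R;
  l2P : l2_fun \in square_summable
}.

HB.instance Definition _ := [isSub for l2_fun].
HB.instance Definition _ := [Choice of l2 by <:].
HB.instance Definition _ := [SubChoice_isSubLmodule of l2 by <:].

Definition ket_fun (x : T) : T -> Cplx R := fun z => (z == x)%:R.

Lemma ket_subproof x : ket_fun x \in square_summable.
Proof.
apply/asboolP; rewrite /sqsum (esumID [set x]) => [|z _]; last first.
  by rewrite lee_fin normc2_ge0.
rewrite setTI esum_set1 ?lee_fin ?normc2_ge0 // esum1 ?adde0 ?ltry //.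
move=> z [_ /eqP/negPf zx].
by rewrite /ket_fun zx /normc2 /= expr0n addr0.
Qed.

Definition ket (x : T) : l2 := L2 (ket_subproof x).

(* Unconditional sum of an absolutely summable family. *)
Definition realsum (f : T -> R) : R :=
  fine (\esum_(x in [set: T]) (Num.max (f x) 0)%:E)%E -
  fine (\esum_(x in [set: T]) (Num.max (- f x) 0)%:E)%E.

Definition inner (u v : l2) : Cplx R :=
  let h x := (u x)^* * v x in
  (realsum (fun x => complex.Re (h x)) +i* realsum (fun x => complex.Im (h x)))%C.

Definition l2norm (u : l2) : R := Num.sqrt (fine (sqsum u)).

End Vectors.

Section TensorVectors.
Variables (R : realType) (S T : choiceType).

Definition tensor_fun (u : l2 R S) (v : l2 R T) : (S * T)%type -> Cplx R :=
  fun p => u p.1 * v p.2.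

Lemma tensor_subproof u v : tensor_fun u v \in @square_summable R (S * T)%type.
Proof.
have /asboolP uoo := l2P u; have /asboolP voo := l2P v; apply/asboolP.
rewrite /sqsum.
have -> : [set: (S * T)%type] = [set: S] `*`` (fun=> [set: T]) by apply/seteqP.
rewrite -(@esum_esum _ _ _ _ _ (fun x y => (normc2 (tensor_fun u v (x, y)))%:E)).
  have v0 : (0 <= sqsum v)%E by apply: esum_ge0 => x _; rewrite lee_fin normc2_ge0.
  have vfin : sqsum v \is a fin_num by rewrite ge0_fin_numE.
  apply: (@le_lt_trans _ _ (\esum_(x in [set: S])
    ((fine (sqsum v))%:E * (normc2 (u x))%:E))%E).
    apply: le_esum => x _; rewrite muleC fineK //.
    under eq_esum => y _ do rewrite normc2M EFinM /=.
    by apply: (@esumZ _ _ (fun y => (normc2 (v y))%:E)) => [|y];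
      [exact: normc2_ge0 | rewrite lee_fin; exact: normc2_ge0].
  apply: (@le_lt_trans _ _ ((fine (sqsum v))%:E * sqsum u)%E).
    apply: (@esumZ _ _ (fun x => (normc2 (u x))%:E)) => [|x].
      exact: fine_ge0.
    by rewrite lee_fin; exact: normc2_ge0.
  by rewrite lte_mul_pinfty // lee_fin fine_ge0.
by move=> *; rewrite lee_fin; exact: normc2_ge0.
Qed.

(* [l2 (S * T)] plays the role of the Hilbert tensor product of [l2 S] and
   [l2 T], with [u (x) v] the function [(x, y) |-> u x * v y]. *)
Definition tensor_vec u v : l2 R (S * T)%type := L2 (tensor_subproof u v).

End TensorVectors.

Section Operators.
Variable R : realType.

Definition bounded_op (T : choiceType) : set (l2 R T -> l2 R T) :=
  [set F | linear F /\ exists M : R, forall u, l2norm (F u) <= M * l2norm u].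

Definition opnorm (T : choiceType) (F : l2 R T -> l2 R T) : R :=
  sup [set l2norm (F u) | u in [set u | l2norm u <= 1]].

(* The bounded operator described by [P], with 0 as default value. The uses below
   are for a [P] satisfied by exactly one bounded operator: for [adjoint] and
   [tensor_op] when the arguments are bounded; for [rho_A], [rho_E], [rho_mn]
   when the argument is continuous, X is compact Hausdorff, XX is completely
   invariant, and the gamma_k are continuous, injective on XX and have disjoint
   images of XX. *)
Definition the_op (T : choiceType) (P : set (l2 R T -> l2 R T)) :
    l2 R T -> l2 R T :=
  xget (fun=> 0) (@bounded_op T `&` P).

Definition adjoint (T : choiceType) (F : l2 R T -> l2 R T) : l2 R T -> l2 R T :=
  the_op [set G | forall u v, inner (F u) v = inner u (G v)].

Definition tensor_op (S T : choiceType) (F : l2 R S -> l2 R S)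
    (G : l2 R T -> l2 R T) : l2 R (S * T)%type -> l2 R (S * T)%type :=
  the_op [set K | forall u v, K (tensor_vec u v) = tensor_vec (F u) (G v)].

Variable T : choiceType.
Implicit Types V A B D : set (l2 R T -> l2 R T).

Definition op_subspace V : Prop :=
  [/\ V `<=` @bounded_op T, V (fun=> 0) &
    forall (a : Cplx R) F G, V F -> V G -> V (fun u => a *: F u + G u)].

Definition norm_closed V : Prop :=
  forall F, bounded_op F ->
    (forall e : R, 0 < e ->
       exists2 G, V G & opnorm (fun u => F u - G u) < e) ->
    V F.

Definition star_subalgebra A : Prop :=
  [/\ op_subspace A,
      forall F G, A F -> A G -> A (F \o G) &
      forall F, A F -> A (adjoint F)].

Definition cstar_subalgebra A : Prop := star_subalgebra A /\ norm_closed A.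

Definition closed_span V : set (l2 R T -> l2 R T) :=
  smallest (fun W => op_subspace W /\ norm_closed W) V.

Definition cstar_generated V : set (l2 R T -> l2 R T) :=
  smallest cstar_subalgebra V.

Definition commutative_set A : Prop :=
  forall F G, A F -> A G -> F \o G = G \o F.

Definition masa D B : Prop :=
  [/\ D `<=` B, star_subalgebra D, commutative_set D &
    forall A, star_subalgebra A -> commutative_set A ->
      D `<=` A -> A `<=` B -> A = D].

End Operators.

(* The unitary [e_k |-> e_(n + k)] of l2(Z). *)
Definition shift (R : realType) (n : int) : l2 R int -> l2 R int :=
  the_op [set F | forall k : int, F (ket R k) = ket R (n + k)].

Section Topology.
Variable X : topologicalType.

Definition nowhere_dense (S : set X) : Prop := interior (closure S) = set0.

Definition meager (S : set X) : Prop :=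
  exists2 F : nat -> set X, (forall n, nowhere_dense (F n)) &
    S = \bigcup_n F n.

Definition comeager (S : set X) : Prop := meager (~` S).

Definition topological_embedding (f : X -> X) : Prop :=
  [/\ continuous f, injective f &
    forall O : set X, open O ->
      exists2 V : set X, open V & f @` O = V `&` range f].

End Topology.

Section IFS.
Variables (R : realType) (X : topologicalType) (N : nat).
Variable gamma : 'I_N -> X -> X.

Definition ifs : Prop := forall k, continuous (gamma k).

Definition completely_invariant (S : set X) : Prop :=
  forall k, gamma k @` S `<=` S /\ gamma k @^-1` S `<=` S.

Definition ifs_image (S : set X) : set X :=
  \bigcup_(k in [set: 'I_N]) (gamma k @` S).

Definition ifs_graph : set (X * X) :=
  [set p | exists k, p.1 = gamma k p.2].

(* Words [(k_n, ..., k_1)] are stored as [[:: k_1; ...; k_n]], so that the i-th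
   point of a chain is obtained from the prefix of length i; accordingly a chain
   [(x_n, ..., x_0)] is the function [i |-> x_i]. *)
Definition word_map (s : seq 'I_N) (x : X) : X :=
  foldl (fun z k => gamma k z) x s.

Definition chain_space (n : nat) := {ptws 'I_n.+1 -> X}.

Definition is_chain (n : nat) (x : chain_space n) : Prop :=
  forall i : 'I_n, exists k,
    x (lift ord0 i) = gamma k (x (widen_ord (leqnSn n) i)).

Definition word_chain (n : nat) (k : n.-tuple 'I_N) (x : X) : chain_space n :=
  fun i => word_map (take i k) x.

Definition chain_pairs (m n : nat) : set (chain_space m * chain_space n) :=
  [set p | [/\ is_chain p.1, is_chain p.2 & p.1 ord0 = p.2 ord0]].

Arguments chain_pairs : clear implicits.

Variable XX : set X.

(* [e_x] for [x] in [XX]; 0 for the other points of X, which is never used. *)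
Definition e_ (x : X) : l2 R XX :=
  oapp (@ket R XX) 0 (insub x).

Definition diagonal_op : set (l2 R XX -> l2 R XX) :=
  [set F | bounded_op F /\
    forall x y, XX x -> XX y -> x <> y -> inner (e_ x) (F (e_ y)) = 0].

Definition rho_A (a : X -> Cplx R) : l2 R XX -> l2 R XX :=
  the_op [set F | forall x, XX x -> F (e_ x) = a x *: e_ x].

Definition rho_E (f : X * X -> Cplx R) : l2 R XX -> l2 R XX :=
  the_op [set F | forall y, XX y ->
    F (e_ y) = \sum_(k < N) f (gamma k y, y) *: e_ (gamma k y)].

(* Elements of C(G), and of C(X_{m,n}) below, are represented by functions on
   the ambient product space, of which only the values on G, resp. X_{m,n},
   are constrained and used. *)
Definition hat_rho_A (a : X -> Cplx R) := tensor_op (rho_A a) (@shift R 0).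

Definition hat_rho_E (f : X * X -> Cplx R) := tensor_op (rho_E f) (@shift R 1).

Definition hat_rho_A_range := hat_rho_A @` [set a | continuous a].

Definition hat_rho_E_range :=
  hat_rho_E @` [set f | {within ifs_graph, continuous f}].

Definition cstar_hat_rho := cstar_generated (hat_rho_A_range `|` hat_rho_E_range).

Definition rho_mn (m n : nat) (f : chain_space m * chain_space n -> Cplx R) :
    l2 R XX -> l2 R XX :=
  the_op [set F |
    (forall (k : n.-tuple 'I_N) x, XX x ->
       F (e_ (word_map k x)) =
       \sum_(j : m.-tuple 'I_N)
         f (word_chain j x, word_chain k x) *: e_ (word_map j x)) /\
    (forall y, XX y -> ~ iter n ifs_image XX y -> F (e_ y) = 0)].

Definition E_mn (m n : nat) : set (l2 R XX -> l2 R XX) :=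
  @rho_mn m n @` [set f | {within chain_pairs m n, continuous f}].

Definition B_ (k : int) : set (l2 R XX -> l2 R XX) :=
  closed_span [set F | exists m n : nat, m%:Z - n%:Z = k /\ E_mn m n F].

Definition D_ (k : int) : set (l2 R XX -> l2 R XX) := B_ k `&` diagonal_op.

Definition D_hat : set (l2 R (XX * int)%type -> l2 R (XX * int)%type) :=
  closed_span (\bigcup_(k in [set: int])
    [set tensor_op F (@shift R k) | F in D_ k]).

End IFS.

Arguments hat_rho_A_range R {X} XX.
Arguments cstar_hat_rho R {X N} gamma XX.
Arguments D_hat R {X N} gamma XX.

(* Main.v *)
Require Import Defs.
From mathcomp Require Import all_boot all_order all_algebra complex ring lra zify.
From mathcomp Require Import all_classical all_reals.
From mathcomp Require Import ereal topology normedtype esum.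

Set Implicit Arguments.
Unset Strict Implicit.
Unset Printing Implicit Defensive.

Import Order.TTheory GRing.Theory Num.Theory.
Import numFieldNormedType.Exports.

Local Open Scope classical_set_scope.
Local Open Scope ring_scope.

(* [D_hat] is the relative commutant of [hat_rho_A(A)] in [C*(hat_rho)], which is
   commutative; hence it is maximal commutative.

   An element T of [C*(hat_rho)] has Fourier coefficients T_k, obtained by slicing
   with vectors of l2(Z), and T_k lies in [B_k] because [C*(hat_rho)] is the
   closed span of the spaces [B_k (x) v_k].  If T commutes with [hat_rho_A(A)],
   then each T_k commutes with all continuous functions on X; these separate the
   points of XX, so T_k is diagonal and lies in [D_k].  The Cesaro means of
   [sum_k T_k (x) v_k] converge to T in norm, so T belongs to [D_hat].

   That [C*(hat_rho)] is the closed span of the [B_k (x) v_k] rests on [E_{m,n}]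
   being contained in the closed span of the operators [M L^*], where M and L are
   products [a_m s ... s a_0] and [b_n s ... s b_0] of functions and
   [s = rho_E 1]: products of coordinate functions span a dense subspace of
   [C(X_{m,n})].  Since [s^* a s] is again a function, these operators [M L^*] are
   stable under products. *)

(** * Summation over an arbitrary index type *)

(** The Fourier series of an element of the C*-algebra need not converge in norm; this is why Cesaro
    means are used. Their uniform boundedness comes from a compression: let V_r send e_(x,i) to
    e_(x,i) (x) e_(i-r) and put V = V_0 + ... + V_(n-1). Then the mean of K is n^-1 V^* (K (x) 1) V,
    and V has norm sqrt n. This uses that the block matrix of K over Z is constant along diagonals,
    a property that has to be carried through closed spans. The relation s^* a s = sum_k a o gamma_k
    holds because a point of XX has at most one predecessor, under at most one of the maps. In a
    product M L^* P Q^* it cancels the letters s of L and P pairwise until the shorter word is used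
    up; the rest of the longer one is absorbed by M or by Q. The operators of the statement are
    given by descriptions ([the_op]). Each is therefore built explicitly on l2 and identified with
    its description on basis vectors, which determine a bounded operator. *)

Section RealSum.
Variables (R : realType) (T : choiceType).
Implicit Types f g h : T -> R.

Definition abs_summable f : Prop :=
  (\esum_(x in [set: T]) (`|f x|)%:E < +oo)%E.

(** [fine] sends [+oo] to 0, so this number has the expected meaning only for summable families;
    hence the recurring hypothesis [abs_summable]. *)
Definition possum f : R := fine (\esum_(x in [set: T]) (f x)%:E)%E.

Lemma possumE f : (forall x, 0 <= f x) -> abs_summable f ->
  (\esum_(x in [set: T]) (f x)%:E)%E = (possum f)%:E.
Proof.
move=> f0 fs; rewrite /possum fineK // ge0_fin_numE.
  by move: fs; rewrite /abs_summable; under eq_esum do rewrite ger0_norm //.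
by apply: esum_ge0 => x _; rewrite lee_fin.
Qed.

Lemma abs_summable_le f g : (forall x, `|f x| <= g x) -> abs_summable g ->
  abs_summable f.
Proof.
move=> fg; apply: le_lt_trans; apply: le_esum => x _.
by rewrite lee_fin (le_trans (fg x)) // ler_norm.
Qed.

Lemma abs_summableD f g : abs_summable f -> abs_summable g ->
  abs_summable (fun x => f x + g x).
Proof.
move=> fs gs; have : (\esum_(x in [set: T]) (`|f x|)%:E +
    \esum_(x in [set: T]) (`|g x|)%:E < +oo)%E by rewrite lte_add_pinfty.
rewrite -esumD; try by move=> *; rewrite lee_fin.
apply: le_lt_trans; apply: le_esum => x _.
by rewrite -EFinD lee_fin ler_normD.
Qed.

Lemma abs_summableZ (c : R) f : abs_summable f -> abs_summable (fun x => c * f x).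
Proof.
move=> fs; apply: (@le_lt_trans _ _ (`|c|%:E *
    \esum_(x in [set: T]) (`|f x|)%:E)%E); last first.
  by rewrite lte_mul_pinfty // lee_fin.
apply: (le_trans _ (@esumZ R T (fun x => (`|f x|)%:E) `|c| (normr_ge0 _) _)).
  by apply: le_esum => x _; rewrite -EFinM normrM.
by move=> x; rewrite lee_fin.
Qed.

Lemma possumD f g : (forall x, 0 <= f x) -> (forall x, 0 <= g x) ->
  abs_summable f -> abs_summable g ->
  possum (fun x => f x + g x) = possum f + possum g.
Proof.
move=> f0 g0 fs gs; apply: EFin_inj.
rewrite EFinD -!possumE //.
- by rewrite -esumD //; move=> x _; rewrite lee_fin.
- by move=> x; rewrite addr_ge0.
- exact: abs_summableD.
Qed.

Lemma possumZ (c : R) f : 0 <= c -> (forall x, 0 <= f x) ->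
  abs_summable f -> possum (fun x => c * f x) = c * possum f.
Proof.
move=> c0 f0 fs.
have le d g : 0 <= d -> (forall x, 0 <= g x) -> abs_summable g ->
    possum (fun x => d * g x) <= d * possum g.
  move=> d0 g0 gs; rewrite -lee_fin EFinM -!possumE //.
  - by apply: (@esumZ R T (fun x => (g x)%:E)) => // x; rewrite lee_fin.
  - by move=> x; rewrite mulr_ge0.
  - exact: abs_summableZ.
apply/eqP; rewrite eq_le le //=.
have [->|cn] := eqVneq c 0.
  rewrite mul0r fine_ge0 //; apply: esum_ge0 => x _; rewrite lee_fin.
  by rewrite mul0r.
have cp : 0 < c by rewrite lt_def cn.
(* The reverse inequality is the bound [le] itself, applied to the factor [c^-1] and the family
   [c * f]. *)
have : possum (fun x => c^-1 * (c * f x)) <= c^-1 * possum (fun x => c * f x).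
  by apply: le; rewrite ?invr_ge0 //; [move=> x; rewrite mulr_ge0|
    exact: abs_summableZ].
rewrite -(ler_pM2l cp) mulrA mulfV // mul1r.
by under eq_fun do rewrite mulrA mulVf // mul1r.
Qed.

Lemma le_possum f g : (forall x, 0 <= f x) -> abs_summable g ->
  (forall x, f x <= g x) -> possum f <= possum g.
Proof.
move=> f0 gs fg; have g0 x : 0 <= g x by rewrite (le_trans (f0 x)).
have fs : abs_summable f.
  by apply: abs_summable_le gs => x; rewrite ger0_norm.
by rewrite -lee_fin -!possumE //; apply: le_esum => x _; rewrite lee_fin.
Qed.

Lemma possum_ge0 f : (forall x, 0 <= f x) -> 0 <= possum f.
Proof. by move=> f0; rewrite fine_ge0 // esum_ge0 // => x _; rewrite lee_fin. Qed.

Lemma possum0 : possum (fun _ => 0) = 0.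
Proof. by rewrite /possum esum1. Qed.

Lemma max_sub (a : R) : Num.max a 0 - Num.max (- a) 0 = a.
Proof. by rewrite !maxEle; do 2 case: ifPn => ?; lra. Qed.

(** Positive parts are not additive, so the sum is freed from its canonical decomposition: if f = g
    - h, then f^+ + h = f^- + g, and [possumD] applies to both sides. *)
Lemma realsum_diff f g h : (forall x, 0 <= g x) -> (forall x, 0 <= h x) ->
  abs_summable g -> abs_summable h -> (forall x, f x = g x - h x) ->
  realsum f = possum g - possum h.
Proof.
move=> g0 h0 gs hs fE.
have p0 x : 0 <= Num.max (f x) 0 by rewrite le_max lexx orbT.
have m0 x : 0 <= Num.max (- f x) 0 by rewrite le_max lexx orbT.
have ps : abs_summable (fun x => Num.max (f x) 0).
  by apply: abs_summable_le gs => x; rewrite ger0_norm // ge_max g0 andbT fE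
    lerBlDr lerDl.
have ms : abs_summable (fun x => Num.max (- f x) 0).
  by apply: abs_summable_le hs => x; rewrite ger0_norm // ge_max h0 andbT fE
    opprB lerBlDr lerDl.
have -> : realsum f = possum (fun x => Num.max (f x) 0) -
  possum (fun x => Num.max (- f x) 0) by [].
suff: possum (fun x => Num.max (f x) 0) + possum h =
      possum (fun x => Num.max (- f x) 0) + possum g by move=> ?; lra.
rewrite -!possumD //; congr possum; apply/funext => x.
by have := max_sub (f x); have := fE x; move=> ? ?; lra.
Qed.

Lemma realsum_pos f : (forall x, 0 <= f x) -> abs_summable f ->
  realsum f = possum f.
Proof.
move=> f0 fs; rewrite (@realsum_diff f f (fun=> 0)) ?possum0 ?subr0 //.
  by rewrite /abs_summable esum1 // => *; rewrite normr0.
by move=> x; rewrite subr0.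
Qed.

Let posp f x := Num.max (f x) 0.
Let negp f x := Num.max (- f x) 0.
Let pos0 f x : 0 <= posp f x. Proof. by rewrite /posp le_max lexx orbT. Qed.
Let neg0 f x : 0 <= negp f x. Proof. by rewrite /negp le_max lexx orbT. Qed.
Let poss f : abs_summable f -> abs_summable (posp f).
Proof.
move=> fs; have fs' : abs_summable (fun x => `|f x|).
  by rewrite /abs_summable; under eq_esum do rewrite normr_id.
apply: abs_summable_le fs' => x.
by rewrite ger0_norm // /posp ge_max ler_norm normr_ge0.
Qed.
Let negs f : abs_summable f -> abs_summable (negp f).
Proof.
move=> fs; apply: (poss (f := fun x => - f x)).
by rewrite /abs_summable; under eq_esum do rewrite normrN.
Qed.
Let posnegE f x : f x = posp f x - negp f x.
Proof.
by rewrite /posp /negp max_sub.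
Qed.
Let realsumE f : realsum f = possum (posp f) - possum (negp f).
Proof. by []. Qed.

Lemma realsumD f g : abs_summable f -> abs_summable g ->
  realsum (fun x => f x + g x) = realsum f + realsum g.
Proof.
move=> fs gs; rewrite (@realsum_diff _ (fun x => posp f x + posp g x)
  (fun x => negp f x + negp g x)).
- by rewrite !possumD ?realsumE; try by [apply: poss|apply: negs|lra].
- by move=> x; rewrite addr_ge0.
- by move=> x; rewrite addr_ge0.
- by apply: abs_summableD; apply: poss.
- by apply: abs_summableD; apply: negs.
- by move=> x; rewrite {1}(posnegE f x) {1}(posnegE g x); lra.
Qed.

Lemma realsumN f : realsum (fun x => - f x) = - realsum f.
Proof. by rewrite /realsum opprB; under [in X in _ - X]eq_esum do rewrite opprK. Qed.

Lemma realsumZ (c : R) f : abs_summable f ->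
  realsum (fun x => c * f x) = c * realsum f.
Proof.
have pos d g : 0 <= d -> abs_summable g ->
    realsum (fun x => d * g x) = d * realsum g.
  move=> d0 gs; rewrite (@realsum_diff _ (fun x => d * posp g x)
    (fun x => d * negp g x)).
  - by rewrite !possumZ ?realsumE; try by [apply: poss|apply: negs|lra].
  - by move=> x; rewrite mulr_ge0.
  - by move=> x; rewrite mulr_ge0.
  - by apply: abs_summableZ; apply: poss.
  - by apply: abs_summableZ; apply: negs.
  - by move=> x; rewrite {1}(posnegE g x) mulrBr.
move=> fs; have [c0|c0] := lerP 0 c; first exact: pos.
rewrite -[c in RHS]opprK mulNr -pos ?oppr_ge0 ?ltW // -realsumN.
by congr realsum; apply/funext => x; rewrite mulNr opprK.
Qed.

Lemma possum_single f (x : T) : (forall y, 0 <= f y) ->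
  (forall y, y != x -> f y = 0) -> abs_summable f /\ possum f = f x.
Proof.
move=> f0 fx.
have e : (\esum_(y in [set: T]) (f y)%:E)%E = (f x)%:E.
  rewrite (esumID [set x]) => [|y _]; last by rewrite lee_fin.
  rewrite setTI esum_set1 ?lee_fin // esum1 ?adde0 // => y [_ /eqP yx].
  by rewrite fx.
split; last by rewrite /possum e.
rewrite /abs_summable; under eq_esum do rewrite ger0_norm //.
by rewrite e ltry.
Qed.

Lemma realsum_single f (x : T) : (forall y, y != x -> f y = 0) ->
  realsum f = f x.
Proof.
move=> fx.
have [ps pE] := @possum_single (posp f) x (pos0 f) (fun y yx => ltac:(
  by rewrite /posp fx // maxxx)).
have [ns nE] := @possum_single (negp f) x (neg0 f) (fun y yx => ltac:(
  by rewrite /negp fx // oppr0 maxxx)).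
by rewrite realsumE pE nE -posnegE.
Qed.

End RealSum.

Section ComplexSum.
Variables (R : realType) (T : choiceType).
Implicit Types g h : T -> Cplx R.

Lemma conjcE (z : Cplx R) : z^* = (complex.Re z -i* complex.Im z)%C.
Proof. by case: z. Qed.

Definition csum h : Cplx R :=
  (realsum (fun x => complex.Re (h x)) +i* realsum (fun x => complex.Im (h x)))%C.

Definition csummable h : Prop :=
  abs_summable (fun x => complex.Re (h x)) /\
  abs_summable (fun x => complex.Im (h x)).

Lemma ReD (z w : Cplx R) : complex.Re (z + w) = complex.Re z + complex.Re w.
Proof. by case: z; case: w. Qed.
Lemma ImD (z w : Cplx R) : complex.Im (z + w) = complex.Im z + complex.Im w.
Proof. by case: z; case: w. Qed.
Lemma ReM (z w : Cplx R) : complex.Re (z * w) =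
  complex.Re z * complex.Re w + (- complex.Im z) * complex.Im w.
Proof. by case: z => a b; case: w => c d; rewrite mulNr. Qed.
Lemma ImM (z w : Cplx R) : complex.Im (z * w) =
  complex.Re z * complex.Im w + complex.Im z * complex.Re w.
Proof. by case: z => a b; case: w. Qed.

Lemma csumD g h : csummable g -> csummable h ->
  csum (fun x => g x + h x) = csum g + csum h.
Proof.
move=> [g1 g2] [h1 h2]; rewrite /csum.
under [fun x => complex.Re _]eq_fun do rewrite ReD.
under [fun x => complex.Im _]eq_fun do rewrite ImD.
by rewrite !realsumD.
Qed.

Lemma csumZ (c : Cplx R) h : csummable h ->
  csum (fun x => c * h x) = c * csum h.
Proof.
move=> [h1 h2]; rewrite /csum.
under [fun x => complex.Re _]eq_fun do rewrite ReM.
under [fun x => complex.Im _]eq_fun do rewrite ImM.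
rewrite !realsumD ?realsumZ //; try exact: abs_summableZ.
by case: c => a b /=; congr Complex; rewrite mulNr.
Qed.

Lemma csum_conj h : csum (fun x => (h x)^*) = (csum h)^*.
Proof.
rewrite conjcE /csum /= -realsumN.
by congr Complex; congr realsum; apply/funext => x; case: (h x).
Qed.

Lemma csum_single h (x : T) : (forall y, y != x -> h y = 0) -> csum h = h x.
Proof.
move=> hx; rewrite /csum (@realsum_single _ _ _ x); last by move=> y /hx->.
rewrite (@realsum_single _ _ _ x); last by move=> y /hx->.
by case: (h x).
Qed.

End ComplexSum.

(** * The Hilbert space l2 *)

Section HilbertSpace.
Variables (R : realType) (T : choiceType).
Implicit Types u v w : l2 R T.

Lemma l2ext u v : (forall x, u x = v x) -> u = v.
Proof. by move=> uv; apply: val_inj; apply/funext. Qed.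

Lemma l2D u v x : (u + v) x = u x + v x. Proof. by []. Qed.
Lemma l2N u x : (- u) x = - u x. Proof. by []. Qed.
Lemma l2Z a u x : (a *: u) x = a * u x. Proof. by []. Qed.
Lemma l20 x : (0 : l2 R T) x = 0. Proof. by []. Qed.
Lemma l2_sum I (r : seq I) (P : pred I) (F : I -> l2 R T) x :
  (\sum_(i <- r | P i) F i) x = \sum_(i <- r | P i) F i x.
Proof. by elim/big_rec2: _ => // i y1 y2 _ <-. Qed.

Lemma ketE (x y : T) : ket R x y = (y == x)%:R. Proof. by []. Qed.

Lemma normc2_summable u : abs_summable (fun x => normc2 (u x)).
Proof.
have /asboolP := l2P u; rewrite /abs_summable /sqsum.
by under [X in _ -> (X < _)%E]eq_esum do rewrite ger0_norm ?normc2_ge0 //.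
Qed.

Definition nsq u : R := possum (fun x => normc2 (u x)).

Lemma nsq_ge0 u : 0 <= nsq u.
Proof. by apply: possum_ge0 => x; exact: normc2_ge0. Qed.

Lemma l2normE u : l2norm u = Num.sqrt (nsq u). Proof. by []. Qed.

Lemma sqr_l2norm u : l2norm u ^+ 2 = nsq u.
Proof. by rewrite l2normE sqr_sqrtr // nsq_ge0. Qed.

Lemma l2norm_ge0 u : 0 <= l2norm u. Proof. exact: sqrtr_ge0. Qed.

Lemma normc2_le_nsq u x : normc2 (u x) <= nsq u.
Proof.
have h : abs_summable (fun y => (y == x)%:R * normc2 (u y)) /\
    possum (fun y => (y == x)%:R * normc2 (u y)) = (x == x)%:R * normc2 (u x).
  apply: possum_single => y; first by rewrite mulr_ge0 ?normc2_ge0.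
  by move=> /negPf->; rewrite mul0r.
have [_] := h; rewrite eqxx mul1r => <-.
apply: le_possum; [by move=> y; rewrite mulr_ge0 ?normc2_ge0|
  exact: normc2_summable|move=> y].
by case: eqP; rewrite ?mul1r // mul0r normc2_ge0.
Qed.

Lemma normc2_eq0 (z : Cplx R) : normc2 z = 0 -> z = 0.
Proof.
case: z => a b; rewrite /normc2 /= => /eqP.
by rewrite paddr_eq0 ?sqr_ge0 // !sqrf_eq0 => /andP[/eqP-> /eqP->].
Qed.

Lemma nsq_eq0 u : nsq u = 0 -> u = 0.
Proof.
move=> u0; apply: l2ext => x; apply: normc2_eq0; apply/eqP.
by rewrite eq_le normc2_ge0 andbT -u0 normc2_le_nsq.
Qed.

(** Real and imaginary parts of conj(u x) * v x are dominated by |u x|^2 + |v x|^2; the squares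
    supplied to [nra] are those whose expansion contains the mixed products. *)
Lemma inner_summable u v : csummable (fun x => (u x)^* * v x).
Proof.
have s := abs_summableD (normc2_summable u) (normc2_summable v).
split; apply: (abs_summable_le _ s) => x /=;
  case: (u x) (v x) => [a b] [c d]; rewrite /normc2 /= ler_norml !expr2.
  have := sqr_ge0 (a - c); have := sqr_ge0 (b - d); have := sqr_ge0 (a + c).
  have := sqr_ge0 (b + d); rewrite !expr2 => *; apply/andP; split; nra.
have := sqr_ge0 (a - d); have := sqr_ge0 (b - c); have := sqr_ge0 (a + d).
have := sqr_ge0 (b + c); rewrite !expr2 => *; apply/andP; split; nra.
Qed.

Lemma innerE u v : inner u v = csum (fun x => (u x)^* * v x). Proof. by []. Qed.

Lemma innerC u v : inner u v = (inner v u)^*.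
Proof.
rewrite !innerE -csum_conj; congr csum; apply/funext => x.
by rewrite rmorphM /= conjCK mulrC.
Qed.

Lemma innerDr u v w : inner u (v + w) = inner u v + inner u w.
Proof.
rewrite !innerE -csumD; try exact: inner_summable.
by congr csum; apply/funext => x; rewrite l2D mulrDr.
Qed.

Lemma innerZr a u v : inner u (a *: v) = a * inner u v.
Proof.
rewrite !innerE -csumZ; last exact: inner_summable.
by congr csum; apply/funext => x; rewrite l2Z mulrCA.
Qed.

Lemma innerDl u v w : inner (u + v) w = inner u w + inner v w.
Proof. by rewrite innerC innerDr rmorphD /= -!innerC. Qed.

Lemma innerZl a u v : inner (a *: u) v = a^* * inner u v.
Proof. by rewrite innerC innerZr rmorphM /= -innerC. Qed.

Lemma inner0r u : inner u 0 = 0.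
Proof. by rewrite -(scale0r (0 : l2 R T)) innerZr mul0r. Qed.

Lemma inner0l u : inner 0 u = 0.
Proof. by rewrite innerC inner0r rmorph0. Qed.

Lemma innerNr u v : inner u (- v) = - inner u v.
Proof. by rewrite -scaleN1r innerZr mulN1r. Qed.

Lemma innerNl u v : inner (- u) v = - inner u v.
Proof. by rewrite innerC innerNr rmorphN /= -innerC. Qed.

Lemma inner_sumr u I (r : seq I) (P : pred I) (F : I -> l2 R T) :
  inner u (\sum_(i <- r | P i) F i) = \sum_(i <- r | P i) inner u (F i).
Proof.
by elim/big_rec2: _ => [|i y1 y2 _ <-]; rewrite ?inner0r ?innerDr.
Qed.

Lemma inner_suml u I (r : seq I) (P : pred I) (F : I -> l2 R T) :
  inner (\sum_(i <- r | P i) F i) u = \sum_(i <- r | P i) inner (F i) u.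
Proof.
by elim/big_rec2: _ => [|i y1 y2 _ <-]; rewrite ?inner0l ?innerDl.
Qed.

Lemma inner_self u : inner u u = ((nsq u)%:C)%C.
Proof.
rewrite innerE /csum; congr Complex.
  have e x : complex.Re ((u x)^* * u x) = normc2 (u x).
    by case: (u x) => a b; rewrite /normc2 /= !expr2 mulNr opprK.
  under eq_fun do rewrite e.
  by rewrite realsum_pos //; [move=> x; exact: normc2_ge0|exact: normc2_summable].
have e x : complex.Im ((u x)^* * u x) = 0.
  by case: (u x) => a b /=; ring.
under eq_fun do rewrite e.
by rewrite /realsum oppr0 subrr.
Qed.

Lemma inner_ketl x u : inner (ket R x) u = u x.
Proof.
rewrite innerE (@csum_single _ _ _ x) ?ketE ?eqxx ?conjC1 ?mul1r //.
by move=> y /negPf yx; rewrite ketE yx conjC0 mul0r.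
Qed.

Lemma inner_ketr x u : inner u (ket R x) = (u x)^*.
Proof. by rewrite innerC inner_ketl. Qed.

Lemma nsq_ket x : nsq (ket R x) = 1.
Proof.
have := inner_self (ket R x); rewrite inner_ketl ketE eqxx.
by move/(congr1 (@complex.Re R)) => /= <-.
Qed.

Lemma nsqZ a u : nsq (a *: u) = normc2 a * nsq u.
Proof.
have := inner_self (a *: u); rewrite innerZl innerZr inner_self.
move/(congr1 (@complex.Re R)) => /= <-.
case: a => a b; rewrite /normc2 /=; ring.
Qed.

Lemma nsqD u v :
  nsq (u + v) = nsq u + nsq v + 2 * complex.Re (inner u v).
Proof.
have := inner_self (u + v); rewrite innerDl !innerDr !inner_self (innerC v u).
move/(congr1 (@complex.Re R)); case: (inner u v) => a b /= => <-; ring.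
Qed.

Lemma nsqN u : nsq (- u) = nsq u.
Proof.
by congr possum; apply/funext => x; rewrite l2N; case: (u x) => a b;
  rewrite /normc2 /= !sqrrN.
Qed.

Lemma cauchy_schwarz u v : normc2 (inner u v) <= nsq u * nsq v.
Proof.
have [u0|un] := eqVneq (nsq u) 0.
  by rewrite (nsq_eq0 u0) inner0l /normc2 /= !expr0n addr0 mulr_ge0 ?nsq_ge0.
have up : 0 < nsq u by rewrite lt_def un nsq_ge0.
(* This vector is |u|^2 times the component of v orthogonal to u; its squared norm is |u|^2 (|u|^2
   |v|^2 - |<u|v>|^2). *)
have := nsq_ge0 ((nsq u)%:C%C *: v + (- inner u v) *: u).
rewrite nsqD !nsqZ innerZl innerZr (innerC v u).
have -> : normc2 ((nsq u)%:C%C : Cplx R) = nsq u ^+ 2.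
  by rewrite /normc2 /= expr0n addr0.
case: (inner u v) => a b; rewrite /normc2 /= => H.
rewrite -(ler_pM2l up) -subr_ge0; apply: le_trans H _.
rewrite le_eqVlt; apply/orP; left; apply/eqP; ring.
Qed.

End HilbertSpace.

(** * Norm, finitely supported vectors, Bessel's inequality *)

Section Norm.
Variables (R : realType) (T : choiceType).
Implicit Types u v w : l2 R T.

Definition cmod (z : Cplx R) : R := Num.sqrt (normc2 z).

Lemma sqr_cmod z : cmod z ^+ 2 = normc2 z.
Proof. by rewrite sqr_sqrtr // normc2_ge0. Qed.

Lemma cmod_ge0 z : 0 <= cmod z. Proof. exact: sqrtr_ge0. Qed.

Lemma normcE (z : Cplx R) : `|z| = ((cmod z)%:C)%C.
Proof. by case: z => a b. Qed.

Lemma cmod_le (z : Cplx R) (e : R) : (cmod z <= e) = (`|z| <= (e%:C)%C).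
Proof. by rewrite normcE lecR. Qed.

Lemma l2normZ a u : l2norm (a *: u) = cmod a * l2norm u.
Proof. by rewrite !l2normE nsqZ sqrtrM // normc2_ge0. Qed.

Lemma l2normN u : l2norm (- u) = l2norm u.
Proof. by rewrite !l2normE nsqN. Qed.

Lemma l2norm_eq0 u : l2norm u = 0 -> u = 0.
Proof.
by move=> u0; apply: nsq_eq0; rewrite -sqr_l2norm u0 expr0n.
Qed.

Lemma l2norm0 : l2norm (0 : l2 R T) = 0.
Proof.
have := l2normZ 0 (0 : l2 R T).
by rewrite scale0r /cmod /normc2 /= expr0n addr0 sqrtr0 mul0r.
Qed.

Lemma l2norm_ket (x : T) : l2norm (ket R x) = 1.
Proof. by rewrite l2normE nsq_ket sqrtr1. Qed.

Lemma cmod_inner u v : cmod (inner u v) <= l2norm u * l2norm v.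
Proof.
by rewrite -sqrtrM ?nsq_ge0 // ler_sqrt ?cauchy_schwarz // mulr_ge0 ?nsq_ge0.
Qed.

Lemma Re_le_cmod z : complex.Re z <= cmod z.
Proof.
case: z => a b; rewrite /cmod /normc2 /=.
apply: (le_trans (ler_norm a)); rewrite -sqrtr_sqr ler_sqrt ?lerDl ?sqr_ge0 //.
by rewrite addr_ge0 ?sqr_ge0.
Qed.

Lemma l2normD u v : l2norm (u + v) <= l2norm u + l2norm v.
Proof.
have h := addr_ge0 (l2norm_ge0 u) (l2norm_ge0 v).
rewrite -(@ler_pXn2r _ 2) ?nnegrE ?l2norm_ge0 //.
rewrite sqr_l2norm nsqD sqrrD !sqr_l2norm.
have := le_trans (Re_le_cmod (inner u v)) (cmod_inner u v).
by move=> ?; rewrite mulr2n; lra.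
Qed.

Lemma l2norm_sum I (r : seq I) (P : pred I) (F : I -> l2 R T) :
  l2norm (\sum_(i <- r | P i) F i) <= \sum_(i <- r | P i) l2norm (F i).
Proof.
elim/big_rec2: _ => [|i y1 y2 _ h]; first by rewrite l2norm0.
by apply: (le_trans (l2normD _ _)); rewrite lerD2l.
Qed.

Lemma l2norm_small u (C : R) : (forall e : R, 0 < e -> l2norm u <= C * e) -> u = 0.
Proof.
move=> h; apply: l2norm_eq0; apply/eqP; rewrite eq_le l2norm_ge0 andbT.
apply/ler_addgt0Pl => e e0; rewrite addr0.
have d0 : 0 < `|C| + 1 by rewrite ltr_wpDl.
apply: (le_trans (h (e / (`|C| + 1)) _)); first by rewrite divr_gt0.
rewrite mulrA ler_pdivrMr // mulrC ler_wpM2l ?(ltW e0) //.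
by rewrite (le_trans (ler_norm C)) // lerDl.
Qed.

Definition fvec (s : seq T) (c : T -> Cplx R) : l2 R T :=
  \sum_(x <- s) c x *: ket R x.

Lemma fvecE s c y : uniq s -> fvec s c y = (y \in s)%:R * c y.
Proof.
rewrite /fvec; elim: s => [|x s IH] /=; first by rewrite big_nil mul0r.
move=> /andP[xs us]; rewrite big_cons l2D IH // l2Z ketE in_cons.
have [->|] := eqVneq y x; last by rewrite mulr0 add0r.
by rewrite (negPf xs) mulr1 mul0r addr0 mul1r.
Qed.

Lemma inner_fvecl s c u : inner (fvec s c) u = \sum_(x <- s) (c x)^* * u x.
Proof.
by rewrite inner_suml; apply: eq_bigr => x _; rewrite innerZl inner_ketl.
Qed.

Lemma conjMc (z : Cplx R) : z^* * z = (normc2 z)%:C%C.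
Proof.
case: z => a b; rewrite conjcE /normc2 /= !expr2.
by congr Complex; ring.
Qed.

Lemma nsq_fvec s c : uniq s -> nsq (fvec s c) = \sum_(x <- s) normc2 (c x).
Proof.
move=> us; apply: complexI; rewrite -inner_self inner_fvecl.
rewrite big_seq rmorph_sum [RHS]big_seq /=; apply: eq_bigr => x xs.
by rewrite fvecE // xs mul1r conjMc.
Qed.

(** [sqsum] is a supremum over finite sets, so a uniform bound on finite partial sums puts [h] in
    l2. Adjoints and all concrete operators are obtained in this way. *)
Lemma square_summable_bound (h : T -> Cplx R) (M : R) :
  (forall s, uniq s -> \sum_(x <- s) normc2 (h x) <= M) ->
  exists2 u : l2 R T, l2_fun u = h & nsq u <= M.
Proof.
move=> hM.
have hs : (sqsum h <= M%:E)%E.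
  apply: ge_ereal_sup => _ [A [fA _] <-].
  by rewrite fsbig_finite // sumEFin lee_fin hM.
have hP : h \in @square_summable R T.
  by apply/asboolP; apply: le_lt_trans hs _; rewrite ltry.
exists (L2 hP) => //.
rewrite -lee_fin -possumE //; first by move=> x; exact: normc2_ge0.
exact: (normc2_summable (L2 hP)).
Qed.

Lemma nsq_sub_fvec u s : uniq s ->
  nsq (u - fvec s u) = nsq u - \sum_(x <- s) normc2 (u x).
Proof.
move=> us; rewrite nsqD nsqN innerNr innerC inner_fvecl nsq_fvec //.
rewrite (eq_bigr (fun x => (normc2 (u x))%:C%C)); last by move=> x _; rewrite conjMc.
by rewrite -rmorph_sum conjcE /=; lra.
Qed.

Lemma bessel u s : uniq s -> \sum_(x <- s) normc2 (u x) <= nsq u.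
Proof. by move=> us; rewrite -subr_ge0 -nsq_sub_fvec // nsq_ge0. Qed.

(** By [nsq_sub_fvec] the squared error is the part of the sum outside [s], which is small once the
    finite sum is within e^2 of the supremum. *)
Lemma l2_approx u (e : R) : 0 < e ->
  exists2 s, uniq s & l2norm (u - fvec s u) < e.
Proof.
move=> e0.
have uE : (\esum_(x in [set: T]) (normc2 (u x))%:E)%E = (nsq u)%:E.
  apply: possumE; [by move=> x; exact: normc2_ge0|exact: normc2_summable].
have : ((nsq u - e ^+ 2)%:E < \esum_(x in [set: T]) (normc2 (u x))%:E)%E.
  by rewrite uE lte_fin ltrBlDr ltrDl exprn_gt0.
move=> /ereal_sup_gt[_ [A [fA _] <-]].
rewrite fsbig_finite //= sumEFin lte_fin => h.
exists (finmap.enum_fset (fset_set A)); first exact: finmap.fset_uniq.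
rewrite -(@ltr_pXn2r _ 2) ?nnegrE ?l2norm_ge0 ?(ltW e0) //.
by rewrite sqr_l2norm nsq_sub_fvec ?finmap.fset_uniq //; lra.
Qed.

End Norm.

Section Bounded.
Variable R : realType.

Definition bnd (S T : choiceType) (M : R) (F : l2 R S -> l2 R T) : Prop :=
  forall u, l2norm (F u) <= M * l2norm u.

Lemma bnd_wide (S T : choiceType) (M M' : R) (F : l2 R S -> l2 R T) :
  M <= M' -> bnd M F -> bnd M' F.
Proof.
by move=> MM FM u; rewrite (le_trans (FM u)) // ler_wpM2r ?l2norm_ge0.
Qed.

Lemma bnd_ge0 (S T : choiceType) (M : R) (F : l2 R S -> l2 R T) :
  bnd M F -> bnd `|M| F.
Proof. by apply: bnd_wide; rewrite ler_norm. Qed.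

Variables (S T : choiceType).

Section Linear.
Variable F : l2 R S -> l2 R T.
Hypothesis lF : linear F.
Lemma lin0 : F 0 = 0.
Proof. by have := lF (-1) 0 0; rewrite scaleN1r oppr0 addr0 scaleN1r addNr. Qed.
Lemma linZ a u : F (a *: u) = a *: F u.
Proof. by have := lF a u 0; rewrite !addr0 lin0 addr0. Qed.
Lemma linD u v : F (u + v) = F u + F v.
Proof. by have := lF 1 u v; rewrite !scale1r. Qed.
Lemma linN u : F (- u) = - F u.
Proof. by rewrite -scaleN1r linZ scaleN1r. Qed.
Lemma linB u v : F (u - v) = F u - F v.
Proof. by rewrite linD linN. Qed.
Lemma lin_sum I (r : seq I) (P : pred I) (G : I -> l2 R S) :
  F (\sum_(i <- r | P i) G i) = \sum_(i <- r | P i) F (G i).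
Proof. by elim/big_rec2: _ => [|i y1 y2 _ <-]; rewrite ?lin0 ?linD. Qed.
Lemma lin_fvec s c : F (fvec s c) = \sum_(x <- s) c x *: F (ket R x).
Proof. by rewrite lin_sum; apply: eq_bigr => x _; rewrite linZ. Qed.
End Linear.

(** F and G agree on finitely supported vectors, so their difference at u only sees the remainder of
    an approximation of u, which both maps keep small. *)
Lemma lin_ext (F G : l2 R S -> l2 R T) M M' : linear F -> linear G ->
  bnd M F -> bnd M' G -> (forall x, F (ket R x) = G (ket R x)) -> F = G.
Proof.
move=> lF lG FM GM FG; apply/funext => u; apply/eqP; rewrite -subr_eq0; apply/eqP.
apply: (@l2norm_small _ _ _ (`|M| + `|M'|)) => e e0.
have [s us su] := l2_approx u e0.
have -> : F u - G u = F (u - fvec s u) - G (u - fvec s u).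
  rewrite !linB // !lin_fvec //.
  rewrite (eq_bigr (fun x => u x *: G (ket R x))) => [|x _]; last by rewrite FG.
  by rewrite opprB addrA subrK.
apply: (le_trans (l2normD _ _)); rewrite l2normN mulrDl.
by apply: lerD; [apply: (le_trans (bnd_ge0 FM _))|apply: (le_trans (bnd_ge0 GM _))];
  rewrite ler_wpM2l // ltW.
Qed.

Lemma adjoint_pair (F : l2 R S -> l2 R T) (G : l2 R T -> l2 R S) M M' :
  linear F -> bnd M F -> bnd M' G ->
  (forall x v, inner (F (ket R x)) v = G v x) ->
  forall u v, inner (F u) v = inner u (G v).
Proof.
move=> lF FM GM GE u v.
apply/eqP; rewrite -subr_eq0; apply/eqP; apply: normc2_eq0.
suff: cmod (inner (F u) v - inner u (G v)) = 0.
  by move=> h0; rewrite -sqr_cmod h0 expr0n.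
apply/eqP; rewrite eq_le cmod_ge0 andbT.
apply/ler_addgt0Pl => e e0; rewrite addr0.
(* The difference of the two inner products is conjugate-linear in u with bound C - 1; the added 1
   allows division by C. *)
pose C := (`|M| + `|M'|) * l2norm v + 1.
have C0 : 0 < C by rewrite ltr_wpDl // mulr_ge0 ?addr_ge0 ?l2norm_ge0.
have [s us su] := l2_approx u (divr_gt0 e0 C0).
have -> : inner (F u) v - inner u (G v) =
    inner (F (u - fvec s u)) v - inner (u - fvec s u) (G v).
  rewrite linB // !innerDl !innerNl lin_fvec // inner_suml inner_fvecl.
  rewrite (eq_bigr (fun x => (u x)^* * G v x)) => [|x _]; last by rewrite innerZl GE.
  by rewrite opprB addrA subrK.
have tri (z w : Cplx R) : cmod (z - w) <= cmod z + cmod w.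
  by rewrite cmod_le rmorphD /= -!normcE ler_normB.
apply: (le_trans (tri _ _)).
apply: (le_trans (lerD (cmod_inner _ _) (cmod_inner _ _))).
apply: (@le_trans _ _ (C * l2norm (u - fvec s u))); last first.
  by rewrite mulrC -ler_pdivlMr // ltW.
set d := l2norm (u - _); have d0 : 0 <= d by exact: l2norm_ge0.
have h1 : l2norm (F (u - fvec s u)) * l2norm v <= `|M| * d * l2norm v.
  by rewrite ler_wpM2r ?l2norm_ge0 // bnd_ge0.
have h2 : d * l2norm (G v) <= d * (`|M'| * l2norm v).
  by rewrite ler_wpM2l // bnd_ge0.
by apply: (le_trans (lerD h1 h2)); rewrite /C; lra.
Qed.

End Bounded.

(** * Bounded operators and adjoints *)

Section BoundedOp.
Variables (R : realType) (T : choiceType).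
Implicit Types F G K : l2 R T -> l2 R T.

Lemma bop_lin F : bounded_op F -> linear F. Proof. by case. Qed.

Lemma bopP F : bounded_op F -> exists2 M : R, 0 <= M & bnd M F.
Proof. by move=> [_ [M FM]]; exists `|M| => //; exact: bnd_ge0. Qed.

Lemma bop_ext F G : bounded_op F -> bounded_op G ->
  (forall x, F (ket R x) = G (ket R x)) -> F = G.
Proof. by move=> [lF [M FM]] [lG [M' GM]]; exact: lin_ext. Qed.

Lemma bop_ext_entry F G : bounded_op F -> bounded_op G ->
  (forall x y, F (ket R x) y = G (ket R x) y) -> F = G.
Proof. by move=> bF bG h; apply: bop_ext => // x; apply: l2ext. Qed.

Lemma bop0 : bounded_op (fun _ : l2 R T => 0 : l2 R T).
Proof.
split=> [a u v|]; first by rewrite scaler0 addr0.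
by exists 0 => u; rewrite l2norm0 mul0r.
Qed.

Lemma bop_lc a F G : bounded_op F -> bounded_op G ->
  bounded_op (fun u => a *: F u + G u).
Proof.
move=> [lF [M FM]] [lG [M' GM]]; split=> [b u v|].
  by rewrite lF lG !scalerDr !scalerA addrACA [a * b]mulrC.
exists (cmod a * M + M') => u; apply: (le_trans (l2normD _ _)).
by rewrite l2normZ mulrDl lerD // -mulrA ler_wpM2l ?cmod_ge0.
Qed.

Lemma bopD F G : bounded_op F -> bounded_op G -> bounded_op (fun u => F u + G u).
Proof.
by move=> bF bG; have := bop_lc 1 bF bG; under eq_fun do rewrite scale1r.
Qed.

Lemma bopB F G : bounded_op F -> bounded_op G -> bounded_op (fun u => F u - G u).
Proof.
move=> bF bG; have := bop_lc (-1) bG bF.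
by under eq_fun do rewrite scaleN1r addrC.
Qed.

Lemma bop_comp F G : bounded_op F -> bounded_op G -> bounded_op (F \o G).
Proof.
move=> bF bG; have [M M0 FM] := bopP bF; have [M' M'0 GM] := bopP bG.
split=> [a u v|] /=; first by rewrite (bop_lin bG) (bop_lin bF).
exists (M * M') => u; apply: (le_trans (FM _)).
by rewrite -mulrA ler_wpM2l.
Qed.

Lemma bop_sum I (r : seq I) (P : pred I) (F : I -> l2 R T -> l2 R T) :
  (forall i, bounded_op (F i)) ->
  bounded_op (fun u => \sum_(i <- r | P i) F i u).
Proof.
move=> bF; elim: r => [|i r IH].
  by under eq_fun do rewrite big_nil; exact: bop0.
under eq_fun do rewrite big_cons; case: (P i) => //.
exact: bopD.
Qed.

Lemma opnorm_le F M : bounded_op F -> 0 <= M -> bnd M F -> opnorm F <= M.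
Proof.
move=> bF M0 FM; apply: ge_sup; first by exists (l2norm (F 0)), 0 => //; rewrite /= l2norm0.
move=> _ [u /= u1 <-]; apply: (le_trans (FM u)).
by rewrite -[leRHS]mulr1 ler_wpM2l.
Qed.

Lemma bnd_opnorm F : bounded_op F -> bnd (opnorm F) F.
Proof.
move=> bF u; have [M M0 FM] := bopP bF.
have hub : has_ubound [set l2norm (F u) | u in [set u | l2norm u <= 1]].
  exists M => _ [v /= v1 <-]; apply: (le_trans (FM v)).
  by rewrite -[leRHS]mulr1 ler_wpM2l.
have [u0|un] := eqVneq (l2norm u) 0.
  by rewrite (l2norm_eq0 u0) (lin0 (bop_lin bF)) l2norm0 mulr0.
have up : 0 < l2norm u by rewrite lt_def un l2norm_ge0.
rewrite -ler_pdivrMr //.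
have -> : l2norm (F u) / l2norm u = l2norm (F ((l2norm u)^-1%:C%C *: u)).
  rewrite (linZ (bop_lin bF)) l2normZ mulrC /cmod /normc2 /= expr0n addr0.
  by rewrite sqrtr_sqr ger0_norm // invr_ge0 l2norm_ge0.
apply: ub_le_sup => //; exists ((l2norm u)^-1%:C%C *: u) => //=.
rewrite l2normZ /cmod /normc2 /= expr0n addr0 sqrtr_sqr ger0_norm ?invr_ge0 ?l2norm_ge0 //.
by rewrite mulVf.
Qed.

(** Explicit bounds [bnd e] pass through sums and compositions more easily than the supremum
    [opnorm]. Halving e turns such a bound into a strict inequality for [opnorm]. *)
Lemma norm_closedP (V : set (l2 R T -> l2 R T)) : V `<=` @bounded_op R T ->
  norm_closed V <->
  (forall F, bounded_op F ->
     (forall e : R, 0 < e -> exists2 G, V G & bnd e (fun u => F u - G u)) -> V F).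
Proof.
move=> Vb; split=> h F bF approx; apply: h => // e e0.
  have [|G VG FG] := approx (e / 2); first by rewrite divr_gt0.
  exists G => //; apply: (@le_lt_trans _ _ (e / 2)).
    by apply: opnorm_le => //; [apply: bopB => //; exact: Vb|rewrite divr_ge0 // ltW].
  by rewrite ltr_pdivrMr // ltr_pMr // ltr1n.
have [G VG FG] := approx e e0; exists G => //.
by apply: bnd_wide (ltW FG) _; apply: bnd_opnorm; apply: bopB => //; exact: Vb.
Qed.

Lemma the_op_eq (P : set (l2 R T -> l2 R T)) K : bounded_op K -> P K ->
  (forall K', bounded_op K' -> P K' -> forall x, K' (ket R x) = K (ket R x)) ->
  the_op P = K.
Proof.
move=> bK PK uK; apply: xget_unique => // K' [bK' PK'].
by apply: bop_ext => //; exact: uK.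
Qed.

(** The coordinates of G v have to be <F e_x|v>. For square-summability, let c be their restriction
    to a finite set: |c|^2 = <F c|v> is at most M |c| |v| by Cauchy-Schwarz, hence |c| is at most M
    |v|. *)
Lemma adjoint_exists F : bounded_op F ->
  exists2 G, bounded_op G & forall u v, inner (F u) v = inner u (G v).
Proof.
move=> bF; have [M M0 FM] := bopP bF; have lF := bop_lin bF.
have h v : exists2 w : l2 R T, l2_fun w = (fun x => inner (F (ket R x)) v) &
    nsq w <= M ^+ 2 * nsq v.
  apply: square_summable_bound => s us.
  set c := fun x => inner (F (ket R x)) v.
  have e : inner (F (fvec s c)) v = ((nsq (fvec s c))%:C)%C.
    rewrite lin_fvec // inner_suml nsq_fvec // rmorph_sum /=.
    by apply: eq_bigr => x _; rewrite innerZl conjMc.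
  rewrite -nsq_fvec //; set a := nsq _ in e *.
  have a0 : 0 <= a by exact: nsq_ge0.
  have := cauchy_schwarz (F (fvec s c)) v; rewrite e.
  rewrite {1}/normc2 /= expr0n addr0 -[nsq (F _)]sqr_l2norm => h.
  have : a ^+ 2 <= (M ^+ 2 * a) * nsq v.
    apply: (le_trans h); rewrite ler_wpM2r ?nsq_ge0 //.
    rewrite /a -(sqr_l2norm (fvec _ _)) -exprMn.
    by rewrite lerXn2r ?nnegrE ?mulr_ge0 ?l2norm_ge0.
  have [->|an] := eqVneq a 0; first by rewrite mulr_ge0 ?sqr_ge0 ?nsq_ge0.
  have ap : 0 < a by rewrite lt_def an.
  by rewrite mulrAC expr2 ler_pM2r.
pose G v := sval (cid2 (h v)).
have GE v x : G v x = inner (F (ket R x)) v.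
  by rewrite /G; case: cid2 => w /= ->.
have Gn v : l2norm (G v) <= M * l2norm v.
  rewrite -(@ler_pXn2r _ 2) ?nnegrE ?mulr_ge0 ?l2norm_ge0 // exprMn !sqr_l2norm.
  by rewrite /G; case: cid2.
have bG : bounded_op G.
  split; last by exists M.
  by move=> a u v; apply: l2ext => x; rewrite l2D l2Z !GE innerDr innerZr.
exists G => // u v.
have GM : bnd M G by exact: Gn.
exact: (adjoint_pair lF FM GM (fun x w => esym (GE w x))).
Qed.

Lemma adjointP F : bounded_op F -> bounded_op (adjoint F) /\
  forall u v, inner (F u) v = inner u (adjoint F v).
Proof.
move=> /adjoint_exists[G bG GP].
exact: (@xgetPex _ (fun=> 0) (@bounded_op R T `&` [set G |
  forall u v, inner (F u) v = inner u (G v)]) (ex_intro _ G (conj bG GP))).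
Qed.

Lemma adjoint_bop F : bounded_op F -> bounded_op (adjoint F).
Proof. by move=> /adjointP[]. Qed.

Lemma inner_adjoint F u v : bounded_op F -> inner (F u) v = inner u (adjoint F v).
Proof. by move=> /adjointP[_]. Qed.

Lemma adjointE F v x : bounded_op F -> adjoint F v x = inner (F (ket R x)) v.
Proof. by move=> bF; rewrite -[LHS]inner_ketl -inner_adjoint. Qed.

Lemma adjoint_entry F x y : bounded_op F ->
  adjoint F (ket R y) x = (F (ket R x) y)^*.
Proof.
by move=> bF; rewrite -inner_ketl -inner_adjoint // inner_ketr.
Qed.

Lemma adjoint_eq F G : bounded_op F -> bounded_op G ->
  (forall x y, G (ket R y) x = (F (ket R x) y)^*) -> adjoint F = G.
Proof.
move=> bF bG FG; apply: bop_ext_entry => //; first exact: adjoint_bop.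
by move=> x y; rewrite adjoint_entry.
Qed.

Lemma adjointK F : bounded_op F -> adjoint (adjoint F) = F.
Proof.
move=> bF; apply: adjoint_eq => //; first exact: adjoint_bop.
by move=> x y; rewrite adjoint_entry // conjCK.
Qed.

Lemma adjoint_comp F G : bounded_op F -> bounded_op G ->
  adjoint (F \o G) = adjoint G \o adjoint F.
Proof.
move=> bF bG; apply: adjoint_eq; first exact: bop_comp.
  by apply: bop_comp; apply: adjoint_bop.
move=> x y /=; rewrite -[LHS]inner_ketl -!inner_adjoint //.
by rewrite inner_ketr.
Qed.

Lemma adjoint_lc a F G : bounded_op F -> bounded_op G ->
  adjoint (fun u => a *: F u + G u) = (fun u => a^* *: adjoint F u + adjoint G u).
Proof.
move=> bF bG; apply: adjoint_eq; first exact: bop_lc.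
  by apply: bop_lc; exact: adjoint_bop.
by move=> x y; rewrite !l2D !l2Z !adjoint_entry // rmorphD rmorphM.
Qed.

Lemma adjoint0 : adjoint (fun _ : l2 R T => 0 : l2 R T) = (fun=> 0).
Proof. by apply: adjoint_eq; try exact: bop0; move=> x y; rewrite !l20 conjC0. Qed.

(** With G the adjoint of F, |G v|^2 = <F G v|v> is at most M |G v| |v|, and one factor |G v|
    cancels. *)
Lemma adjoint_bnd F M : bounded_op F -> bnd M F -> bnd M (adjoint F).
Proof.
move=> bF FM v; set G := adjoint F.
have [z|nz] := eqVneq (l2norm (G v)) 0.
  by rewrite z; exact: le_trans (l2norm_ge0 _) (FM v).
have p : 0 < l2norm (G v) by rewrite lt_def nz l2norm_ge0.
rewrite -(ler_pM2r p) -expr2 sqr_l2norm.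
have -> : nsq (G v) = complex.Re (inner (F (G v)) v).
  by rewrite inner_adjoint // inner_self.
apply: (le_trans (Re_le_cmod _)); apply: (le_trans (cmod_inner _ _)).
by rewrite mulrAC ler_wpM2r ?l2norm_ge0.
Qed.

End BoundedOp.

(** * Closed spans *)

Section Subspaces.
Variables (R : realType) (T : choiceType).
Implicit Types (F G : l2 R T -> l2 R T) (V W : set (l2 R T -> l2 R T)).

Lemma bounded_op_subspace : op_subspace (@bounded_op R T).
Proof. by split => //; [exact: bop0|move=> a F G; exact: bop_lc]. Qed.

Lemma subspace_bop W F : op_subspace W -> W F -> bounded_op F.
Proof. by case=> + _ _ => /(_ F). Qed.

Lemma subspaceD W F G : op_subspace W -> W F -> W G -> W (fun u => F u + G u).
Proof.
move=> [_ _ h] WF WG; have := h 1 _ _ WF WG.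
by under eq_fun do rewrite scale1r.
Qed.

Lemma subspaceZ W a F : op_subspace W -> W F -> W (fun u => a *: F u).
Proof.
move=> [_ W0 h] WF; have := h a _ _ WF W0.
by under eq_fun do rewrite addr0.
Qed.

Lemma subspace_sum W I (r : seq I) (P : pred I) (F : I -> l2 R T -> l2 R T) :
  op_subspace W -> (forall i, W (F i)) ->
  W (fun u => \sum_(i <- r | P i) F i u).
Proof.
move=> sW WF; elim: r => [|i r IH].
  by under eq_fun do rewrite big_nil; case: sW.
under eq_fun do rewrite big_cons; case: (P i) => //.
exact: subspaceD.
Qed.

Definition closed_subspace W := op_subspace W /\ norm_closed W.

Lemma bounded_op_closed : closed_subspace (@bounded_op R T).
Proof. by split; [exact: bounded_op_subspace|]. Qed.

Lemma closed_span_min V W : closed_subspace W -> V `<=` W -> closed_span V `<=` W.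
Proof. exact: smallest_sub. Qed.

Lemma sub_closed_span V : V `<=` closed_span V.
Proof. exact: sub_gen_smallest. Qed.

Lemma closed_span_closed V : V `<=` @bounded_op R T -> closed_subspace (closed_span V).
Proof.
move=> Vb; split.
  split.
  - by apply: closed_span_min => //; exact: bounded_op_closed.
  - by move=> W [[[_ W0 _] _] _].
  - move=> a F G sF sG W hW; have [[[_ _ Wl] _] _] := hW.
    by apply: Wl; [exact: sF|exact: sG].
move=> F bF h W hW; have [[_ cW] _] := hW; apply: cW => // e e0.
by have [G sG FG] := h e e0; exists G => //; exact: sG.
Qed.

Lemma closed_approx W F : closed_subspace W -> bounded_op F ->
  (forall e : R, 0 < e -> exists2 G, W G & bnd e (fun u => F u - G u)) -> W F.
Proof.
by move=> [[Wb _ _] cW] bF h; move: F bF h; apply/norm_closedP.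
Qed.

End Subspaces.

(* [s = id] covers linear maps such as [slice k], [s] the conjugation covers [adjoint]. *)
Record op_map (R : realType) (S T : choiceType) (s : Cplx R -> Cplx R) (C : R)
    (Phi : (l2 R S -> l2 R S) -> (l2 R T -> l2 R T)) : Prop := OpMap {
  op_map_bop : forall F, bounded_op F -> bounded_op (Phi F);
  op_map0 : Phi (fun=> 0) = (fun=> 0);
  op_map_lc : forall a F G, bounded_op F -> bounded_op G ->
    Phi (fun u => a *: F u + G u) = (fun u => s a *: Phi F u + Phi G u);
  op_map_bnd : forall F e, bounded_op F -> 0 <= e -> bnd e F -> bnd (C * e) (Phi F)
}.

Section OpMap.
Variables (R : realType).

Lemma op_mapB (S T : choiceType) s C
    (Phi : (l2 R S -> l2 R S) -> (l2 R T -> l2 R T)) F G :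
  op_map s C Phi -> bounded_op F -> bounded_op G ->
  Phi (fun u => F u - G u) = (fun u => Phi F u - Phi G u).
Proof.
move=> h bF bG; have := op_map_lc h (-1) bG bF.
have -> : (fun u => -1 *: G u + F u) = (fun u => F u - G u).
  by apply/funext => u; rewrite scaleN1r addrC.
move=> ->; apply/funext => u; rewrite addrC; congr (_ + _).
have := op_map_lc h (-1) bG bG.
have -> : (fun u => -1 *: G u + G u) = (fun=> 0).
  by apply/funext => v; rewrite scaleN1r addNr.
rewrite (op_map0 h) => /(congr1 (@^~ u)) /= /esym e1.
by apply/eqP; rewrite -subr_eq0 opprK e1.
Qed.

Lemma closed_subspace_preimage (S T : choiceType) s C
    (Phi : (l2 R S -> l2 R S) -> (l2 R T -> l2 R T)) W :
  op_map s C Phi -> closed_subspace W ->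
  closed_subspace [set F | bounded_op F /\ W (Phi F)].
Proof.
move=> h cW; have [sW _] := cW; have [Wb W0 Wl] := sW.
have sV : op_subspace [set F | bounded_op F /\ W (Phi F)].
  split=> [F []//||a F G [bF WF] [bG WG]].
    by split; [exact: bop0|rewrite (op_map0 h)].
  by split; [exact: bop_lc|rewrite (op_map_lc h) //; exact: Wl].
split=> //; have [Vb _ _] := sV.
apply/(norm_closedP Vb) => F bF approx; split=> //.
apply: closed_approx => //; first exact: (op_map_bop h).
move=> e e0; have C0 : 0 < `|C| + 1 by rewrite ltr_wpDl.
have [G [bG WG] FG] := approx _ (divr_gt0 e0 C0).
have bFG := bopB bF bG.
exists (Phi G) => //.
rewrite -(op_mapB h) //; apply: bnd_wide (op_map_bnd h bFG _ FG); last first.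
  by rewrite divr_ge0 ?ltW.
rewrite mulrA ler_pdivrMr // mulrC ler_wpM2l ?(ltW e0) //.
by rewrite (le_trans (ler_norm C)) // lerDl.
Qed.

(** The induction principle for closed spans: as Phi is continuous, the preimage of a closed
    subspace is one, so membership is checked on generators only. *)
Lemma closed_span_map (S T : choiceType) s C
    (Phi : (l2 R S -> l2 R S) -> (l2 R T -> l2 R T)) V W :
  op_map s C Phi -> closed_subspace W -> V `<=` @bounded_op R S ->
  (forall F, V F -> W (Phi F)) -> forall F, closed_span V F -> W (Phi F).
Proof.
move=> h cW Vb VW F sF.
have := closed_span_min (closed_subspace_preimage h cW).
by move=> /(_ V) => /(_ _ F sF)[] // G VG; split; [exact: Vb|exact: VW].
Qed.

Lemma op_map_adjoint (T : choiceType) :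
  op_map (fun a => a^*) 1 (@adjoint R T).
Proof.
split.
- exact: adjoint_bop.
- exact: adjoint0.
- by move=> a F G; exact: adjoint_lc.
- by move=> F e bF e0 FG; rewrite mul1r; exact: adjoint_bnd.
Qed.

Lemma op_map_compl (T : choiceType) (G : l2 R T -> l2 R T) M :
  bounded_op G -> 0 <= M -> bnd M G -> op_map id M (fun F => G \o F).
Proof.
move=> bG M0 GM; split.
- by move=> F bF; exact: bop_comp.
- by apply/funext => u /=; rewrite (lin0 (bop_lin bG)).
- by move=> a F K _ _; apply/funext => u /=; rewrite (bop_lin bG).
- move=> F e bF e0 FG u /=; apply: (le_trans (GM _)).
  by rewrite -mulrA ler_wpM2l.
Qed.

Lemma op_map_compr (T : choiceType) (G : l2 R T -> l2 R T) M :
  bounded_op G -> 0 <= M -> bnd M G -> op_map id M (fun F => F \o G).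
Proof.
move=> bG M0 GM; split=> //.
- by move=> F bF; exact: bop_comp.
- move=> F e bF e0 FG u /=; apply: (le_trans (FG _)).
  by rewrite [M * e]mulrC -mulrA ler_wpM2l.
Qed.

(** One factor at a time: with G fixed in the span, F is reduced to a generator; with that generator
    fixed, G is. *)
Lemma closed_span_mul (T : choiceType) (V1 V2 : set (l2 R T -> l2 R T)) W :
  V1 `<=` @bounded_op R T -> V2 `<=` @bounded_op R T -> closed_subspace W ->
  (forall F G, V1 F -> V2 G -> W (F \o G)) ->
  forall F G, closed_span V1 F -> closed_span V2 G -> W (F \o G).
Proof.
move=> V1b V2b cW VW F G sF sG.
have bG : bounded_op G.
  by have [/subspace_bop h _] := closed_span_closed V2b; exact: h.
have [M M0 GM] := bopP bG.
apply: (closed_span_map (op_map_compr bG M0 GM) cW V1b) sF => H V1H.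
have bH := V1b _ V1H; have [M' M'0 HM] := bopP bH.
apply: (closed_span_map (op_map_compl bH M'0 HM) cW V2b) sG => K V2K.
exact: VW.
Qed.

End OpMap.

(** * Reindexing and multiplication operators, slices *)

Section ConcreteOps.
Variable R : realType.

(** The default is the zero vector when [h] is not square-summable; [l2_ofP] rules this case out by
    a bound on finite sums. *)
Definition l2_of (T : choiceType) (h : T -> Cplx R) : l2 R T := insubd 0 h.

Lemma l2_ofP (T : choiceType) (h : T -> Cplx R) (M : R) :
  (forall s, uniq s -> \sum_(x <- s) normc2 (h x) <= M) ->
  (forall x, l2_of h x = h x) /\ nsq (l2_of h) <= M.
Proof.
move=> /square_summable_bound[u uh uM].
have -> : l2_of h = u; last by split => // x; rewrite -uh.
by apply: val_inj; rewrite /l2_of /= val_insubd -uh; case: u {uh uM} => /= u ->.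
Qed.

Lemma nsq_bnd (S T : choiceType) (F : l2 R S -> l2 R T) (M : R) :
  0 <= M -> (forall u, nsq (F u) <= M ^+ 2 * nsq u) -> bnd M F.
Proof.
move=> M0 h u; rewrite -(@ler_pXn2r _ 2) ?nnegrE ?mulr_ge0 ?l2norm_ge0 //.
by rewrite exprMn !sqr_l2norm.
Qed.

Section Reindex.
Variables (S T : choiceType).

(** Every coordinate of the source is read at most once, which makes [qop q] a contraction. *)
Definition pinj (q : T -> option S) : Prop :=
  forall t t' x, q t = Some x -> q t' = Some x -> t = t'.

(* Both [e_x |-> e_(w x)] (see [push]) and its adjoint (see [pull]) are of this form. *)
Definition qop (q : T -> option S) (u : l2 R S) : l2 R T :=
  l2_of (fun t => oapp u 0 (q t)).

Variable q : T -> option S.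
Hypothesis qi : pinj q.

Lemma qop_bound (u : l2 R S) s : uniq s ->
  \sum_(t <- s) normc2 (oapp u 0 (q t)) <= nsq u.
Proof.
move=> us; have us' : uniq (pmap q s).
  elim: s us => //= t s IH /andP[ts us].
  case qt : (q t) => [x|] /=; last exact: IH.
  rewrite IH // andbT mem_pmap; apply/mapP => -[t' t's qt'].
  by move: ts; rewrite (qi qt (esym qt')) t's.
apply: le_trans (bessel u us'); rewrite le_eqVlt; apply/orP; left; apply/eqP.
elim: s {us us'} => [|t s IH] /=; first by rewrite !big_nil.
rewrite big_cons IH; case: (q t) => [x|] /=; first by rewrite big_cons.
by rewrite /normc2 /= expr0n !add0r.
Qed.

Lemma qopE u t : qop q u t = oapp u 0 (q t).
Proof. by have [+ _] := l2_ofP (@qop_bound u); apply. Qed.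

Lemma qop_bnd : bnd 1 (qop q).
Proof.
apply: nsq_bnd => // u; rewrite expr1n mul1r.
by have [_] := l2_ofP (@qop_bound u).
Qed.

Lemma qop_lin : linear (qop q).
Proof.
move=> a u v; apply: l2ext => t; rewrite l2D l2Z !qopE.
by case: (q t) => //=; rewrite mulr0 addr0.
Qed.

End Reindex.

Lemma qop_bop (T : choiceType) (q : T -> option T) : pinj q -> bounded_op (qop q).
Proof.
by move=> qi; split; [exact: qop_lin|exists 1; exact: qop_bnd].
Qed.

Definition winv (S T : choiceType) (w : S -> T) (t : T) : option S :=
  if pselect (exists x, w x = t) is left h then Some (sval (cid h)) else None.

Lemma winvP (S T : choiceType) (w : S -> T) t x : winv w t = Some x -> w x = t.
Proof. by rewrite /winv; case: pselect => // h [] <-; exact: svalP (cid h). Qed.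

Lemma winvK (S T : choiceType) (w : S -> T) : injective w ->
  forall x, winv w (w x) = Some x.
Proof.
move=> wi x; rewrite /winv; case: pselect => [h|[]]; last by exists x.
by congr Some; case: cid => y /= /wi.
Qed.

Lemma winvN (S T : choiceType) (w : S -> T) t : (forall x, w x <> t) -> winv w t = None.
Proof. by move=> h; rewrite /winv; case: pselect => // e; exfalso; case: e => x; exact: h. Qed.

Lemma winv_pinj (S T : choiceType) (w : S -> T) : pinj (winv w).
Proof. by move=> t t' x /winvP <- /winvP. Qed.

Lemma some_pinj (S T : choiceType) (w : S -> T) : injective w -> pinj (Some \o w).
Proof. by move=> wi t t' x [<-] [/wi]. Qed.

Definition pull (S T : choiceType) (w : S -> T) : l2 R T -> l2 R S := qop (Some \o w).
Definition push (S T : choiceType) (w : S -> T) : l2 R S -> l2 R T := qop (winv w).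

Section PullPush.
Variables (S T : choiceType) (w : S -> T).
Hypothesis wi : injective w.

Lemma pullE u x : pull w u x = u (w x).
Proof. by rewrite /pull qopE //; exact: some_pinj. Qed.

Lemma pushE u x : push w u (w x) = u x.
Proof. by rewrite /push qopE ?winvK //; exact: winv_pinj. Qed.

Lemma pushN u t : (forall x, w x <> t) -> push w u t = 0.
Proof. by move=> h; rewrite /push qopE ?winvN //; exact: winv_pinj. Qed.

Lemma push_ket x : push w (ket R x) = ket R (w x).
Proof.
apply: l2ext => t; rewrite /push qopE; last exact: winv_pinj.
rewrite ketE; case E : (winv w t) => [y|] /=.
  by rewrite -(winvP E) (inj_eq wi).
by case: eqP => // tx; move: E; rewrite tx winvK.
Qed.

Lemma pull_ket x : pull w (ket R (w x)) = ket R x.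
Proof. by apply: l2ext => y; rewrite pullE !ketE (inj_eq wi). Qed.

Lemma pull_ketN t : (forall x, w x <> t) -> pull w (ket R t) = 0.
Proof.
by move=> h; apply: l2ext => y; rewrite pullE ketE; case: eqP => // /h.
Qed.

Lemma pull_lin : linear (pull w). Proof. exact/qop_lin/some_pinj. Qed.
Lemma push_lin : linear (push w). Proof. exact/qop_lin/winv_pinj. Qed.
Lemma pull_bnd : bnd 1 (pull w). Proof. exact/qop_bnd/some_pinj. Qed.
Lemma push_bnd : bnd 1 (push w). Proof. exact/qop_bnd/winv_pinj. Qed.

End PullPush.

Section MulOp.
Variable T : choiceType.
Implicit Types a b : T -> Cplx R.

Definition mulop a (u : l2 R T) : l2 R T := l2_of (fun x => a x * u x).

Definition bounded_fun a : Prop := exists M : R, forall x, cmod (a x) <= M.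

Lemma mulop_bound a M (u : l2 R T) s : (forall x, cmod (a x) <= M) -> uniq s ->
  \sum_(x <- s) normc2 (a x * u x) <= M ^+ 2 * nsq u.
Proof.
move=> aM us.
apply: (@le_trans _ _ (M ^+ 2 * \sum_(x <- s) normc2 (u x))).
  rewrite mulr_sumr; apply: ler_sum => x _; rewrite normc2M.
  rewrite ler_wpM2r ?normc2_ge0 // -sqr_cmod.
  by rewrite lerXn2r ?nnegrE ?cmod_ge0 // (le_trans (cmod_ge0 (a x))).
by rewrite ler_wpM2l ?sqr_ge0 // bessel.
Qed.

Lemma mulopE a u x : bounded_fun a -> mulop a u x = a x * u x.
Proof.
by move=> [M aM]; have [+ _] := l2_ofP (fun s => @mulop_bound a M u s aM); apply.
Qed.

Lemma mulop_lin a : bounded_fun a -> linear (mulop a).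
Proof.
move=> ab c u v; apply: l2ext => x.
by rewrite l2D l2Z !mulopE // mulrDr mulrCA.
Qed.

Lemma mulop_bnd a M : 0 <= M -> (forall x, cmod (a x) <= M) -> bnd M (mulop a).
Proof.
move=> M0 aM; apply: nsq_bnd => // u.
by have [_] := l2_ofP (fun s => @mulop_bound a M u s aM).
Qed.

Lemma mulop_bop a : bounded_fun a -> bounded_op (mulop a).
Proof.
move=> ab; split; first exact: mulop_lin.
move: ab => [M aM]; exists `|M|; apply: mulop_bnd => // x.
by rewrite (le_trans (aM x)) // ler_norm.
Qed.

Lemma mulop_ket a x : bounded_fun a -> mulop a (ket R x) = a x *: ket R x.
Proof.
move=> ab; apply: l2ext => y; rewrite mulopE // l2Z !ketE.
by case: eqP => [->//|_]; rewrite !mulr0.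
Qed.

Lemma cmodM (z w : Cplx R) : cmod (z * w) = cmod z * cmod w.
Proof. by rewrite /cmod normc2M sqrtrM ?normc2_ge0. Qed.

Lemma cmodD (z w : Cplx R) : cmod (z + w) <= cmod z + cmod w.
Proof. by rewrite cmod_le rmorphD /= -!normcE ler_normD. Qed.

Lemma cmod_conj (z : Cplx R) : cmod z^* = cmod z.
Proof. by rewrite /cmod conjcE /normc2 /= sqrrN. Qed.

Lemma bounded_funJ a : bounded_fun a -> bounded_fun (fun x => (a x)^*).
Proof. by move=> [M aM]; exists M => x; rewrite cmod_conj. Qed.

Lemma adjoint_mulop a : bounded_fun a ->
  adjoint (mulop a) = mulop (fun x => (a x)^*).
Proof.
move=> ab; have aj := bounded_funJ ab.
apply: adjoint_eq; try exact: mulop_bop.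
move=> x y; rewrite !mulop_ket // !l2Z !ketE rmorphM /= [y == x]eq_sym.
by case: eqP => [->|_]; rewrite ?conjC1 // conjC0 !mulr0.
Qed.

End MulOp.

End ConcreteOps.

Arguments pull R {S T} w _.
Arguments push R {S T} w _.

(** * Operators of the form F (x) v_k and Fourier coefficients *)

Section ShiftTensor.
Variable R : realType.

Lemma addzI (k : int) : injective (fun i : int => k + i).
Proof. by move=> i j /addrI. Qed.

Lemma shift_bop (k : int) : bounded_op (push R (fun i : int => k + i)).
Proof. exact/qop_bop/winv_pinj. Qed.

Lemma shiftE (k : int) (v : l2 R int) (i : int) : Defs.shift k v i = v (i - k).
Proof.
have -> : @Defs.shift R k = push R (fun i : int => k + i).
  apply: the_op_eq; first exact: shift_bop.
    by move=> j /=; rewrite push_ket //; exact: addzI.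
  by move=> K' _ /= h x; rewrite h push_ket //; exact: addzI.
have {1}-> : i = k + (i - k) by rewrite addrC subrK.
by rewrite pushE //; exact: addzI.
Qed.

Variable S : choiceType.
Implicit Types (F G : l2 R S -> l2 R S) (w : l2 R (S * int)%type).

Lemma pair_inj (i : int) : injective (fun x : S => (x, i)).
Proof. by move=> x y []. Qed.

Definition row (i : int) : l2 R (S * int)%type -> l2 R S := pull R (fun x => (x, i)).

Lemma rowE i w x : row i w x = w (x, i).
Proof. by rewrite /row pullE //; exact: pair_inj. Qed.

(** This is F (x) v_k written by rows of l2(S * Z), the shift moving row i - k to row i;
    [tensor_shiftE] identifies it with the operator described by [tensor_op]. *)
Definition hat (k : int) F w : l2 R (S * int)%type :=
  l2_of (fun p => F (row (p.2 - k) w) p.1).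

Lemma sqsum_rows (h : S * int -> Cplx R) :
  sqsum h = (\esum_(i in [set: int]) sqsum (fun x => h (x, i)))%E.
Proof.
have h0 (p : S * int) : (0 <= (normc2 (h p))%:E)%E by rewrite lee_fin normc2_ge0.
pose sw (p : int * S) := (p.2, p.1).
have bsw : set_bij [set: int * S] [set: S * int] sw.
  split=> //; first by move=> [i x] [j y] _ _ [-> ->].
  by move=> [x i] _; exists (i, x).
rewrite {1}/sqsum (reindex_esum _ _ _ _ bsw) //.
have -> : [set: (int * S)%type] = [set: int] `*`` (fun=> [set: S]) by apply/seteqP.
by rewrite -(@esum_esum _ _ _ _ _ (fun i x => (normc2 (h (x, i)))%:E)).
Qed.

Section Hat.
Variables (k : int) (F : l2 R S -> l2 R S).
Hypothesis bF : bounded_op F.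

(** The squared norm is the sum of the squared norms of the rows; F acts inside each row and the
    shift only permutes the rows. *)
Lemma hat_bound M w : 0 <= M -> bnd M F ->
  (sqsum (fun p : S * int => F (row (p.2 - k) w) p.1) <= (M ^+ 2 * nsq w)%:E)%E.
Proof.
move=> M0 FM; rewrite sqsum_rows /=.
have rowS i : sqsum (fun x => w (x, i)) = (nsq (row i w))%:E.
  have -> : (fun x => w (x, i)) = row i w by apply/funext => x; rewrite rowE.
  by apply: possumE; [move=> x; exact: normc2_ge0|exact: normc2_summable].
have FS i : sqsum (F (row i w)) = (nsq (F (row i w)))%:E.
  by apply: possumE; [move=> x; exact: normc2_ge0|exact: normc2_summable].
have wS : (nsq w)%:E = (\esum_(i in [set: int]) (nsq (row i w))%:E)%E.
  have -> : (nsq w)%:E = sqsum w.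
    by symmetry; apply: possumE; [move=> x; exact: normc2_ge0|exact: normc2_summable].
  by rewrite sqsum_rows; apply: eq_esum => i _; rewrite rowS.
apply: (@le_trans _ _
    (\esum_(i in [set: int]) ((M ^+ 2)%:E * (nsq (row (i - k) w))%:E))%E).
  apply: le_esum => i _; rewrite FS -EFinM lee_fin -!sqr_l2norm -exprMn.
  by rewrite lerXn2r ?nnegrE ?mulr_ge0 ?l2norm_ge0.
have := @esumZ R int (fun i => (nsq (row (i - k) w))%:E) (M ^+ 2) (sqr_ge0 _).
move=> h; apply: le_trans (h _) _; first by move=> i; rewrite lee_fin nsq_ge0.
rewrite [leRHS]EFinM wS lee_wpmul2l ?lee_fin ?sqr_ge0 // le_eqVlt; apply/orP; left.
have bsub : set_bij [set: int] [set: int] (fun i => i - k).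
  split=> //; first by move=> i j _ _ /addIr.
  by move=> i _; exists (i + k) => //; rewrite addrK.
by rewrite [X in _ == X](reindex_esum _ _ _ _ bsub).
Qed.

Lemma hatP M w : 0 <= M -> bnd M F ->
  (forall p, hat k F w p = F (row (p.2 - k) w) p.1) /\ nsq (hat k F w) <= M ^+ 2 * nsq w.
Proof.
move=> M0 FM; apply: l2_ofP => s us.
have := hat_bound w M0 FM; rewrite -lee_fin; apply: le_trans.
rewrite -sumEFin /sqsum.
apply: esum_ge; exists [set` s].
  by split=> //; exact: finite_seq.
rewrite fsbig_finite /=; last exact: finite_seq.
have -> : \sum_(x <- s) (normc2 (F (row (x.2 - k) w) x.1))%:E =
  \sum_(x <- finmap.enum_fset (fset_set [set` s]))
    (normc2 (F (row (x.2 - k) w) x.1))%:E; last by [].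
apply: perm_big; apply: uniq_perm; rewrite ?finmap.fset_uniq // => x.
by apply/idP/idP => h; [rewrite in_fset_set ?inE|move: h; rewrite in_fset_set ?inE].
Qed.

Lemma hatE w x i : hat k F w (x, i) = F (row (i - k) w) x.
Proof. by have [M M0 FM] := bopP bF; have [-> _] := hatP w M0 FM. Qed.

Lemma hat_bnd M : 0 <= M -> bnd M F -> bnd M (hat k F).
Proof. by move=> M0 FM; apply: nsq_bnd => // w; have [_] := hatP w M0 FM. Qed.

Lemma row_hat i w : row i (hat k F w) = F (row (i - k) w).
Proof. by apply: l2ext => x; rewrite rowE hatE. Qed.

Lemma row_lin i : linear (row i). Proof. exact/pull_lin/pair_inj. Qed.
Lemma row_bnd i : bnd 1 (row i). Proof. exact/pull_bnd/pair_inj. Qed.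

Lemma hat_bop : bounded_op (hat k F).
Proof.
split.
  move=> a u v; apply: l2ext => -[x i].
  by rewrite l2D l2Z !hatE row_lin (bop_lin bF).
by have [M M0 FM] := bopP bF; exists M; exact: hat_bnd.
Qed.

Lemma tensor_ket x (j : int) : tensor_vec (ket R x) (ket R j) = ket R ((x, j) : S * int).
Proof.
by apply: l2ext => -[y i]; rewrite [RHS]ketE xpair_eqE -mulnb natrM.
Qed.

Lemma row_tensor i (u : l2 R S) (v : l2 R int) : row i (tensor_vec u v) = v i *: u.
Proof. by apply: l2ext => x; rewrite rowE l2Z mulrC. Qed.

Lemma tensor_shiftE : tensor_op F (Defs.shift k) = hat k F.
Proof.
apply: the_op_eq; first exact: hat_bop.
  move=> u v /=; apply: l2ext => -[x i].
  rewrite hatE row_tensor (linZ (bop_lin bF)) l2Z /= /tensor_fun /= shiftE.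
  by rewrite mulrC.
move=> K' _ /= h [x j]; rewrite -tensor_ket h; apply: l2ext => -[y i].
rewrite hatE row_tensor (linZ (bop_lin bF)) l2Z /= /tensor_fun /= shiftE.
by rewrite mulrC.
Qed.

Lemma row_ket i x (j : int) : row i (ket R ((x, j) : S * int)) = (i == j)%:R *: ket R x.
Proof. by rewrite -tensor_ket row_tensor ketE. Qed.

Lemma hat_ket x j y i :
  hat k F (ket R ((x, j) : S * int)) (y, i) = (i - k == j)%:R * F (ket R x) y.
Proof. by rewrite hatE row_ket (linZ (bop_lin bF)) l2Z. Qed.

End Hat.

Lemma hat_comp k l F G : bounded_op F -> bounded_op G ->
  hat k F \o hat l G = hat (k + l) (F \o G).
Proof.
move=> bF bG; apply/funext => w; apply: l2ext => -[x i] /=.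
by rewrite !hatE ?row_hat //=; [rewrite opprD addrA|exact: bop_comp].
Qed.

Lemma adjoint_hat k F : bounded_op F -> adjoint (hat k F) = hat (- k) (adjoint F).
Proof.
move=> bF; have bA := adjoint_bop bF.
apply: adjoint_eq; try exact: hat_bop.
move=> [x i] [y j]; rewrite !hat_ket // opprK adjoint_entry // rmorphM /=.
rewrite conjC_nat; congr ((nat_of_bool _)%:R * _).
by rewrite subr_eq eq_sym.
Qed.

Lemma op_map_hat k : op_map id 1 (hat k).
Proof.
split.
- by move=> F; exact: hat_bop.
- apply/funext => w; apply: l2ext => -[x i].
  by rewrite hatE //; exact: bop0.
- move=> a F G bF bG; apply/funext => w; apply: l2ext => -[x i].
  by rewrite l2D l2Z !hatE //; exact: bop_lc.
- by move=> F e bF e0 Fe; rewrite mul1r; exact: hat_bnd.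
Qed.

(** The k-th Fourier coefficient: K compressed between the copy of l2(S) over 0 and the copy over
    k. *)
Definition slice (k : int) (K : l2 R (S * int)%type -> l2 R (S * int)%type) (u : l2 R S)
    : l2 R S :=
  row k (K (push R (fun x => (x, 0)) u)).

Lemma row_push0 i u : row i (push R (fun x : S => (x, 0)) u) = (i == 0)%:R *: u.
Proof.
apply: l2ext => x; rewrite rowE l2Z; case: eqP => [->|i0].
  by rewrite (pushE (@pair_inj 0)) mul1r.
by rewrite pushN ?mul0r // => y [_ /esym].
Qed.

Lemma op_map_slice k : op_map id 1 (slice k).
Proof.
have pl : linear (push R (fun x : S => (x, 0 : int))) by exact: push_lin.
have pb : bnd 1 (push R (fun x : S => (x, 0 : int))) by exact: push_bnd.
split.
- move=> K [lK [M KM]]; split.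
    by move=> a u v; rewrite /slice pl lK row_lin.
  exists `|M| => u; apply: (le_trans (row_bnd _ _)); rewrite mul1r.
  apply: (le_trans (bnd_ge0 KM _)); rewrite ler_wpM2l //.
  by apply: (le_trans (pb u)); rewrite mul1r.
- by apply/funext => u; rewrite /slice (lin0 (row_lin k)).
- by move=> a F G bF bG; apply/funext => u; rewrite /slice row_lin.
- move=> F e bF e0 Fe u; rewrite mul1r; apply: (le_trans (row_bnd _ _)).
  rewrite mul1r; apply: (le_trans (Fe _)); rewrite ler_wpM2l //.
  by apply: (le_trans (pb u)); rewrite mul1r.
Qed.

Lemma slice_hat k l F : bounded_op F ->
  slice k (hat l F) = (fun u => (k == l)%:R *: F u).
Proof.
move=> bF; apply/funext => u.
by rewrite /slice row_hat // row_push0 (linZ (bop_lin bF)) subr_eq0.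
Qed.

Lemma slice_entry k K x y : slice k K (ket R x) y = K (ket R (x, 0 : int)) (y, k).
Proof. by rewrite /slice rowE push_ket //; exact: pair_inj. Qed.

End ShiftTensor.

(** * Approximation on a compact set *)

Section Approximation.
Variable Z : topologicalType.

Lemma compact_seq (K : set Z) (V : Z -> set Z) : compact K ->
  (forall p, K p -> nbhs p (V p)) ->
  exists2 s : seq Z, (forall p, p \in s -> K p) &
    forall z, K z -> exists2 p, p \in s & V p z.
Proof.
move=> /(compact_near_coveringP K).1 cov KV.
(* Finite lists, directed by inclusion: what holds eventually along this filter holds for some list,
   so near-covering compactness yields a finite subcover. *)
pose F : set_system (seq Z) := filter_from [set: seq Z]
  (fun s0 => [set s : seq Z | {subset s0 <= s}]).
have FF : Filter F.
  apply: filter_from_filter; first by exists [::].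
  move=> s t _ _; exists (s ++ t) => // r /= h.
  by split=> x xs; apply: h; rewrite mem_cat xs ?orbT.
have [|s _ hs] := cov _ F (fun s z => exists2 p, p \in s /\ K p & V p z) FF.
  move=> x Kx; exists (V x, [set s : seq Z | x \in s]).
    split; first exact: KV.
    by exists [:: x] => // s h; apply: h; rewrite mem_seq1.
  by move=> [z s] [/= Vz xs]; exists x.
exists [seq x <- s | `[< K x >]].
  by move=> p; rewrite mem_filter => /andP[/asboolP].
move=> z Kz; have [//|p [ps Kp] Vp] := hs s _ z Kz.
by exists p; rewrite // mem_filter ps andbT; apply/asboolP.
Qed.

Variables (C : numFieldType) (K : set Z) (P : set (Z -> C)).
Hypothesis K_compact : compact K.
Hypothesis P01 : forall f, P f -> forall z, 0 <= f z <= 1.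
Hypothesis P1 : P (fun=> 1).
Hypothesis PM : forall f g, P f -> P g -> P (fun z => f z * g z).
Hypothesis PC : forall f, P f -> P (fun z => 1 - f z).
(** Separation is required on neighbourhoods, so that a finite product of separating functions is
    still exactly 1 near p and exactly 0 near the points to be avoided. *)
Hypothesis Psep : forall p q, K p -> K q -> p <> q ->
  exists2 f, P f & (\forall z \near p, f z = 1) /\ (\forall z \near q, f z = 0).

(** Each q in K is either interior to O or has a separating function vanishing near it. The product
    over a finite subcover then vanishes on all of K outside O. *)
Lemma bump (p : Z) (O : set Z) : K p -> nbhs p O ->
  exists2 f, P f & (\forall z \near p, f z = 1) /\
    forall z, K z -> f z != 0 -> O z.
Proof.
move=> Kp nO.
have Op : O^° p := nO.
have h q : exists f, K q -> [/\ P f, \forall z \near p, f z = 1 &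
    O^° q \/ \forall z \near q, f z = 0].
  have [Kq|nq] := pselect (K q); last by exists (fun=> 0).
  have [Oq|nOq] := pselect (O^° q).
    exists (fun=> 1) => _; split=> //; last by left.
    exact: nearW.
  have pq : p <> q by move=> e; apply: nOq; rewrite -e.
  by have [f Pf [f1 f0]] := Psep Kp Kq pq; exists f => _; split=> //; right.
pose f q := projT1 (cid (h q)).
have fP q : K q -> [/\ P (f q), \forall z \near p, f q z = 1 &
    O^° q \/ \forall z \near q, f q z = 0] by exact: (projT2 (cid (h q))).
have [|s sK sV] := compact_seq (V := fun q => [set z | O z \/ f q z = 0]) K_compact.
  move=> q Kq; have [_ _ [Oq|f0]] := fP q Kq.
    by apply: filterS Oq => z Oz; left.
  by apply: filterS f0 => z f0; right.
exists (fun z => \prod_(q <- s) f q z).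
  elim: s sK {sV} => [|q s IH] sK; first by under eq_fun do rewrite big_nil.
  under eq_fun do rewrite big_cons.
  apply: PM; first by have [] := fP q (sK q (mem_head _ _)).
  by apply: IH => r rs; apply: sK; rewrite in_cons rs orbT.
split.
  elim: s sK {sV} => [|q s IH] sK; first by apply: nearW => z; rewrite big_nil.
  have [_ f1 _] := fP q (sK q (mem_head _ _)).
  have IH' := IH (fun r rs => sK r (mem_behead (s := q :: s) rs)).
  by apply: filterS2 f1 IH' => z e1 e2; rewrite big_cons e1 e2 mulr1.
move=> z Kz; have [q qs [//|f0]] := sV z Kz.
by rewrite (big_rem q) //= f0 mul0r eqxx.
Qed.

Variable L : set (Z -> C).
Hypothesis L0 : L (fun=> 0).
Hypothesis LD : forall c f g, P f -> L g -> L (fun z => g z + c * f z).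

(* A partition of unity [psi_r = phi_r * \prod_(s < r) (1 - phi_s)] built from
   bump functions stays inside the class [P]. *)
Lemma approx_on_compact (f : Z -> C) (e : C) : 0 < e ->
  (forall p, K p -> \forall z \near p, K z -> `|f p - f z| <= e) ->
  exists2 g, L g & forall z, K z -> `|f z - g z| <= e.
Proof.
move=> e0 cf.
have h p : exists phi, K p -> [/\ P phi, \forall z \near p, phi z = 1 &
    forall z, K z -> phi z != 0 -> `|f p - f z| <= e].
  have [Kp|nKp] := pselect (K p); last by exists (fun=> 0).
  have [phi Pphi [phi1 phiO]] := bump Kp (cf p Kp).
  by exists phi => _; split=> // z Kz nz; exact: phiO.
pose phi q := projT1 (cid (h q)).
have phiP q : K q -> [/\ P (phi q), \forall z \near q, phi q z = 1 &
    forall z, K z -> phi q z != 0 -> `|f q - f z| <= e].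
  exact: (projT2 (cid (h q))).
have [|s sK sV] := compact_seq (V := fun q => [set z | phi q z = 1]) K_compact.
  by move=> q Kq; have [] := phiP q Kq.
pose rho z := \prod_(q <- s) (1 - phi q z).
(* [1 - rho] is the sum of the partition of unity. The error bound weighted by it survives each new
   bump function, and on K it becomes e because some factor of [rho] vanishes there. *)
suff [g Lg gE] : exists2 g, L g & forall z, K z ->
    `|f z * (1 - rho z) - g z| <= e * (1 - rho z).
  exists g => // z Kz; have := gE z Kz; have [q qs q1] := sV z Kz.
  by rewrite /rho (big_rem q) //= q1 subrr mul0r subr0 !mulr1.
have : P rho /\ exists2 g, L g & forall z, K z ->
    `|f z * (1 - rho z) - g z| <= e * (1 - rho z); last by case.
rewrite /rho; elim: s sK {sV rho} => [|q s IH] sK.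
  split; first by under eq_fun do rewrite big_nil.
  by exists (fun=> 0) => // z _; rewrite big_nil subrr !mulr0 subr0 normr0.
have [|Prho [g Lg gE]] := IH.
  by move=> r rs; apply: sK; rewrite in_cons rs orbT.
have [Pq _ qE] := phiP q (sK q (mem_head _ _)).
have Pr : P (fun z => phi q z * \prod_(j <- s) (1 - phi j z)) by exact: PM.
split.
  under eq_fun do rewrite big_cons.
  by apply: PM => //; exact: PC.
exists (fun z => g z + f q * (phi q z * \prod_(j <- s) (1 - phi j z))).
  exact: LD.
move=> z Kz; rewrite big_cons; have := gE z Kz.
set r := \prod_(j <- s) _; set t := phi q z => hz.
have [t0 _] := andP (P01 Pr z); rewrite -/t -/r in t0.
have -> : f z * (1 - (1 - t) * r) - (g z + f q * (t * r)) =
    (f z * (1 - r) - g z) + (f z - f q) * (t * r) by ring.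
have -> : e * (1 - (1 - t) * r) = e * (1 - r) + e * (t * r) by ring.
apply: (le_trans (ler_normD _ _)); apply: lerD => //.
rewrite normrM (ger0_norm t0).
have [->|tn] := eqVneq t 0; first by rewrite mul0r !mulr0.
by rewrite ler_wpM2r // distrC; exact: qE.
Qed.

End Approximation.

(** * Cesaro means *)

Section Fejer.
Variables (R : realType) (S : choiceType).
Local Notation HZ := (l2 R (S * int)%type).
Local Notation HZZ := (l2 R ((S * int) * int)%type).

(** The block matrix of K over Z is constant along its diagonals, as it is for every F (x) v_k. *)
Definition laurent (K : HZ -> HZ) : Prop := forall x y i j,
  K (ket R ((y, j) : S * int)) (x, i) = K (ket R ((y, 0) : S * int)) (x, i - j).

Definition fterm (k : int) (K : HZ -> HZ) : HZ -> HZ := hat k (slice k K).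

(** Among the n^2 differences r - s, a value k with |k| < n occurs n - |k| times, so this is the
    Cesaro mean with weights 1 - |k|/n. The double sum is the form in which it becomes a
    compression. *)
Definition fejer (n : nat) (K : HZ -> HZ) (w : HZ) : HZ :=
  (n%:R^-1)%:C%C *: (\sum_(r < n) \sum_(s < n) fterm (r%:Z - s%:Z) K w).

Lemma slice_bop k (K : HZ -> HZ) : bounded_op K -> bounded_op (slice k K).
Proof. exact: (op_map_bop (op_map_slice R S k)). Qed.

Lemma fterm_bop k K : bounded_op K -> bounded_op (fterm k K).
Proof. by move=> bK; exact/hat_bop/slice_bop. Qed.

Lemma fterm_lc k a K L : bounded_op K -> bounded_op L ->
  fterm k (fun u => a *: K u + L u) = (fun u => a *: fterm k K u + fterm k L u).
Proof.
move=> bK bL; rewrite /fterm (op_map_lc (op_map_slice R S k)) //.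
by rewrite (op_map_lc (op_map_hat R S k)) //; exact: slice_bop.
Qed.

Lemma fejer_lc n a K L : bounded_op K -> bounded_op L ->
  fejer n (fun u => a *: K u + L u) = (fun u => a *: fejer n K u + fejer n L u).
Proof.
move=> bK bL; apply/funext => w; rewrite /fejer.
under eq_bigr => r _ do under eq_bigr => s _ do rewrite (fterm_lc _ _ bK bL).
under eq_bigr => r _ do rewrite big_split -scaler_sumr /=.
by rewrite big_split -scaler_sumr /= scalerDr !scalerA mulrC.
Qed.

(** The last coordinate records i - r. As K (x) 1 preserves it, the matrix entry from
    [diag_emb s (y, j)] to [diag_emb r (x, i)] survives only if i - j = r - s, which selects the
    Fourier term of degree r - s. *)
Definition diag_emb (r : int) (p : S * int) : (S * int) * int := (p, p.2 - r).

Lemma diag_emb_inj r : injective (diag_emb r).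
Proof. by move=> p q []. Qed.

(* Exhibits [fejer n K] as a compression of [K (x) 1], whence [fejer_bnd]. *)
Lemma fterm_compress (r s : int) K : bounded_op K -> laurent K ->
  fterm (r - s) K =
  (fun w => pull R (diag_emb r) (hat 0 K (push R (diag_emb s) w))).
Proof.
move=> bK lK; have bf := fterm_bop (r - s) bK.
have [M M0 KM] := bopP bK; have hM := hat_bnd 0 M0 KM.
have [lf [M' fM']] := bf.
apply: (lin_ext lf _ fM' (M' := M)).
- move=> a u v; rewrite push_lin (bop_lin (hat_bop 0 bK)).
  by rewrite pull_lin //; exact: diag_emb_inj.
- move=> u; apply: (le_trans (pull_bnd (@diag_emb_inj r) _)); rewrite mul1r.
  apply: (le_trans (hM _)); rewrite ler_wpM2l //.
  by apply: (le_trans (push_bnd _ _)); rewrite mul1r.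
move=> [y j]; apply: l2ext => -[x i].
have e1 := push_ket R (@diag_emb_inj s) (y, j).
have e2 := pullE (@diag_emb_inj r) (hat 0 K (ket R (diag_emb s (y, j)))) (x, i).
have e3 := hat_ket 0 bK (y, j) (j - s) (x, i) (i - r).
have e4 := hat_ket (r - s) (slice_bop (r - s) bK) y j x i.
rewrite e1 e2 [RHS]e3 [LHS]e4 slice_entry subr0 (lK x y i j).
have -> : (i - (r - s) == j) = (i - r == j - s).
  by rewrite -subr_eq0 -[RHS]subr_eq0; congr (_ == 0); ring.
case: eqP => [e|]; last by rewrite !mul0r.
by have -> : i - j = r - s by move: e; move/eqP; rewrite subr_eq => /eqP->; ring.
Qed.

(** The isometries pushing along [diag_emb s] have mutually orthogonal ranges for distinct s, so
    their sum has norm sqrt n, and so has its adjoint [proj_sum]. The two factors sqrt n cancel the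
    n^-1 in [fejer]. *)
Definition emb_sum n (w : HZ) : HZZ := \sum_(s < n) push R (diag_emb s%:Z) w.
Definition proj_sum n (y : HZZ) : HZ := \sum_(r < n) pull R (diag_emb r%:Z) y.

Lemma inner_push r u y : inner (push R (diag_emb r) u) y = inner u (pull R (diag_emb r) y).
Proof.
have di := @diag_emb_inj r.
apply: (adjoint_pair (push_lin (diag_emb r)) (push_bnd (diag_emb r)) (pull_bnd di)) => x v.
by rewrite push_ket // inner_ketl pullE.
Qed.

Lemma inner_emb_sum n u y : inner (emb_sum n u) y = inner u (proj_sum n y).
Proof.
rewrite inner_suml inner_sumr; apply: eq_bigr => r _; exact: inner_push.
Qed.

Lemma proj_emb_sum n w : proj_sum n (emb_sum n w) = n%:R *: w.
Proof.
rewrite /proj_sum (eq_bigr (fun=> w)).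
  by rewrite sumr_const card_ord scaler_nat.
move=> r _; apply: l2ext => p; rewrite pullE; last exact: diag_emb_inj.
rewrite l2_sum (bigD1 r) //= pushE; last exact: diag_emb_inj.
rewrite big1 ?addr0 // => s sr; rewrite pushN // => q [-> /addrI /oppr_inj [e]].
by move: sr; rewrite -val_eqE /= e eqxx.
Qed.

Lemma nsq_emb_sum n w : nsq (emb_sum n w) = n%:R * nsq w.
Proof.
have := inner_emb_sum n w (emb_sum n w); rewrite proj_emb_sum innerZr !inner_self.
by move/(congr1 (@complex.Re R)) => /= ->; rewrite -(rmorph_nat (real_complex R)) /=; ring.
Qed.

Lemma l2norm_emb_sum n w : l2norm (emb_sum n w) = Num.sqrt n%:R * l2norm w.
Proof. by rewrite !l2normE nsq_emb_sum sqrtrM. Qed.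

Lemma proj_sum_bnd n : bnd (Num.sqrt n%:R) (proj_sum n).
Proof.
move=> y; set q := proj_sum n y.
have [->|nz] := eqVneq (l2norm q) 0; first by rewrite mulr_ge0 ?sqrtr_ge0 ?l2norm_ge0.
have p : 0 < l2norm q by rewrite lt_def nz l2norm_ge0.
rewrite -(ler_pM2r p) -expr2 sqr_l2norm.
have -> : nsq q = complex.Re (inner (emb_sum n q) y) by rewrite inner_emb_sum inner_self.
apply: (le_trans (Re_le_cmod _)); apply: (le_trans (cmod_inner _ _)).
by rewrite l2norm_emb_sum mulrAC.
Qed.

Lemma fejer_bnd n K M : bounded_op K -> laurent K -> 0 <= M -> bnd M K ->
  bnd M (fejer n.+1 K).
Proof.
move=> bK lK M0 KM w; have hM := hat_bnd 0 M0 KM.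
have lh := bop_lin (hat_bop 0 bK).
have -> : fejer n.+1 K w = ((n.+1%:R)^-1)%:C%C *: proj_sum n.+1 (hat 0 K (emb_sum n.+1 w)).
  congr (_ *: _); apply: eq_bigr => r _.
  rewrite (lin_sum lh) (lin_sum (pull_lin (@diag_emb_inj r%:Z))).
  by apply: eq_bigr => s _; rewrite fterm_compress.
rewrite l2normZ /cmod /normc2 /= expr0n addr0 sqrtr_sqr ger0_norm ?invr_ge0 //.
rewrite mulrC ler_pdivrMr ?ltr0n //.
apply: (le_trans (proj_sum_bnd _ _)).
apply: (@le_trans _ _ (Num.sqrt n.+1%:R * (M * l2norm (emb_sum n.+1 w)))).
  by rewrite ler_wpM2l ?sqrtr_ge0.
rewrite l2norm_emb_sum -[X in _ <= _ * X](@sqr_sqrtr _ n.+1%:R) //.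
by rewrite le_eqVlt; apply/orP; left; apply/eqP; ring.
Qed.

Definition on_diag (k : int) (r s : nat) : bool := r%:Z - s%:Z == k.
Definition in_range (n : nat) (k : int) (r : nat) : bool :=
  (0 <= r%:Z - k) && (r%:Z - k < n%:Z).

Lemma count_diag n (k : int) (r : 'I_n) :
  (\sum_(s < n) on_diag k r s)%N = in_range n k r.
Proof.
rewrite /in_range /on_diag.
case: (boolP ((0 <= r%:Z - k) && (r%:Z - k < n%:Z))) => h; last first.
  rewrite big1 // => s _; apply/eqP; rewrite eqb0; apply/eqP => e.
  by move: h (ltn_ord s); lia.
have [s0 s0E] : exists s0 : 'I_n, s0%:Z = r%:Z - k.
  have lt : (`|r%:Z - k| < n)%N by lia.
  by exists (Ordinal lt) => /=; lia.
rewrite (bigD1 s0) //= big1 ?addn0 => [|s ss].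
  by case: eqP => //; lia.
apply/eqP; rewrite eqb0; apply/eqP => e; move/eqP: ss; apply; apply: val_inj => /=.
by lia.
Qed.

Lemma count_lt n k : (\sum_(r < n) (r < k) <= k)%N.
Proof.
suff -> : (\sum_(r < n) (r < k) = minn n k)%N by exact: geq_minr.
elim: n => [|n IH]; first by rewrite big_ord0 min0n.
by rewrite big_ord_recr /= IH; case: ltnP; lia.
Qed.

Lemma count_ge n k : (\sum_(r < n) (n <= r + k) <= k)%N.
Proof.
rewrite (reindex_inj rev_ord_inj) /=; apply: leq_trans (count_lt n k).
apply: leq_sum => r _; have rn := ltn_ord r.
have h : (n <= n - r.+1 + k)%N -> (r < k)%N by lia.
by case: (boolP (n <= n - r.+1 + k)%N) => // /h ->.
Qed.

(** Each row r contains at most one index s on the k-th diagonal, whence the upper bound. The rows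
    without one are among the first |k| if k is nonnegative and among the last |k| otherwise. *)
Lemma fejer_weight n (k : int) :
  (n - `|k| <= \sum_(r < n) \sum_(s < n) on_diag k r s <= n)%N.
Proof.
under eq_bigr do rewrite count_diag.
apply/andP; split; last first.
  apply: (@leq_trans (\sum_(r < n) 1)); last by rewrite sum_nat_const card_ord muln1.
  by apply: leq_sum => r _; case: (in_range _ _ _).
rewrite leq_subLR.
(* [b] marks the rows that the diagonal may miss; at most |k| of them are allowed. *)
have h b : (\sum_(r < n) b r <= `|k|)%N ->
    (forall r : 'I_n, (1 <= b r + in_range n k r)%N) ->
    (n <= `|k| + \sum_(r < n) in_range n k r)%N.
  move=> bk hb; apply: (@leq_trans (\sum_(r < n) (b r + in_range n k r))).
    apply: (@leq_trans (\sum_(r < n) 1)); first by rewrite sum_nat_const card_ord muln1.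
    exact: leq_sum.
  by rewrite big_split leq_add2r.
have [k0|k0] := lerP 0 k.
  apply: (h (fun r : 'I_n => nat_of_bool (r < `|k|)%N)); first exact: count_lt.
  move=> r; have := ltn_ord r; case: (boolP (r < `|k|)%N) => //= h1 h2.
  by rewrite /in_range; case: (boolP (_ && _)) => //; lia.
apply: (h (fun r : 'I_n => nat_of_bool (n <= r + `|k|)%N)); first exact: count_ge.
move=> r; have := ltn_ord r; case: (boolP (n <= r + `|k|)%N) => //= h1 h2.
by rewrite /in_range; case: (boolP (_ && _)) => //; lia.
Qed.

Lemma fterm_hat k l (F : l2 R S -> l2 R S) w : bounded_op F ->
  fterm k (hat l F) w = (k == l)%:R *: hat l F w.
Proof.
move=> bF; rewrite /fterm slice_hat //; case: eqP => [->|_].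
  by under [fun u => _]eq_fun do rewrite scale1r; rewrite scale1r.
under [fun u => _]eq_fun do rewrite scale0r.
by rewrite (op_map0 (op_map_hat R S k)) scale0r.
Qed.

Lemma fejer_hat n k (F : l2 R S -> l2 R S) w : bounded_op F ->
  fejer n (hat k F) w =
  ((n%:R^-1 * (\sum_(r < n) \sum_(s < n) on_diag k r s)%N%:R)%:C)%C *: hat k F w.
Proof.
move=> bF; rewrite /fejer.
under eq_bigr => r _ do under eq_bigr => s _ do rewrite fterm_hat //.
under eq_bigr => r _ do rewrite -scaler_suml -natr_sum.
by rewrite -scaler_suml -natr_sum scalerA rmorphM /= rmorph_nat.
Qed.

(** The condition [laurent] travels with the convergence because the bound [fejer_bnd], which makes
    the latter pass to limits, is stated for Laurent operators. *)
Definition fejer_conv (K : HZ -> HZ) : Prop :=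
  [/\ bounded_op K, laurent K &
    forall e : R, 0 < e -> exists n0, forall n, (n0 <= n)%N ->
      bnd e (fun w => fejer n.+1 K w - K w)].

Lemma fejer_conv_hat k (F : l2 R S -> l2 R S) : bounded_op F -> fejer_conv (hat k F).
Proof.
move=> bF; have bh := hat_bop k bF; split=> //.
  move=> x y i j.
  have e1 := hat_ket k bF y j x i; have e2 := hat_ket k bF y 0 x (i - j).
  rewrite e1 e2; congr ((nat_of_bool _)%:R * _).
  by rewrite -[LHS]subr_eq0; congr (_ == _); ring.
move=> e e0; have [M M0 hM] := bopP bh.
(* The weight of degree k differs from 1 by at most |k|/(n+1), so the error has bound |k| M/(n+1),
   which is at most e once n + 1 exceeds [a]. *)
pose a := (`|k|%N)%:R * M / e.
have a0 : 0 <= a by rewrite divr_ge0 ?mulr_ge0 // ltW.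
exists (Num.bound a) => n na w.
rewrite fejer_hat //; set c : nat := (\sum_(r < n.+1) _)%N.
have -> : ((n.+1%:R^-1 * c%:R)%:C)%C *: hat k F w - hat k F w =
    ((n.+1%:R^-1 * c%:R - 1)%:C)%C *: hat k F w.
  by rewrite rmorphB scalerBl rmorph1 scale1r.
rewrite l2normZ /cmod /normc2 /= expr0n addr0 sqrtr_sqr.
have /andP[c1 c2] := fejer_weight n.+1 k; rewrite -/c in c1 c2.
have n0 : 0 < n.+1%:R :> R by [].
have cd : `|n.+1%:R^-1 * c%:R - 1| <= n.+1%:R^-1 * (`|k|%N)%:R :> R.
  have -> : n.+1%:R^-1 * c%:R - 1 = n.+1%:R^-1 * (c%:R - n.+1%:R) :> R.
    by rewrite mulrBr mulVf // gt_eqF.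
  rewrite normrM ger0_norm ?invr_ge0 // ler_wpM2l ?invr_ge0 //.
  rewrite ler0_norm ?subr_le0 ?ler_nat // opprB lerBlDr -natrD ler_nat.
  by move: c1; rewrite leq_subLR.
apply: (le_trans (ler_wpM2r (l2norm_ge0 _) cd)).
apply: (@le_trans _ _ (n.+1%:R^-1 * (`|k|%N)%:R * (M * l2norm w))).
  by rewrite ler_wpM2l // mulr_ge0 // invr_ge0.
rewrite mulrA ler_wpM2r ?l2norm_ge0 // -mulrA mulrC ler_pdivrMr //.
rewrite [e * _]mulrC -ler_pdivrMr //; apply: ltW.
apply: (lt_le_trans (archi_boundP a0)); rewrite ler_nat.
exact: leqW.
Qed.

Lemma entry_bnd (K : HZ -> HZ) e p q : bnd e K -> cmod (K (ket R p) q) <= e.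
Proof.
move=> Ke; have := Ke (ket R p); rewrite l2norm_ket mulr1; apply: le_trans.
rewrite -(inner_ketl q); apply: (le_trans (cmod_inner _ _)).
by rewrite l2norm_ket mul1r.
Qed.

Lemma laurent_lc a (K L : HZ -> HZ) : laurent K -> laurent L ->
  laurent (fun w => a *: K w + L w).
Proof. by move=> lK lL x y i j; rewrite !l2D !l2Z (lK x y i j) (lL x y i j). Qed.

(** An e/3 argument: if L approximates K, the means of K - L are as small as K - L itself, uniformly
    in n. Hence K must be shown to be Laurent first, entry by entry. *)
Lemma fejer_conv_closed : closed_subspace fejer_conv.
Proof.
have sub : op_subspace fejer_conv.
  split.
  - by move=> K [].
  - split=> [|//|e e0]; first exact: bop0.
    exists 0 => n _ w; rewrite subr0.
    have z k u : fterm k (fun _ : HZ => 0 : HZ) u = 0.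
      rewrite /fterm (op_map0 (op_map_slice R S k)).
      by rewrite (op_map0 (op_map_hat R S k)).
    rewrite /fejer big1 => [|r _]; last by rewrite big1.
    by rewrite scaler0 l2norm0 mulr_ge0 ?l2norm_ge0 // ltW.
  - move=> a K L [bK lK cK] [bL lL cL]; split; first exact: bop_lc.
      exact: laurent_lc.
    move=> e e0; have d0 : 0 < cmod a + 1 by rewrite ltr_wpDl ?cmod_ge0.
    have [n1 h1] := cK (e / 2 / (cmod a + 1)) (divr_gt0 (divr_gt0 e0 (ltr0n _ 2)) d0).
    have [n2 h2] := cL (e / 2) (divr_gt0 e0 (ltr0n _ 2)).
    exists (maxn n1 n2) => n; rewrite geq_max => /andP[m1 m2] w.
    rewrite fejer_lc //.
    have -> : a *: fejer n.+1 K w + fejer n.+1 L w - (a *: K w + L w) =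
        a *: (fejer n.+1 K w - K w) + (fejer n.+1 L w - L w).
      by rewrite scalerBr opprD addrACA.
    apply: (le_trans (l2normD _ _)); rewrite l2normZ.
    apply: (@le_trans _ _ (e / 2 * l2norm w + e / 2 * l2norm w)); last first.
      by rewrite -mulrDl -splitr.
    apply: lerD; last exact: h2.
    apply: (le_trans (ler_wpM2l (cmod_ge0 a) (h1 n m1 w))).
    rewrite mulrA ler_wpM2r ?l2norm_ge0 // mulrA ler_pdivrMr // mulrC.
    have ee : 0 <= e / 2 by rewrite divr_ge0 // ltW.
    by apply: ler_wpM2l => //; rewrite lerDl.
split=> //; have [Vb _ _] := sub; apply/(norm_closedP Vb) => K bK approx.
have lK : laurent K.
  move=> x y i j; apply/eqP; rewrite -subr_eq0; apply/eqP; apply: normc2_eq0.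
  suff h : cmod (K (ket R ((y, j) : S * int)) (x, i) -
      K (ket R ((y, 0) : S * int)) (x, i - j)) = 0.
    by rewrite -sqr_cmod h expr0n.
  apply/eqP; rewrite eq_le cmod_ge0 andbT; apply/ler_addgt0Pl => e e0; rewrite addr0.
  have [L [bL lL _] KL] := approx (e / 2) (divr_gt0 e0 (ltr0n _ 2)).
  have h1 := entry_bnd (y, j : int) (x, i) KL.
  have h2 := entry_bnd (y, 0 : int) (x, i - j) KL.
  rewrite l2D l2N (lL x y i j) in h1; rewrite l2D l2N in h2.
  set A := K _ _ in h1 *; set B := K _ _ in h2 *; set D := L _ _ in h1 h2.
  have -> : A - B = (A - D) + (-1) * (B - D) by ring.
  apply: (le_trans (cmodD _ _)); rewrite cmodM.
  have -> : cmod (-1 : Cplx R) = 1.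
    by rewrite /cmod /normc2 /= oppr0 expr0n sqrrN expr1n addr0 sqrtr1.
  by rewrite mul1r [leRHS]splitr lerD.
split=> // e e0; have e3 : 0 < e / 3 by rewrite divr_gt0.
have [L [bL lL cL] KL] := approx _ e3.
have [n0 hn] := cL _ e3; exists n0 => n n0n w.
have lKL : laurent (fun w => K w - L w).
  have := laurent_lc (-1) lL lK.
  by under [fun w => _]eq_fun do rewrite scaleN1r addrC.
have := fejer_bnd n (bopB bK bL) lKL (ltW e3) KL w.
have -> : fejer n.+1 (fun w => K w - L w) w = fejer n.+1 K w - fejer n.+1 L w.
  have := congr1 (@^~ w) (fejer_lc n.+1 (-1) bL bK) => /=.
  under [fun w => _]eq_fun do rewrite scaleN1r addrC.
  by move=> ->; rewrite scaleN1r addrC.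
move=> h1; have h2 := hn n n0n w; have h3 := KL w.
have -> : fejer n.+1 K w - K w = (fejer n.+1 K w - fejer n.+1 L w) +
    (fejer n.+1 L w - L w) + - (K w - L w).
  by rewrite opprB -addrA !subrKA.
apply: (le_trans (l2normD _ _)); rewrite l2normN.
apply: (le_trans (lerD (l2normD _ _) (lexx _))).
apply: (@le_trans _ _ (e / 3 * l2norm w + e / 3 * l2norm w + e / 3 * l2norm w)).
  exact: (lerD (lerD h1 h2) h3).
by rewrite -!mulrDl le_eqVlt; apply/orP; left; apply/eqP; congr (_ * _); field.
Qed.

(** Only the Fourier coefficients of K enter its means. This transfers K from the span over the
    larger spaces B_k, where convergence is known, to the span over the D_k. *)
Lemma fejer_in_span (D : int -> set (l2 R S -> l2 R S)) K :
  (forall k F, D k F -> bounded_op F) -> fejer_conv K ->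
  (forall k, D k (slice k K)) ->
  closed_span (\bigcup_(k in [set: int]) [set hat k F | F in D k]) K.
Proof.
move=> Db [bK lK cK] sK.
have sp : closed_subspace (closed_span (\bigcup_(k in [set: int]) [set hat k F | F in D k])).
  by apply: closed_span_closed => _ [k _ [F /Db bF <-]]; exact: hat_bop.
apply: (closed_approx sp bK) => e e0; have [n hn] := cK e e0.
exists (fejer n.+1 K).
  have [s0 _] := sp; apply: (subspaceZ _ s0).
  apply: (subspace_sum _ _ s0) => r; apply: (subspace_sum _ _ s0) => s.
  by apply: sub_closed_span; exists (r%:Z - s%:Z) => //; exists (slice (r%:Z - s%:Z) K).
by move=> w; rewrite -l2normN opprB; exact: hn.
Qed.

End Fejer.

(** * Graded algebras *)

Section Graded.
Variables (R : realType) (S : choiceType).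
Local Notation HZ := (l2 R (S * int)%type).

Lemma closed_span_mono (T : choiceType) (V1 V2 : set (l2 R T -> l2 R T)) :
  V2 `<=` @bounded_op R T -> V1 `<=` closed_span V2 -> closed_span V1 `<=` closed_span V2.
Proof. by move=> V2b V12; apply: closed_span_min => //; exact: closed_span_closed. Qed.

Definition graded (B : int -> set (l2 R S -> l2 R S)) : set (HZ -> HZ) :=
  closed_span (\bigcup_(k in [set: int]) [set hat k F | F in B k]).

Section GradedAlgebra.
Variable B : int -> set (l2 R S -> l2 R S).
Hypothesis Bb : forall k, B k `<=` @bounded_op R S.

Lemma graded_gen_bop : \bigcup_(k in [set: int]) [set hat k F | F in B k] `<=`
  @bounded_op R (S * int)%type.
Proof. by move=> _ [k _ [F BF <-]]; apply: hat_bop; exact: (Bb BF). Qed.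

Lemma graded_closed : closed_subspace (graded B).
Proof. exact: closed_span_closed graded_gen_bop. Qed.

Lemma hat_graded k F : B k F -> graded B (hat k F).
Proof. by move=> BF; apply: sub_closed_span; exists k => //; exists F. Qed.

Lemma graded_cstar :
  (forall k l F G, B k F -> B l G -> B (k + l) (F \o G)) ->
  (forall k F, B k F -> B (- k) (adjoint F)) ->
  cstar_subalgebra (graded B).
Proof.
move=> BM BA; have [sB cB] := graded_closed; split=> //; split=> //.
  move=> F G; apply: closed_span_mul; try exact: graded_gen_bop.
    exact: graded_closed.
  move=> _ _ [k _ [{}F BF <-]] [l _ [{}G BG <-]].
  rewrite hat_comp; [|exact: (Bb BF)|exact: (Bb BG)].
  by apply: hat_graded; exact: BM.
apply: (closed_span_map (op_map_adjoint R _) graded_closed graded_gen_bop).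
move=> _ [k _ [F BF <-]]; rewrite adjoint_hat; last exact: (Bb BF).
by apply: hat_graded; exact: BA.
Qed.

(** Slicing is continuous and kills the generators of every degree other than k. *)
Lemma slice_graded k K : closed_subspace (B k) -> graded B K -> B k (slice k K).
Proof.
move=> cB; apply: (closed_span_map (op_map_slice R S k) cB graded_gen_bop).
move=> _ [l _ [F BF <-]]; rewrite slice_hat; last exact: (Bb BF).
have [sB _] := cB; case: (k =P l) => [kl|_].
  by subst l; exact: (subspaceZ _ sB BF).
by under eq_fun do rewrite scale0r; case: sB.
Qed.

Lemma fejer_conv_graded K : graded B K -> fejer_conv K.
Proof.
apply: closed_span_min; first exact: fejer_conv_closed.
by move=> _ [k _ [F BF <-]]; apply: fejer_conv_hat; exact: (Bb BF).
Qed.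

End GradedAlgebra.

Lemma commutant_closed (T : choiceType) (G : l2 R T -> l2 R T) : bounded_op G ->
  closed_subspace [set K | bounded_op K /\ K \o G = G \o K].
Proof.
move=> bG; have lG := bop_lin bG.
have sub : op_subspace [set K | bounded_op K /\ K \o G = G \o K].
  split=> [K []//||a K L [bK cK] [bL cL]].
    by split; [exact: bop0|apply/funext => u; exact: esym (lin0 lG)].
  split; first exact: bop_lc.
  apply/funext => u /=; rewrite lG.
  have eK : K (G u) = G (K u) := congr1 (@^~ u) cK.
  have eL : L (G u) = G (L u) := congr1 (@^~ u) cL.
  by rewrite eK eL.
split=> //; have [Vb _ _] := sub; apply/(norm_closedP Vb) => K bK approx.
split=> //; have [M M0 GM] := bopP bG.
apply/funext => u /=; apply/eqP; rewrite -subr_eq0; apply/eqP.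
apply: (@l2norm_small _ _ _ (2 * M * l2norm u)) => e e0.
have [L [bL LG] KL] := approx e e0.
have cL : L (G u) = G (L u) := congr1 (@^~ u) LG.
have -> : K (G u) - G (K u) = (K (G u) - L (G u)) - G (K u - L u).
  by rewrite (linB lG) cL opprB subrKA.
apply: (le_trans (l2normD _ _)); rewrite l2normN.
have h1 : l2norm (K (G u) - L (G u)) <= e * (M * l2norm u).
  by apply: (le_trans (KL (G u))); rewrite ler_wpM2l // ltW.
have h2 : l2norm (G (K u - L u)) <= M * (e * l2norm u).
  by apply: (le_trans (GM _)); rewrite ler_wpM2l //; exact: KL.
apply: (le_trans (lerD h1 h2)); rewrite le_eqVlt; apply/orP; left; apply/eqP; ring.
Qed.

(** Commutants are closed subspaces: this lets first one factor, then the other, range over the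
    closed span. *)
Lemma closed_span_commute (T : choiceType) (V : set (l2 R T -> l2 R T)) :
  V `<=` @bounded_op R T -> commutative_set V -> commutative_set (closed_span V).
Proof.
move=> Vb cV; have [[sb _ _] _] := closed_span_closed Vb.
have step G : V G -> forall F, closed_span V F -> F \o G = G \o F.
  move=> VG F sF.
  have h := closed_span_min (commutant_closed (Vb _ VG)) (V := V).
  by have [] := h (fun K VK => conj (Vb _ VK) (cV _ _ VK VG)) F sF.
move=> F G sF sG.
have h := closed_span_min (commutant_closed (sb _ sG)) (V := V).
by have [] := h (fun K VK => conj (Vb _ VK) (esym (step K VK G sG))) F sF.
Qed.

End Graded.

(** The head of a word is the map applied first, so this splits off the first step of a chain. *)
Lemma big_tuple_cons (V : nmodType) (I : finType) n (F : n.+1.-tuple I -> V) :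
  \sum_(t : n.+1.-tuple I) F t = \sum_l \sum_(j : n.-tuple I) F [tuple of l :: j].
Proof.
rewrite pair_big /= (reindex (fun p : I * n.-tuple I => [tuple of p.1 :: p.2])) //.
exists (fun t : n.+1.-tuple I => (thead t, [tuple of behead t])) => [[l j]|t] _.
  by rewrite theadE; congr pair; apply: val_inj.
by rewrite -tuple_eta.
Qed.

(** * The operators of the iterated function system *)

Section Words.
Variables (R : realType) (X : topologicalType) (N : nat).
Variables (gamma : 'I_N -> X -> X) (XX : set X).
Hypothesis X_compact : compact [set: X].
Hypothesis gamma_cont : ifs gamma.
Hypothesis XX_inv : completely_invariant gamma XX.
Hypothesis XX_disj : trivIset [set: 'I_N] (fun k => gamma k @` XX).
Hypothesis XX_inj : forall k, {in XX &, injective (gamma k)}.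

Local Notation H := (l2 R XX).
Local Notation C := (Cplx R).

Lemma act_subproof k (x : XX) : gamma k (val x) \in XX.
Proof.
by apply/mem_set; have [h _] := XX_inv k; apply: h; exists (val x) => //;
  exact/set_mem/valP.
Qed.

Definition act k (x : XX) : XX := SigSub (act_subproof k x).

Lemma val_act k x : val (act k x) = gamma k (val x). Proof. by []. Qed.

Lemma act_inj2 k l x y : act k x = act l y -> k = l /\ x = y.
Proof.
move=> h; have e : gamma k (val x) = gamma l (val y) := congr1 val h.
have xX : XX (val x) by exact/set_mem/valP.
have yX : XX (val y) by exact/set_mem/valP.
have kl : k = l.
  apply: (XX_disj I I); exists (gamma k (val x)); split; first by exists (val x).
  by exists (val y).
subst l; split=> //; apply: val_inj; apply: (XX_inj _ _ e); exact: valP.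
Qed.

Lemma act_inj k : injective (act k). Proof. by move=> x y /act_inj2[]. Qed.

Definition wact (s : seq 'I_N) (x : XX) : XX := foldl (fun z k => act k z) x s.

Lemma val_wact s x : val (wact s x) = word_map gamma s (val x).
Proof. by elim: s x => //= k s IH x; rewrite IH. Qed.

(** The uniqueness of the word k of given length and of x in y = gamma_k(x), on which the definition
    of rho_{m,n} rests. *)
Lemma wact_inj2 s t x y : size s = size t -> wact s x = wact t y -> s = t /\ x = y.
Proof.
elim: s t x y => [|k s IH] [|l t] //= x y [st].
by move=> /(IH _ _ _ st)[-> /act_inj2[-> ->]].
Qed.

Lemma wact_tuple_inj2 n (s t : n.-tuple 'I_N) x y :
  wact s x = wact t y -> s = t /\ x = y.
Proof.
move=> /wact_inj2; rewrite !size_tuple => /(_ erefl)[st ->].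
by split=> //; apply: val_inj.
Qed.

Lemma wact_inj s : injective (wact s). Proof. by move=> x y /(wact_inj2 erefl)[]. Qed.

Lemma word_map_continuous s : continuous (word_map gamma s).
Proof.
elim: s => [|k s IH] x; first exact: cvg_id.
apply: (@continuous_comp _ _ _ (gamma k) (word_map gamma s)); first exact: gamma_cont.
exact: IH.
Qed.

(* A record, lest automation unfold continuity. *)
Record cont (a : X -> C) : Prop := Cont { contP : continuous a }.

Lemma cont_bounded (a : X -> C) : cont a -> bounded_fun (fun x : XX => a (val x)).
Proof.
move=> ca.
have cov := (compact_near_coveringP [set: X]).1 X_compact.
have [] : \forall M \near +oo%R, [set: X] `<=` (fun x => cmod (a x) <= M).
  apply: (cov R +oo%R (fun M x => cmod (a x) <= M)) => x _.
  have /cvgrPdist_lt/(_ 1 ltr01) h := @contP _ ca x.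
  (* Compactness is applied to the filter M -> +oo: the bound [cmod (a x) + 1] serves for all points
     near x. *)
  exists ([set y | `|a x - a y| < 1], [set M | cmod (a x) + 1 <= M]) => /=.
    by split; [exact: h|exact: nbhs_pinfty_ge (num_real _)].
  move=> [y M] [/= xy xM]; apply: le_trans xM.
  have -> : a y = a x + (a y - a x) by rewrite addrC subrK.
  by apply: (le_trans (cmodD _ _)); rewrite lerD2l cmod_le distrC ltW.
move=> M [Mr hM]; exists (M + 1) => x.
by apply: (hM (M + 1)); rewrite // ltrDl.
Qed.

Lemma cont_cst c : cont (fun=> c). Proof. by split => x; exact: cvg_cst. Qed.
Lemma contM a b : cont a -> cont b -> cont (fun x => a x * b x).
Proof. by move=> [ca] [cb]; split=> x; apply: cvgM; [exact: ca|exact: cb]. Qed.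
Lemma contD a b : cont a -> cont b -> cont (fun x => a x + b x).
Proof. by move=> [ca] [cb]; split=> x; apply: cvgD; [exact: ca|exact: cb]. Qed.
Lemma cont_comp a (f : X -> X) : cont a -> continuous f -> cont (fun x => a (f x)).
Proof. by move=> [ca] cf; split=> x; apply: continuous_comp; [exact: cf|exact: ca]. Qed.

Lemma conj_dist (z w : C) : `|z^* - w^*| = `|z - w|.
Proof. by rewrite -rmorphB /= norm_conjC. Qed.

Lemma contJ a : cont a -> cont (fun x => (a x)^*).
Proof.
move=> ca; split=> x; apply/cvgrPdist_lt => e e0.
have /cvgrPdist_lt/(_ e e0) := @contP _ ca x.
by apply: filterS => t; rewrite conj_dist.
Qed.

Lemma cont_sum I (r : seq I) (P : pred I) (a : I -> X -> C) :
  (forall i, cont (a i)) -> cont (fun x => \sum_(i <- r | P i) a i x).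
Proof.
move=> ca; elim: r => [|i r IH].
  by under eq_fun do rewrite big_nil; exact: cont_cst.
have -> : (fun x => \sum_(j <- i :: r | P j) a j x) =
    (fun x => if P i then a i x + \sum_(j <- r | P j) a j x
              else \sum_(j <- r | P j) a j x).
  by apply/funext => x; rewrite big_cons.
by case: (P i); [exact: (contD (ca i) IH)|exact: IH].
Qed.

Lemma cont_prod I (r : seq I) (P : pred I) (a : I -> X -> C) :
  (forall i, cont (a i)) -> cont (fun x => \prod_(i <- r | P i) a i x).
Proof.
move=> ca; elim: r => [|i r IH].
  by under eq_fun do rewrite big_nil; exact: cont_cst.
have -> : (fun x => \prod_(j <- i :: r | P j) a j x) =
    (fun x => if P i then a i x * \prod_(j <- r | P j) a j x
              else \prod_(j <- r | P j) a j x).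
  by apply/funext => x; rewrite big_cons.
by case: (P i); [exact: (contM (ca i) IH)|exact: IH].
Qed.

Definition mulA (a : X -> C) : H -> H := mulop (fun x : XX => a (val x)).

Lemma mulAE a u x : cont a -> mulA a u x = a (val x) * u x.
Proof. by move=> /cont_bounded h; rewrite /mulA mulopE. Qed.

Lemma mulA_bop a : cont a -> bounded_op (mulA a).
Proof. by move=> /cont_bounded h; exact: mulop_bop. Qed.

Lemma mulA_ket a x : cont a -> mulA a (ket R x) = a (val x) *: ket R x.
Proof. by move=> /cont_bounded h; exact: mulop_ket. Qed.

Lemma mulA_comp a b : cont a -> cont b -> mulA a \o mulA b = mulA (fun x => a x * b x).
Proof.
move=> ca cb; apply/funext => u; apply: l2ext => x /=.
by rewrite !mulAE ?mulrA //; exact: contM.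
Qed.

Lemma adjoint_mulA a : cont a -> adjoint (mulA a) = mulA (fun x => (a x)^*).
Proof. by move=> /cont_bounded h; exact: adjoint_mulop. Qed.

Lemma e_ket (x : XX) : e_ R XX (val x) = ket R x.
Proof. by rewrite /e_ valK. Qed.

Lemma XX_val x : XX x -> exists y : XX, x = val y.
Proof. by move=> /mem_set h; exists (SigSub h). Qed.

Lemma XX_valP (x : XX) : XX (val x). Proof. exact/set_mem/valP. Qed.

Lemma rho_AE a : cont a -> rho_A (XX := XX) a = mulA a.
Proof.
move=> ca; apply: the_op_eq; first exact: mulA_bop.
  by move=> _ /= /XX_val[x ->]; rewrite e_ket mulA_ket.
move=> K' _ /= h x; rewrite -e_ket h ?e_ket ?mulA_ket //; exact: XX_valP.
Qed.

Definition sop (f : X * X -> C) (u : H) : H :=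
  \sum_(k < N) push R (act k) (mulA (fun y => f (gamma k y, y)) u).

(** Continuity on the graph, pulled back along the parametrisation of each branch by X. *)
Definition cont_graph (f : X * X -> C) := forall k, cont (fun y => f (gamma k y, y)).

Lemma push_act_bop k : bounded_op (push R (act k)).
Proof. by apply: qop_bop; exact: winv_pinj. Qed.

Lemma sop_bop f : cont_graph f -> bounded_op (sop f).
Proof.
move=> cf; apply: bop_sum => k.
by apply: (bop_comp (push_act_bop k)); exact: mulA_bop.
Qed.

Lemma sop_ket f y : cont_graph f ->
  sop f (ket R y) = \sum_(k < N) f (gamma k (val y), val y) *: ket R (act k y).
Proof.
move=> cf; apply: eq_bigr => k _; rewrite mulA_ket //.
by rewrite (linZ (push_lin (act k))) push_ket //; exact: act_inj.
Qed.

Lemma rho_EE f : cont_graph f -> rho_E gamma (XX := XX) f = sop f.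
Proof.
move=> cf; apply: the_op_eq; first exact: sop_bop.
  move=> _ /= /XX_val[x ->]; rewrite e_ket sop_ket //.
  by apply: eq_bigr => k _; rewrite -val_act e_ket.
move=> K' _ /= h x; rewrite -e_ket h ?e_ket ?sop_ket //; last exact: XX_valP.
by apply: eq_bigr => k _; rewrite -val_act e_ket.
Qed.

Section Rho.
Variables m n : nat.
Implicit Types f : chain_space X m * chain_space X n -> C.

Definition wt f (j : m.-tuple 'I_N) (k : n.-tuple 'I_N) (x : X) : C :=
  f (word_chain gamma j x, word_chain gamma k x).

(** Continuity on X_{m,n}, read along each pair of words. Equivalence with the subspace topology is
    the content of [within_cont_words] and [cont_words_within]. *)
Definition cont_words f : Prop := forall j k, cont (wt f j k).

(** The sum of S_j f_{jk} S_k^* over pairs of words, with S_j the isometry e_x -> e_(gamma_j(x)). In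
    this form boundedness is immediate, and points outside the n-th image are sent to 0. *)
Definition rhoop f (u : H) : H :=
  \sum_(j : m.-tuple 'I_N) \sum_(k : n.-tuple 'I_N)
    push R (wact j) (mulA (wt f j k) (pull R (wact k) u)).

Lemma term_bop f (j : m.-tuple _) (k : n.-tuple _) : cont_words f ->
  bounded_op (fun u : H => push R (wact j) (mulA (wt f j k) (pull R (wact k) u))).
Proof.
move=> cf; apply: (@bop_comp _ _ (push R (wact j))).
  by apply: qop_bop; exact: winv_pinj.
apply: (@bop_comp _ _ (mulA (wt f j k))); first exact: mulA_bop.
by apply: qop_bop; apply: some_pinj; exact: wact_inj.
Qed.

Lemma rhoop_bop f : cont_words f -> bounded_op (rhoop f).
Proof.
by move=> cf; apply: bop_sum => j; apply: bop_sum => k; exact: term_bop.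
Qed.

Lemma rhoop_ket f (k : n.-tuple 'I_N) x : cont_words f ->
  rhoop f (ket R (wact k x)) =
  \sum_(j : m.-tuple 'I_N) wt f j k (val x) *: ket R (wact j x).
Proof.
move=> cf; apply: eq_bigr => j _; rewrite (bigD1 k) //= big1 ?addr0.
  rewrite pull_ket; last exact: wact_inj.
  rewrite mulA_ket // (linZ (push_lin (wact j))) push_ket //.
  exact: wact_inj.
move=> k' k'k; rewrite pull_ketN; last first.
- by move=> y /wact_tuple_inj2[kk _]; rewrite kk eqxx in k'k.
- exact: wact_inj.
by rewrite (lin0 (bop_lin (mulA_bop (cf _ _)))) (lin0 (push_lin (wact j))).
Qed.

Lemma rhoop_ketN f y : cont_words f ->
  (forall (k : n.-tuple 'I_N) x, wact k x <> y) -> rhoop f (ket R y) = 0.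
Proof.
move=> cf h; apply: big1 => j _; apply: big1 => k _.
rewrite pull_ketN; [|exact: wact_inj|exact: h].
by rewrite (lin0 (bop_lin (mulA_bop (cf _ _)))) (lin0 (push_lin (wact j))).
Qed.

Lemma iter_image (y : XX) : iter n (ifs_image gamma) XX (val y) <->
  exists (k : n.-tuple 'I_N) x, wact k x = y.
Proof.
suff h : iter n (ifs_image gamma) XX (val y) <->
    exists s x, size s = n /\ wact s x = y.
  rewrite h; split=> [[s [x [sn <-]]]|[k [x <-]]].
    by move: sn => /eqP sn; exists (Tuple sn), x.
  by exists k, x; rewrite size_tuple.
elim: n y => [|n' IH] y.
  by split=> [_|_]; [exists [::], y|exact: XX_valP].
split=> /= [[l _ [z zi zy]]|[s [x [sn <-]]]].
  (* Backward invariance: a predecessor of a point of XX lies in XX again. *)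
  have zX : XX z by have [_ h] := XX_inv l; apply: h; rewrite /= zy; exact: XX_valP.
  have [z' z'E] := XX_val zX; subst z.
  have [s [x [sn sx]]] := (IH z').1 zi.
  exists (rcons s l), x; rewrite size_rcons sn /wact foldl_rcons; split=> //.
  apply: val_inj; apply: etrans zy.
  exact: (congr1 (fun t => gamma l (val t)) sx).
case/lastP: s sn => // s l; rewrite size_rcons => -[sn].
exists l => //; exists (val (wact s x)); first by apply/IH; exists s, x.
by rewrite /wact foldl_rcons.
Qed.

Lemma rho_mnE f : cont_words f -> rho_mn gamma (XX := XX) f = rhoop f.
Proof.
move=> cf.
have wordE l (x : XX) : word_map gamma l (val x) = val (wact l x) by rewrite val_wact.
apply: the_op_eq; first exact: rhoop_bop.
  split=> [k _ /XX_val[x ->]|_ /XX_val[y ->] yn]; rewrite ?wordE e_ket.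
    by rewrite rhoop_ket //; apply: eq_bigr => j _; rewrite wordE e_ket.
  by rewrite rhoop_ketN // => k x kx; apply: yn; apply/iter_image; exists k, x.
move=> K' _ [h1 h2] y.
have [/iter_image[k [x <-]]|yn] := pselect (iter n (ifs_image gamma) XX (val y)).
  have := h1 k (val x) (XX_valP x); rewrite wordE e_ket rhoop_ket // => ->.
  by apply: eq_bigr => j _; rewrite wordE e_ket.
have := h2 (val y) (XX_valP y) yn; rewrite e_ket => ->.
by rewrite rhoop_ketN // => k x kx; apply: yn; apply/iter_image; exists k, x.
Qed.

Lemma rhoop_lc c f g : cont_words f -> cont_words g ->
  rhoop (fun p => c * f p + g p) = (fun u => c *: rhoop f u + rhoop g u).
Proof.
move=> cf cg; apply/funext => u.
rewrite /rhoop scaler_sumr -big_split; apply: eq_bigr => j _ /=.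
rewrite scaler_sumr -big_split; apply: eq_bigr => k _ /=.
rewrite -(push_lin (wact j)); congr (push _ _ _); apply: l2ext => x.
have ch : cont (wt (fun p => c * f p + g p) j k).
  exact: (contD (contM (cont_cst c) (cf j k)) (cg j k)).
set v := pull R (wact k) u.
by rewrite l2D l2Z (mulAE v x ch) (mulAE v x (cf j k)) (mulAE v x (cg j k)) mulrDl mulrA.
Qed.

Lemma rhoop_bnd f (e : R) : cont_words f -> 0 <= e ->
  (forall j k x, cmod (wt f j k x) <= e) ->
  bnd (\sum_(j : m.-tuple 'I_N) \sum_(k : n.-tuple 'I_N) e) (rhoop f).
Proof.
move=> cf e0 fe u; rewrite mulr_suml; apply: (le_trans (l2norm_sum _ _ _)).
apply: ler_sum => j _; rewrite mulr_suml; apply: (le_trans (l2norm_sum _ _ _)).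
apply: ler_sum => k _; apply: (le_trans (push_bnd _ _)); rewrite mul1r.
apply: (le_trans (mulop_bnd e0 _ _)); first by move=> x; exact: fe.
rewrite ler_wpM2l //; apply: (le_trans (pull_bnd _ _)); last by rewrite mul1r.
exact: wact_inj.
Qed.

End Rho.

(** * Words in continuous functions and s, and their cancellation *)

Definition sone : H -> H := sop (fun=> 1).

Lemma cont_graph1 : cont_graph (fun=> 1). Proof. by move=> k; exact: cont_cst. Qed.

Lemma sone_bop : bounded_op sone. Proof. exact: sop_bop cont_graph1. Qed.

Lemma sone_ket y : sone (ket R y) = \sum_(k < N) ket R (act k y).
Proof.
rewrite /sone sop_ket; last exact: cont_graph1.
by apply: eq_bigr => k _; rewrite scale1r.
Qed.

Lemma adjoint_soneE v x : adjoint sone v x = \sum_(k < N) v (act k x).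
Proof.
rewrite (adjointE _ _ sone_bop) sone_ket inner_suml.
by apply: eq_bigr => k _; rewrite inner_ketl.
Qed.

(** The right-hand side is the transfer operator applied to a. Cross terms vanish because
    [act k y = act l z] forces k = l and y = z, so s^* sends e_(gamma_k(y)) back to e_y. *)
Lemma adjoint_sone_mul a : cont a ->
  adjoint sone \o mulA a \o sone = mulA (fun x => \sum_(k < N) a (gamma k x)).
Proof.
move=> ca.
have cs : cont (fun x => \sum_(k < N) a (gamma k x)).
  by apply: cont_sum => k; apply: cont_comp => //; exact: gamma_cont.
apply: bop_ext.
- apply: bop_comp sone_bop; apply: (bop_comp (adjoint_bop sone_bop)).
  exact: mulA_bop.
- exact: mulA_bop.
move=> y; rewrite /= sone_ket (lin_sum (bop_lin (mulA_bop ca))).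
rewrite (lin_sum (bop_lin (adjoint_bop sone_bop))) (mulA_ket y cs) scaler_suml.
apply: eq_bigr => k _; rewrite (mulA_ket _ ca) (linZ (bop_lin (adjoint_bop sone_bop))).
congr (_ *: _); apply: l2ext => z; rewrite adjoint_soneE ketE.
rewrite (bigD1 k) //= big1 ?addr0 => [|l lk].
  by rewrite /ket_fun (inj_eq (@act_inj k)).
rewrite /ket_fun; case: eqP => // /act_inj2[kl _].
by rewrite kl eqxx in lk.
Qed.

Inductive W : nat -> (H -> H) -> Prop :=
| W0 a : cont a -> W 0 (mulA a)
| WS n F a : W n F -> cont a -> W n.+1 (F \o sone \o mulA a).

Lemma W_bop n F : W n F -> bounded_op F.
Proof.
elim=> [a|{}n {}F a _ bF] ca; first exact: mulA_bop.
by apply: bop_comp (mulA_bop ca); exact: bop_comp sone_bop.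
Qed.

Lemma W_mull a n F : cont a -> W n F -> W n (mulA a \o F).
Proof.
move=> ca; elim=> [b cb|{}n {}F b _ IH cb]; last exact: (WS IH cb).
by rewrite mulA_comp //; apply: W0; exact: contM.
Qed.

Lemma W_mulr a n F : cont a -> W n F -> W n (F \o mulA a).
Proof.
move=> ca [b cb|{}n {}F b WF cb].
  by rewrite mulA_comp //; apply: W0; exact: contM.
have -> : (F \o sone \o mulA b) \o mulA a = F \o sone \o mulA (fun x => b x * a x).
  by rewrite -mulA_comp.
by apply: WS => //; exact: contM.
Qed.

Lemma W_comp m n F G : W m F -> W n G -> W (m + n) (F \o G).
Proof.
move=> WF; elim=> [b cb|{}n {}G b _ IH cb]; first by rewrite addn0; exact: W_mulr.
by rewrite addnS; exact: (WS IH cb).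
Qed.

(** Words grow at their right end, but in [adjoint F \o G] cancellation takes place between the left
    ends of F and G; this exposes them. *)
Lemma W_left n F : W n.+1 F ->
  exists a F', [/\ cont a, W n F' & F = mulA a \o sone \o F'].
Proof.
elim: n F => [|n IH] F WF; inversion WF as [|n' F' b WF' cb]; subst.
  inversion WF' as [a ca|]; subst.
  by exists a, (mulA b); split=> //; exact: W0.
have [a [F'' [ca WF'' ->]]] := IH _ WF'.
by exists a, (F'' \o sone \o mulA b); split=> //; exact: WS.
Qed.

(** If F = a s F' and G = b s G', then F^* G = F'^* (s^* conj(a) b s) G'. The bracket is a function,
    which G' absorbs, and both words have lost one letter s. *)
Lemma W_cancel n p F G : W n F -> W (n + p) G -> W p (adjoint F \o G).
Proof.
elim: n F G => [|n IH] F G WF.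
  inversion WF as [a ca|]; subst; rewrite adjoint_mulA //.
  by apply: W_mull; exact: contJ.
move=> WG; have [a [F' [ca WF' ->]]] := W_left WF.
have [b [G' [cb WG' ->]]] := W_left WG.
have bF' := W_bop WF'; have bs := sone_bop; have ba := mulA_bop ca.
rewrite (adjoint_comp (bop_comp ba bs) bF') (adjoint_comp ba bs) adjoint_mulA //.
have cab : cont (fun x => (a x)^* * b x) by apply: contM => //; exact: contJ.
have -> : ((adjoint F' \o (adjoint sone \o mulA (fun x => (a x)^*))) \o
    (mulA b \o sone \o G')) =
    adjoint F' \o ((adjoint sone \o mulA (fun x => (a x)^* * b x) \o sone) \o G').
  by rewrite -(mulA_comp (contJ ca) cb).
rewrite (adjoint_sone_mul cab); apply: IH => //; apply: W_mull => //.
by apply: cont_sum => k; exact: (cont_comp cab (@gamma_cont k)).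
Qed.

Definition mono (m n : nat) (K : H -> H) : Prop :=
  exists M L, [/\ W m M, W n L & K = M \o adjoint L].

Lemma mono_bop m n K : mono m n K -> bounded_op K.
Proof.
move=> [M [L [WM WL ->]]]; apply: bop_comp (W_bop WM) _.
exact/adjoint_bop/(W_bop WL).
Qed.

Lemma adjoint_mono m n K : mono m n K -> mono n m (adjoint K).
Proof.
move=> [M [L [WM WL ->]]]; exists L, M; split=> //.
have bM := W_bop WM; have bL := W_bop WL.
by rewrite adjoint_comp ?adjointK //; exact: adjoint_bop.
Qed.

(** In M L^* P Q^* the middle pair collapses to a word of length p - n, absorbed by M, or to the
    adjoint of a word of length n - p, absorbed by Q. The difference of lengths is additive in both
    cases. *)
Lemma mono_comp m n p q K J : mono m n K -> mono p q J ->
  exists m' n', m'%:Z - n'%:Z = (m%:Z - n%:Z) + (p%:Z - q%:Z) /\ mono m' n' (K \o J).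
Proof.
move=> [M [L [WM WL ->]]] [P [Q [WP WQ ->]]].
have bM := W_bop WM; have bL := W_bop WL; have bP := W_bop WP; have bQ := W_bop WQ.
have [np|pn] := leqP n p.
  exists (m + (p - n))%N, q; split; first by lia.
  exists (M \o (adjoint L \o P)), Q; split=> //.
  have WP' : W (n + (p - n)) P by rewrite subnKC.
  exact: W_comp (W_cancel WL WP').
exists m, (q + (n - p))%N; split; first by lia.
exists M, (Q \o (adjoint P \o L)); split=> //.
  have WL' : W (p + (n - p)) L by rewrite subnKC // ltnW.
  exact: W_comp (W_cancel WP WL').
have bPL : bounded_op (adjoint P \o L) by apply: bop_comp => //; exact: adjoint_bop.
rewrite adjoint_comp // adjoint_comp ?adjointK //; exact: adjoint_bop.
Qed.

(** * Monomials as operators attached to functions on chains *)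

Local Notation tup0 := ([tuple] : 0.-tuple 'I_N).

Lemma word_chain0 (j : 0.-tuple 'I_N) x : word_chain gamma j x = (fun _ => x).
Proof. by apply/funext => i; rewrite /word_chain tuple0. Qed.

(** The function attached to F s a when [f] is attached to F: [f] sees the chain without its
    starting point, with x_1 as new base point in the second component, and [a] sees the starting
    point x_0. *)
Definition consf m (f : chain_space X m * chain_space X 0 -> C) (a : X -> C) :
    chain_space X m.+1 * chain_space X 0 -> C :=
  fun p => f (fun i => p.1 (lift ord0 i), fun _ => p.1 (lift ord0 ord0)) * a (p.1 ord0).

Lemma wt_consf m (f : chain_space X m * chain_space X 0 -> C) a l
    (j : m.-tuple 'I_N) (k : 0.-tuple 'I_N) x :
  wt (consf f a) [tuple of l :: j] k x = wt f j k (gamma l x) * a x.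
Proof.
rewrite /wt /consf /= [word_chain _ k (gamma l x)]word_chain0; congr (f (_, _) * _).
by apply/funext => i; rewrite /word_chain /= take0.
Qed.

Lemma cont_words_consf m (f : chain_space X m * chain_space X 0 -> C) a :
  cont_words f -> cont a -> cont_words (consf f a).
Proof.
move=> cf ca j k; rewrite (tuple_eta j).
have -> : wt (consf f a) [tuple of thead j :: behead j] k =
    (fun x => wt f [tuple of behead j] k (gamma (thead j) x) * a x).
  by apply/funext => x; rewrite -wt_consf; congr (wt _ _ _ _); apply: val_inj.
by apply: contM => //; apply: (cont_comp (cf _ _)); exact: gamma_cont.
Qed.

Lemma rhoop_ket0 m (f : chain_space X m * chain_space X 0 -> C) (x : XX) :
  cont_words f ->
  rhoop f (ket R x) = \sum_(j : m.-tuple 'I_N) wt f j tup0 (val x) *: ket R (wact j x).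
Proof. by move=> cf; rewrite -rhoop_ket. Qed.

Lemma rhoop_consf m (f : chain_space X m * chain_space X 0 -> C) a :
  cont_words f -> cont a -> rhoop f \o sone \o mulA a = rhoop (consf f a).
Proof.
move=> cf ca; have cc := cont_words_consf cf ca.
apply: bop_ext.
- by apply: bop_comp (mulA_bop ca); apply: bop_comp sone_bop; exact: rhoop_bop.
- exact: rhoop_bop.
move=> x /=; rewrite (rhoop_ket0 x cc) big_tuple_cons (mulA_ket x ca).
rewrite (linZ (bop_lin sone_bop)) (linZ (bop_lin (rhoop_bop cf))) sone_ket.
rewrite (lin_sum (bop_lin (rhoop_bop cf))) scaler_sumr.
apply: eq_bigr => l _; rewrite (rhoop_ket0 _ cf) scaler_sumr.
by apply: eq_bigr => j _; rewrite wt_consf scalerA mulrC.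
Qed.

Lemma rhoop00 (f : chain_space X 0 * chain_space X 0 -> C) a :
  cont a -> (forall z w, f (z, w) = a (z ord0)) -> rhoop f = mulA a.
Proof.
move=> ca fa.
have wE j k : wt f j k = a by apply/funext => x; rewrite /wt fa word_chain0.
have cf : cont_words f by move=> j k; rewrite wE.
apply: bop_ext; [exact: rhoop_bop|exact: mulA_bop|move=> x].
rewrite (rhoop_ket0 x cf) (mulA_ket x ca) (big_pred1 tup0) ?wE //.
by move=> j; apply/esym/eqP/val_inj; case: j => [[]].
Qed.

Lemma W_rhoop m M : W m M ->
  exists2 f : chain_space X m * chain_space X 0 -> C, cont_words f & M = rhoop f.
Proof.
elim=> [a ca|{}m F a _ [f cf ->] ca].
  exists (fun p => a (p.1 ord0)); last by rewrite (@rhoop00 _ a).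
  by move=> j k; have -> : wt (fun p => a (p.1 ord0)) j k = a;
    [apply/funext => x; rewrite /wt word_chain0|].
exists (consf f a); first exact: cont_words_consf.
exact: rhoop_consf.
Qed.

Definition prodc n (a : 'I_n.+1 -> X -> C) (z : chain_space X n) : C :=
  \prod_i a i (z i).

Lemma cont_prodc n (a : 'I_n.+1 -> X -> C) (j : n.-tuple 'I_N) :
  (forall i, cont (a i)) -> cont (fun x => prodc a (word_chain gamma j x)).
Proof.
move=> ca; apply: cont_prod => i; apply: cont_comp => //.
exact: word_map_continuous.
Qed.

Lemma W_prodc m (a : 'I_m.+1 -> X -> C) : (forall i, cont (a i)) ->
  W m (rhoop (fun p : chain_space X m * chain_space X 0 => prodc a p.1)).
Proof.
elim: m a => [|m IH] a ca.
  rewrite (@rhoop00 _ (a ord0)) //; first exact: W0.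
  by move=> z w; rewrite /prodc big_ord1.
have -> : (fun p : chain_space X m.+1 * chain_space X 0 => prodc a p.1) =
    consf (fun p => prodc (fun i => a (lift ord0 i)) p.1) (a ord0).
  by apply/funext => p; rewrite /consf /prodc big_ord_recl mulrC.
rewrite -rhoop_consf //; first by apply: WS => //; exact: IH.
by move=> j k; exact: cont_prodc.
Qed.

(** The function attached to the product of [rhoop f] with the adjoint of [rhoop g]. The chains of
    length 0 are filled with the base points. *)
Definition tensf m n (f : chain_space X m * chain_space X 0 -> C)
    (g : chain_space X n * chain_space X 0 -> C) (p : chain_space X m * chain_space X n) : C :=
  f (p.1, fun _ => p.1 ord0) * (g (p.2, fun _ => p.2 ord0))^*.

Lemma wt_tensf m n (f : chain_space X m * chain_space X 0 -> C)
    (g : chain_space X n * chain_space X 0 -> C) j k x :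
  wt (tensf f g) j k x = wt f j tup0 x * (wt g k tup0 x)^*.
Proof.
by rewrite /wt /tensf !word_chain0 /=; congr (f (_, _) * (g (_, _))^*);
  apply/funext => i; rewrite /word_chain take0.
Qed.

Lemma cont_words_tensf m n (f : chain_space X m * chain_space X 0 -> C)
    (g : chain_space X n * chain_space X 0 -> C) :
  cont_words f -> cont_words g -> cont_words (tensf f g).
Proof.
move=> cf cg j k.
have -> : wt (tensf f g) j k = (fun x => wt f j tup0 x * (wt g k tup0 x)^*).
  by apply/funext => x; exact: wt_tensf.
by apply: contM => //; exact: contJ.
Qed.

Lemma adjoint_rhoop0_ket n (g : chain_space X n * chain_space X 0 -> C)
    (k : n.-tuple 'I_N) x : cont_words g ->
  adjoint (rhoop g) (ket R (wact k x)) = (wt g k tup0 (val x))^* *: ket R x.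
Proof.
move=> cg; apply: l2ext => z.
rewrite (adjoint_entry _ _ (rhoop_bop cg)) (rhoop_ket0 z cg) l2_sum l2Z ketE.
rewrite (bigD1 k) // big1 => [|j /andP[_ jk]].
  rewrite l2Z ketE (inj_eq (@wact_inj k)) [z == x]eq_sym /= addr0.
  by case: (x =P z) => [->|_]; rewrite ?mulr1 // !mulr0 conjC0.
rewrite l2Z ketE.
case: (wact k x =P wact j z) => [/wact_tuple_inj2[kj _]|]; last by rewrite mulr0.
by rewrite kj eqxx in jk.
Qed.

Lemma adjoint_rhoop0_ketN n (g : chain_space X n * chain_space X 0 -> C) y :
  cont_words g -> (forall (k : n.-tuple 'I_N) x, wact k x <> y) ->
  adjoint (rhoop g) (ket R y) = 0.
Proof.
move=> cg yn; apply: l2ext => z.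
rewrite (adjoint_entry _ _ (rhoop_bop cg)) (rhoop_ket0 z cg) l2_sum l20.
rewrite big1 ?conjC0 // => j _; rewrite l2Z ketE.
by case: (y =P wact j z) => [e|]; [case: (yn j z)|rewrite mulr0].
Qed.

Lemma rhoop_tensf m n (f : chain_space X m * chain_space X 0 -> C)
    (g : chain_space X n * chain_space X 0 -> C) :
  cont_words f -> cont_words g ->
  rhoop f \o adjoint (rhoop g) = rhoop (tensf f g).
Proof.
move=> cf cg; have ct := cont_words_tensf cf cg.
have bf := rhoop_bop cf; have bg := rhoop_bop cg.
apply: bop_ext; [by apply: bop_comp => //; exact: adjoint_bop|exact: rhoop_bop|].
move=> y /=.
have [[k [x <-]]|yn] := pselect (exists (k : n.-tuple 'I_N) x, wact k x = y).
  rewrite adjoint_rhoop0_ket // (linZ (bop_lin bf)) (rhoop_ket0 x cf).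
  rewrite (rhoop_ket _ _ ct) scaler_sumr; apply: eq_bigr => j _.
  by rewrite wt_tensf scalerA mulrC.
have yn' (k : n.-tuple 'I_N) x : wact k x <> y by move=> e; apply: yn; exists k, x.
by rewrite adjoint_rhoop0_ketN // (rhoop_ketN ct yn') (lin0 (bop_lin bf)).
Qed.

Lemma mono_rhoop m n K : mono m n K ->
  exists2 f : chain_space X m * chain_space X n -> C, cont_words f & K = rhoop f.
Proof.
move=> [M [L [/W_rhoop[f cf ->] /W_rhoop[g cg ->] ->]]].
by exists (tensf f g); [exact: cont_words_tensf|exact: rhoop_tensf].
Qed.

Lemma mono_prodc m n (a : 'I_m.+1 -> X -> C) (b : 'I_n.+1 -> X -> C) :
  (forall i, cont (a i)) -> (forall i, cont (b i)) ->
  mono m n (rhoop (fun p : chain_space X m * chain_space X n =>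
    prodc a p.1 * prodc b p.2)).
Proof.
(* The second word enters through its adjoint, hence the conjugates. *)
move=> ca cb; pose b' i x := (b i x)^*.
have cb' i : cont (b' i) by exact: contJ.
have := W_prodc ca; have := W_prodc cb'.
set g := fun p : chain_space X n * chain_space X 0 => _.
set f := fun p : chain_space X m * chain_space X 0 => _.
move=> Wg Wf; exists (rhoop f), (rhoop g); split=> //.
rewrite rhoop_tensf; try by move=> j k; exact: cont_prodc.
congr rhoop; apply/funext => p; rewrite /tensf /f /g /=; congr (_ * _).
by rewrite /prodc rmorph_prod /=; apply: eq_bigr => i _; rewrite /b' conjCK.
Qed.

(** * The topology of the spaces of chains *)

Hypothesis X_hausdorff : hausdorff_space X.

Lemma hausdorff_nbhs (x y : X) : x <> y ->
  exists A B, [/\ nbhs x A, nbhs y B & forall z, A z -> B z -> False].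
Proof.
move=> /eqP xy; move: X_hausdorff; rewrite open_hausdorff => /(_ _ _ xy).
move=> [[A B] /= [/set_mem Ax /set_mem By] [oA oB /eqP AB]].
exists A, B; split; try exact: open_nbhs_nbhs.
by move=> z Az Bz; have : (A `&` B) z by []; rewrite AB.
Qed.

Lemma word_chain_continuous n (j : n.-tuple 'I_N) :
  continuous (fun x => word_chain gamma j x : chain_space X n).
Proof.
move=> x; apply/cvg_sup => i U [V] [[O] oO <-] Ox OU.
apply: (filterS OU); apply: (@word_map_continuous (take i j) x).
exact: open_nbhs_nbhs.
Qed.

Lemma coord_continuous n (i : 'I_n.+1) : continuous (fun z : chain_space X n => z i).
Proof. exact: (@proj_continuous _ (fun=> X) i). Qed.

Section Chains.
Variables m n : nat.
Implicit Types f : chain_space X m * chain_space X n -> C.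

Definition chains (j : m.-tuple 'I_N) (k : n.-tuple 'I_N) (x : X) :
    chain_space X m * chain_space X n :=
  (word_chain gamma j x, word_chain gamma k x).

Lemma chains_continuous j k : continuous (chains j k).
Proof.
move=> x.
exact: (cvg_pair (@word_chain_continuous m j x) (@word_chain_continuous n k x)).
Qed.

Lemma word_chain_ord0 (r : nat) (j : r.-tuple 'I_N) x : word_chain gamma j x ord0 = x.
Proof. by rewrite /word_chain take0. Qed.

Lemma word_map_rcons s l x : word_map gamma (rcons s l) x = gamma l (word_map gamma s x).
Proof. exact: foldl_rcons. Qed.

Lemma is_chain_word (r : nat) (z : chain_space X r) : is_chain gamma z <->
  exists j : r.-tuple 'I_N, z = word_chain gamma j (z ord0).
Proof.
split=> [h|[j zj] i]; last first.
  exists (tnth j i); rewrite zj /word_chain /= (tnth_nth (tnth j i)).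
  by rewrite (take_nth (tnth j i)) ?size_tuple // word_map_rcons.
pose l i := projT1 (cid (h i)).
have lE i : z (lift ord0 i) = gamma (l i) (z (widen_ord (leqnSn r) i)).
  exact: (projT2 (cid (h i))).
have [j jE] : exists j : r.-tuple 'I_N, forall i, tnth j i = l i.
  by exists (mktuple l) => i; rewrite tnth_mktuple.
exists j; suff h' i (ir : (i < r.+1)%N) : z (Ordinal ir) = word_map gamma (take i j) (z ord0).
  by apply/funext => -[i ir]; exact: h'.
elim: i ir => [|i IH] ir; first by rewrite take0 /=; congr z; exact: val_inj.
have ir' : (i < r)%N by [].
rewrite (take_nth (l (Ordinal ir'))) ?size_tuple // word_map_rcons -(IH (ltnW ir)).
have -> : z (Ordinal ir) = z (lift ord0 (Ordinal ir')) by congr z; exact: val_inj.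
rewrite lE -[i in nth _ _ i]/(val (Ordinal ir')) -tnth_nth jE.
by congr (gamma _ (z _)); exact: val_inj.
Qed.

(** This presents X_{m,n} as a finite union of continuous images of X, one for each pair of words;
    compactness and the treatment of continuity both use it. *)
Lemma chain_pairsP (p : chain_space X m * chain_space X n) :
  chain_pairs gamma p <-> exists j k x, p = chains j k x.
Proof.
case: p => z w; split=> [[/= /is_chain_word[j zj] /is_chain_word[k wk] zw]|].
  by exists j, k, (z ord0); rewrite /chains {1}zj wk zw.
move=> [j [k [x [-> ->]]]]; split => /=; last by rewrite !word_chain_ord0.
  by apply/is_chain_word; exists j; rewrite word_chain_ord0.
by apply/is_chain_word; exists k; rewrite word_chain_ord0.
Qed.

Lemma coord1_continuous i :
  continuous (fun q : chain_space X m * chain_space X n => q.1 i).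
Proof.
move=> q; apply: (cvg_comp fst (fun z : chain_space X m => z i)); first exact: cvg_fst.
exact: coord_continuous.
Qed.

Lemma coord2_continuous i :
  continuous (fun q : chain_space X m * chain_space X n => q.2 i).
Proof.
move=> q; apply: (cvg_comp snd (fun z : chain_space X n => z i)); first exact: cvg_snd.
exact: coord_continuous.
Qed.

Lemma within_comp (T U V : topologicalType) (A : set U) (g : T -> U) (f : U -> V) :
  {within A, continuous f} -> continuous g -> (forall x, A (g x)) ->
  continuous (f \o g).
Proof.
move=> /subspace_continuousP cf cg gA x O /= /(cf _ (gA x)) h0.
have h : nbhs x (g @^-1` [set y | A y -> O (f y)]) by exact: (cg x _ h0).
by apply: filterS h => y /= hy; apply: hy; exact: gA.
Qed.

Lemma within_cont_words f :
  {within [set p | chain_pairs gamma p], continuous f} -> cont_words f.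
Proof.
move=> cf j k; have h x : chain_pairs gamma (chains j k x).
  by apply/chain_pairsP; exists j, k, x.
by split; exact: (within_comp cf (@chains_continuous j k) h).
Qed.

(** There are finitely many pairs of words, so each can be treated separately near p. If p lies on
    the image of [chains j k], the base point of q tends to that of p and [cf] applies; otherwise a
    neighbourhood of p misses this image. *)
Lemma cont_words_within f : cont_words f ->
  {within [set p | chain_pairs gamma p], continuous f}.
Proof.
move=> cf; apply/subspace_continuousP => p _ O nO.
have c0 := @coord1_continuous ord0.
suff h j k : \forall q \near p, forall x, q = chains j k x -> O (f q).
  pose S (jk : (m.-tuple 'I_N * n.-tuple 'I_N)%type) :=
    [set q | forall x, q = chains jk.1 jk.2 x -> O (f q)].
  have hS := @filter_forall _ _ S (nbhs p) (nbhs_filter p) (fun jk => h jk.1 jk.2).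
  suff : nbhs p [set q | chain_pairs gamma q -> O (f q)] by [].
  by apply: filterS hS => q hq /chain_pairsP[j [k [x e]]]; exact: (hq (j, k) x e).
set x0 := p.1 ord0.
have c0x x : (chains j k x).1 ord0 = x by exact: word_chain_ord0.
(* A coordinate at which p differs from the chain through its own base point x0 keeps differing
   nearby: both sides depend continuously on q and X is Hausdorff. *)
have sep (g : chain_space X m * chain_space X n -> X) s : continuous g ->
    (forall x, g (chains j k x) = word_map gamma s x) ->
    word_map gamma s x0 <> g p ->
    \forall q \near p, forall x, q = chains j k x -> O (f q).
  move=> cg gE /hausdorff_nbhs[A [B [nA nB AB]]].
  have h1 : \forall q \near p, A (word_map gamma s (q.1 ord0)).
    exact: (c0 p _ (@word_map_continuous s x0 _ nA)).
  have h2 : \forall q \near p, B (g q) by exact: (cg p _ nB).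
  apply: filterS2 h1 h2 => q Aq Bq x qx; exfalso; apply: AB Bq.
  by rewrite qx gE; move: Aq; rewrite qx c0x.
have [e|ne] := pselect (p = chains j k x0).
  have h : \forall q \near p, O (f (chains j k (q.1 ord0))).
    have nO' : nbhs (wt f j k x0) O by rewrite /wt -/(chains j k x0) -e.
    exact: (c0 p _ (@contP _ (cf j k) x0 _ nO')).
  by apply: filterS h => q Oq x qx; move: Oq; rewrite qx c0x.
have [h1|] := pselect (forall i : 'I_m.+1, word_map gamma (take i j) x0 = p.1 i).
  have [h2|] := pselect (forall i : 'I_n.+1, word_map gamma (take i k) x0 = p.2 i).
    exfalso; apply: ne; rewrite /chains [LHS]surjective_pairing.
    by congr pair; apply/funext => i; rewrite /word_chain ?h1 ?h2.
  move=> /existsNP[i ni]; apply: (sep (fun q => q.2 i) (take i k)) => //.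
exact: coord2_continuous.
move=> /existsNP[i ni]; apply: (sep (fun q => q.1 i) (take i j)) => //.
exact: coord1_continuous.
Qed.

End Chains.

(** * Separation of points by continuous functions *)

Lemma cont_real (u : X -> R) : continuous u -> cont (fun x => ((u x)%:C)%C : C).
Proof.
move=> cu; split=> x; apply/cvgrPdist_lt => e e0.
have [eI eR] : complex.Im e = 0 /\ 0 < complex.Re e.
  by move: e0; rewrite ltcE /= => /andP[/eqP -> ->].
have eE : e = ((complex.Re e)%:C)%C by case: e eI {e0 eR} => a b /= ->.
have /cvgrPdist_lt/(_ _ eR) := cu x.
apply: filterS => t ht; rewrite -rmorphB /= eE.
have -> : `|((u x - u t)%:C)%C : C| = ((`|u x - u t|)%:C)%C.
  by rewrite normcE /cmod /normc2 /= expr0n addr0 sqrtr_sqr.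
by rewrite ltcR.
Qed.

Lemma sep_urysohn (A B : set X) : closed A -> closed B -> A `&` B = set0 ->
  exists u : X -> R, [/\ continuous u, forall x, 0 <= u x <= 1,
    forall x, A x -> u x = 0 & forall x, B x -> u x = 1].
Proof.
move=> cA cB AB.
have nX : normal_space X := compact_normal X_hausdorff X_compact.
have /(@uniform_separatorP _ R)[u [cu u01 uA uB]] :=
  (@normal_separatorP R X).1 nX _ _ cA cB AB.
exists u; split=> //.
- by move=> x; have := u01 (u x) (ex_intro2 _ _ x I erefl); rewrite /= in_itv.
- by move=> x Ax; exact: (uA (u x) (ex_intro2 _ _ x Ax erefl)).
- by move=> x Bx; exact: (uB (u x) (ex_intro2 _ _ x Bx erefl)).
Qed.

(** Urysohn's lemma is applied twice: u separates the points, and v separates the sets where u is at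
    most 1/3 and at least 2/3. These contain neighbourhoods of y and x, so v is constant near each
    point. *)
Lemma separating_function (x y : X) : x <> y ->
  exists a : X -> C, [/\ cont a, forall z, 0 <= a z <= 1,
    \forall z \near x, a z = 1 & \forall z \near y, a z = 0].
Proof.
move=> xy; have cl1 (z : X) : closed [set z].
  by apply: compact_closed => //; exact: compact_set1.
have [|u [cu _ uy ux]] := @sep_urysohn [set y] [set x] (cl1 y) (cl1 x).
  by apply/seteqP; split=> // z [-> /esym].
pose A := u @^-1` [set r | r <= 3^-1]; pose B := u @^-1` [set r | 2 / 3 <= r].
have cA : closed A by exact: ((continuous_closedP u).1 cu _ (@closed_le _ _)).
have cB : closed B by exact: ((continuous_closedP u).1 cu _ (@closed_ge _ _)).
have [|v [cv v01 vA vB]] := @sep_urysohn A B cA cB.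
  apply/seteqP; split=> // z [] /=; rewrite /A /B /= => h1 h2.
  by have := le_trans h2 h1; lra.
exists (fun z => ((v z)%:C)%C); split.
- exact: cont_real.
- by move=> z; have /andP[v0 v1] := v01 z; rewrite ler0c v0 -[1]/((1%:C)%C : C) lecR.
- have h : \forall z \near x, 2 / 3 < u z.
    have nO : nbhs (u x) [set r | 2 / 3 < r].
      apply: open_nbhs_nbhs; split; [exact: open_gt|rewrite /= (ux x) //].
      by rewrite ltr_pdivrMr // mul1r ltr_nat.
    exact: (cu x _ nO).
  by apply: filterS h => z /ltW zB; rewrite vB.
- have h : \forall z \near y, u z < 3^-1.
    have nO : nbhs (u y) [set r | r < 3^-1].
      by apply: open_nbhs_nbhs; split; [exact: open_lt|rewrite /= (uy y) // invr_gt0].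
    exact: (cu y _ nO).
  by apply: filterS h => z /ltW zA; rewrite vA.
Qed.

(** * Density of products of coordinate functions *)

Section Density.
Variables m n : nat.
Implicit Types f g : chain_space X m * chain_space X n -> C.

Lemma compact_chain_pairs : compact [set p | @chain_pairs X N gamma m n p].
Proof.
have -> : [set p | @chain_pairs X N gamma m n p] =
    \bigcup_(jk in [set: (m.-tuple 'I_N * n.-tuple 'I_N)%type])
      (chains jk.1 jk.2 @` [set: X]).
  apply/seteqP; split=> p.
    by move=> /chain_pairsP[j [k [x ->]]]; exists (j, k) => //; exists x.
  by move=> [[j k] _ [x _ <-]]; apply/chain_pairsP; exists j, k, x.
have -> : [set: (m.-tuple 'I_N * n.-tuple 'I_N)%type] =
    [set` enum {: m.-tuple 'I_N * n.-tuple 'I_N}].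
  by apply/seteqP; split=> // jk _ /=; rewrite mem_enum.
elim: (enum _) => [|jk s IH].
  by rewrite set_nil bigcup_set0; exact: compact0.
have -> : [set` jk :: s] = [set jk] `|` [set` s].
  apply/seteqP; split=> r /=; rewrite in_cons.
    by move=> /orP[/eqP->|]; [left|right].
  by move=> [->|->]; rewrite ?eqxx ?orbT.
rewrite bigcup_setU bigcup_set1; apply: compactU => //.
apply: continuous_compact => //; apply: continuous_subspaceT.
exact: chains_continuous.
Qed.

Let span := closed_span (@mono m n).

Let span_closed : closed_subspace span.
Proof. by apply: closed_span_closed => K; exact: mono_bop. Qed.

(* The functions f such that multiplying f by products of coordinate functions
   stays in the closed span; [Pdense] are their multipliers, an algebra. *)
Definition Qdense f := cont_words f /\
  forall (a : 'I_m.+1 -> X -> C) (b : 'I_n.+1 -> X -> C),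
    (forall i, cont (a i)) -> (forall i, cont (b i)) ->
    span (rhoop (fun p => f p * (prodc a p.1 * prodc b p.2))).

Lemma cont_words_lc c f g : cont_words f -> cont_words g ->
  cont_words (fun p => c * f p + g p).
Proof.
by move=> cf cg j k; exact: (contD (contM (cont_cst c) (cf j k)) (cg j k)).
Qed.

Lemma cont_wordsM f g : cont_words f -> cont_words g ->
  cont_words (fun p => f p * g p).
Proof. by move=> cf cg j k; exact: (contM (cf j k) (cg j k)). Qed.

Lemma cont_words_prodc (a : 'I_m.+1 -> X -> C) (b : 'I_n.+1 -> X -> C) :
  (forall i, cont (a i)) -> (forall i, cont (b i)) ->
  cont_words (fun p => prodc a p.1 * prodc b p.2).
Proof. by move=> ca cb j k; exact: (contM (cont_prodc _ ca) (cont_prodc _ cb)). Qed.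

Lemma Qdense_lc c f g : Qdense f -> Qdense g -> Qdense (fun p => c * f p + g p).
Proof.
move=> [cf Qf] [cg Qg]; split; first exact: cont_words_lc.
move=> a b ca cb.
have cab := cont_words_prodc ca cb.
have -> : (fun p => (c * f p + g p) * (prodc a p.1 * prodc b p.2)) =
    (fun p => c * (f p * (prodc a p.1 * prodc b p.2)) +
      g p * (prodc a p.1 * prodc b p.2)).
  by apply/funext => p; ring.
rewrite rhoop_lc; [|exact: cont_wordsM|exact: cont_wordsM].
have [[_ _ h] _] := span_closed.
by apply: h; [exact: Qf|exact: Qg].
Qed.

Lemma Qdense1 : Qdense (fun=> 1).
Proof.
split; first by move=> j k; exact: cont_cst.
move=> a b ca cb; apply: sub_closed_span.
have -> : (fun p : chain_space X m * chain_space X n =>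
    1 * (prodc a p.1 * prodc b p.2)) = (fun p => prodc a p.1 * prodc b p.2).
  by apply/funext => p; rewrite mul1r.
exact: mono_prodc.
Qed.

Definition Pdense f := [/\ forall p, 0 <= f p <= 1, cont_words f &
  forall g, Qdense g -> Qdense (fun p => f p * g p)].

Lemma prodc_upd r (a : 'I_r.+1 -> X -> C) (i : 'I_r.+1) (c : X -> C)
    (z : chain_space X r) :
  c (z i) * prodc a z = prodc (fun l x => if l == i then c x * a l x else a l x) z.
Proof.
rewrite /prodc (bigD1 i) //= [RHS](bigD1 i) //= eqxx mulrA; congr (_ * _).
by apply: eq_bigr => l /negPf->.
Qed.

Lemma Pdense_coord1 (i : 'I_m.+1) (c : X -> C) : cont c ->
  (forall x, 0 <= c x <= 1) -> Pdense (fun p => c (p.1 i)).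
Proof.
move=> cc c01; have ccw : cont_words (fun p : chain_space X m * chain_space X n => c (p.1 i)).
  by move=> j k; exact: (cont_comp cc (@word_map_continuous (take i j))).
split=> [p||g [cg Qg]]; [exact: c01|exact: ccw|].
split; first exact: (cont_wordsM ccw cg).
move=> a b ca cb.
have -> : (fun p => c (p.1 i) * g p * (prodc a p.1 * prodc b p.2)) =
    (fun p => g p * (prodc (fun l x => if l == i then c x * a l x else a l x) p.1 *
       prodc b p.2)).
  by apply/funext => p; rewrite -(prodc_upd a i c); ring.
by apply: Qg => // l; case: (l == i); [exact: contM|].
Qed.

Lemma Pdense_coord2 (i : 'I_n.+1) (c : X -> C) : cont c ->
  (forall x, 0 <= c x <= 1) -> Pdense (fun p => c (p.2 i)).
Proof.
move=> cc c01; have ccw : cont_words (fun p : chain_space X m * chain_space X n => c (p.2 i)).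
  by move=> j k; exact: (cont_comp cc (@word_map_continuous (take i k))).
split=> [p||g [cg Qg]]; [exact: c01|exact: ccw|].
split; first exact: (cont_wordsM ccw cg).
move=> a b ca cb.
have -> : (fun p => c (p.2 i) * g p * (prodc a p.1 * prodc b p.2)) =
    (fun p => g p * (prodc a p.1 *
       prodc (fun l x => if l == i then c x * b l x else b l x) p.2)).
  by apply/funext => p; rewrite -(prodc_upd b i c); ring.
by apply: Qg => // l; case: (l == i); [exact: contM|].
Qed.

Lemma rhoop_dense f : cont_words f -> span (rhoop f).
Proof.
move=> cf.
have dense (e : C) : 0 < e -> exists2 g, Qdense g &
    forall p, chain_pairs gamma p -> `|f p - g p| <= e.
  move=> e0; apply: (@approx_on_compact _ C _ Pdense compact_chain_pairs).
  - by move=> g [h _ _]; exact: h.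
  - split; [by move=> p; rewrite ler01 lexx|by move=> j k; exact: cont_cst|].
    by move=> g; under eq_fun do rewrite mul1r.
  - move=> g h [g01 cg Pg] [h01 ch Ph]; split; last first.
    + move=> q Qq; have := Pg _ (Ph _ Qq).
      by under eq_fun do rewrite mulrA.
    + exact: cont_wordsM.
    + move=> p; have /andP[g0 g1] := g01 p; have /andP[h0 h1] := h01 p.
      by rewrite mulr_ge0 //= mulr_ile1.
  - move=> g [g01 cg Pg]; split.
    + by move=> p; have /andP[g0 g1] := g01 p; rewrite subr_ge0 g1 gerBl.
    + have := cont_words_lc (-1) cg (g := fun=> 1) (fun j k => cont_cst 1).
      by under eq_fun do rewrite mulN1r addrC.
    + move=> q Qq; have := Qdense_lc (-1) (Pg _ Qq) Qq.
      by under eq_fun do rewrite mulN1r -{2}[q _]mul1r addrC -mulrBl.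
  - move=> p q _ _ pq.
    have [h1|/existsNP[i ni]] := pselect (forall i : 'I_m.+1, p.1 i = q.1 i).
      have [h2|/existsNP[i ni]] := pselect (forall i : 'I_n.+1, p.2 i = q.2 i).
        exfalso; apply: pq; rewrite [LHS]surjective_pairing [RHS]surjective_pairing.
        by congr pair; apply/funext.
      have [c [cc c01 c1 c0]] := separating_function ni.
      exists (fun p => c (p.2 i)); first exact: Pdense_coord2.
      by split; [exact: (@coord2_continuous m n i p _ c1)|
        exact: (@coord2_continuous m n i q _ c0)].
    have [c [cc c01 c1 c0]] := separating_function ni.
    exists (fun p => c (p.1 i)); first exact: Pdense_coord1.
    by split; [exact: (@coord1_continuous m n i p _ c1)|
      exact: (@coord1_continuous m n i q _ c0)].
  (* The zero function is obtained as -1 + 1. *)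
  - have := Qdense_lc (-1) Qdense1 Qdense1.
    by under eq_fun do rewrite mulN1r addNr.
  - move=> c h g [h01 ch Ph] Qg; have := Qdense_lc c (Ph _ Qdense1) Qg.
    by under eq_fun do rewrite mulr1 addrC.
  - exact: e0.
  - move=> p Kp; have /subspace_continuousP h := cont_words_within cf.
    have /cvgrPdist_le/(_ e e0) := h p Kp.
    exact: id.
apply: (closed_approx span_closed); first exact: rhoop_bop.
(* [M] is the number of pairs of words, the factor lost in [rhoop_bnd] when passing from the
   supremum of the function to a bound for the operator. *)
move=> e e0; pose M : R := \sum_(j : m.-tuple 'I_N) \sum_(k : n.-tuple 'I_N) 1.
have M0 : 0 <= M by apply: sumr_ge0 => *; exact: sumr_ge0.
have M1 : 0 < M + 1 by rewrite ltr_wpDl.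
pose d := e / (M + 1); have d0 : 0 < d by rewrite divr_gt0.
have d0C : 0 < (d%:C)%C :> C by rewrite ltcR.
have [g [cg Qg] fg] := dense _ d0C.
exists (rhoop g).
  (* With all coordinate functions equal to 1, membership of g in [Qdense] says that [rhoop g]
     itself lies in the span. *)
  have := Qg (fun _ _ => 1) (fun _ _ => 1) (fun=> cont_cst 1) (fun=> cont_cst 1).
  have -> // : (fun p : chain_space X m * chain_space X n =>
      g p * (prodc (fun _ _ => 1) p.1 * prodc (fun _ _ => 1) p.2)) = g.
  by apply/funext => p; rewrite /prodc !big1_eq !mulr1.
have cfg := cont_words_lc (-1) cg cf.
have -> : (fun u => rhoop f u - rhoop g u) = rhoop (fun p => -1 * g p + f p).
  by rewrite rhoop_lc //; apply/funext => u; rewrite scaleN1r addrC.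
have fgd j k x : cmod (wt (fun p => -1 * g p + f p) j k x) <= d.
  rewrite cmod_le /wt mulN1r addrC; apply: fg; apply/chain_pairsP.
  by exists j, k, x.
apply: bnd_wide (rhoop_bnd cfg (ltW d0) fgd).
have -> : \sum_(j : m.-tuple 'I_N) \sum_(k : n.-tuple 'I_N) d = d * M.
  by rewrite mulr_sumr; apply: eq_bigr => j _; rewrite mulr_sumr;
    apply: eq_bigr => k _; rewrite mulr1.
by rewrite /d mulrAC ler_pdivrMr // ler_wpM2l ?(ltW e0) // lerDl.
Qed.

End Density.

(** * Diagonal operators *)

Lemma diagonalP (F : H -> H) : diagonal_op F <->
  bounded_op F /\ forall x y : XX, x <> y -> F (ket R y) x = 0.
Proof.
split=> -[bF h]; split=> //.
  move=> x y xy; rewrite -inner_ketl -!e_ket; apply: h; try exact: XX_valP.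
  by move=> /val_inj.
move=> _ _ /XX_val[x ->] /XX_val[y ->] xy; rewrite !e_ket inner_ketl.
by apply: h => e; apply: xy; rewrite e.
Qed.

Lemma diagonal_ket (F : H -> H) x : diagonal_op F ->
  F (ket R x) = F (ket R x) x *: ket R x.
Proof.
move=> /diagonalP[_ h]; apply: l2ext => y; rewrite l2Z ketE.
by case: (y =P x) => [->|yx]; rewrite ?mulr1 // mulr0 h.
Qed.

Lemma diagonal_comp (F G : H -> H) : diagonal_op F -> diagonal_op G ->
  diagonal_op (F \o G) /\ F \o G = G \o F.
Proof.
move=> dF dG; have [bF _] := dF; have [bG _] := dG.
have bFG := bop_comp bF bG; have bGF := bop_comp bG bF.
have hF x : (F \o G) (ket R x) = (F (ket R x) x * G (ket R x) x) *: ket R x.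
  rewrite /= (diagonal_ket x dG) (linZ (bop_lin bF)) {1}(diagonal_ket x dF).
  by rewrite scalerA mulrC !l2Z !ketE eqxx !mulr1.
have hG x : (G \o F) (ket R x) = (F (ket R x) x * G (ket R x) x) *: ket R x.
  rewrite /= (diagonal_ket x dF) (linZ (bop_lin bG)) {1}(diagonal_ket x dG).
  by rewrite scalerA !l2Z !ketE eqxx !mulr1.
split; last by apply: bop_ext => // x; rewrite hF hG.
apply/diagonalP; split=> // x y /eqP/negPf xy.
by rewrite hF l2Z ketE xy mulr0.
Qed.

Lemma diagonal_adjoint (F : H -> H) : diagonal_op F -> diagonal_op (adjoint F).
Proof.
move=> /diagonalP[bF h]; apply/diagonalP; split; first exact: adjoint_bop.
by move=> x y xy; rewrite adjoint_entry // h ?conjC0 // => e; apply: xy.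
Qed.

Lemma diagonal_mulA a : cont a -> diagonal_op (mulA a).
Proof.
move=> ca; apply/diagonalP; split; first exact: mulA_bop.
by move=> x y /eqP/negPf xy; rewrite mulA_ket // l2Z ketE xy mulr0.
Qed.

(** * The spaces B_k and D_k *)

Definition monoK (k : int) : set (H -> H) :=
  [set K | exists m n : nat, m%:Z - n%:Z = k /\ mono m n K].

Lemma monoK_bop k : monoK k `<=` @bounded_op R XX.
Proof. by move=> K [m [n [_ mK]]]; exact: (mono_bop mK). Qed.

(** Products and adjoints of monomials are computable, those of general elements of E_{m,n} less so;
    the algebraic properties of B_k are therefore checked on monomials. *)
Lemma B_E k : B_ gamma (XX := XX) k = closed_span (monoK k).
Proof.
have Eb : [set F | exists m n : nat, m%:Z - n%:Z = k /\ E_mn gamma (XX := XX) m n F] `<=`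
    @bounded_op R XX.
  move=> F [m [n [_ [f /within_cont_words cf <-]]]].
  by rewrite rho_mnE //; exact: rhoop_bop.
apply/seteqP; split.
  apply: closed_span_mono; first exact: monoK_bop.
  move=> F [m [n [mn [f /within_cont_words cf <-]]]]; rewrite rho_mnE //.
  apply: (closed_span_mono _ _ (rhoop_dense cf)); first exact: monoK_bop.
  by move=> K mK; apply: sub_closed_span; exists m, n.
apply: closed_span_mono => // K [m [n [mn mK]]]; apply: sub_closed_span.
exists m, n; split=> //; have [f cf ->] := mono_rhoop mK.
by exists f; [exact: cont_words_within|exact: rho_mnE].
Qed.

Local Notation B k := (B_ gamma (R := R) (XX := XX) k).
Local Notation D k := (D_ gamma (R := R) (XX := XX) k).

Lemma B_closed k : closed_subspace (B k).
Proof. by rewrite B_E; apply: closed_span_closed; exact: monoK_bop. Qed.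

Lemma B_bop k : B k `<=` @bounded_op R XX.
Proof. by have [[]] := B_closed k. Qed.

Lemma B_comp k l F G : B k F -> B l G -> B (k + l) (F \o G).
Proof.
have cB := B_closed (k + l); move: cB; rewrite !B_E => cB.
apply: (closed_span_mul (@monoK_bop k) (@monoK_bop l) cB) => K L.
move=> [m [n [<- mK]]] [p [q [<- mL]]]; apply: sub_closed_span.
by have [m' [n' [e mKL]]] := mono_comp mK mL; exists m', n'.
Qed.

Lemma B_adjoint k F : B k F -> B (- k) (adjoint F).
Proof.
have cB := B_closed (- k); move: cB; rewrite !B_E => cB.
apply: (closed_span_map (op_map_adjoint R _) cB (@monoK_bop k)) => K.
move=> [m [n [<- mK]]]; apply: sub_closed_span; exists n, m.
by split; [rewrite opprB|exact: adjoint_mono].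
Qed.

Lemma B_mulA a : cont a -> B 0 (mulA a).
Proof.
move=> ca; rewrite B_E; apply: sub_closed_span; exists 0%N, 0%N; split=> //.
exists (mulA a), (mulA (fun=> 1)); split; try exact: W0.
  exact: (W0 (cont_cst 1)).
rewrite adjoint_mulA; last exact: cont_cst.
rewrite mulA_comp //; last by apply: contJ; exact: cont_cst.
by congr mulA; apply/funext => x; rewrite conjC1 mulr1.
Qed.

Lemma B_sop f : cont_graph f -> B 1 (sop f).
Proof.
move=> cf; apply: sub_closed_span; exists 1%N, 0%N; split=> //.
(* A chain of length one is a point (x_1, x_0) of the graph; [ord_max] is the index of x_1. *)
pose f' (p : chain_space X 1 * chain_space X 0) := f (p.1 ord_max, p.1 ord0).
have wE l (j k : 0.-tuple 'I_N) x : wt f' [tuple of l :: j] k x = f (gamma l x, x).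
  by rewrite /wt /f' /word_chain /= take0.
have cf' : cont_words f'.
  move=> j k; rewrite (tuple_eta j).
  have -> : wt f' [tuple of thead j :: behead j] k = (fun x => f (gamma (thead j) x, x)).
    by apply/funext => x; rewrite -(wE _ [tuple of behead j] k); congr (wt _ _ _ _);
      exact: val_inj.
  exact: cf.
exists f'; first exact: cont_words_within.
rewrite rho_mnE //; apply: bop_ext; [exact: rhoop_bop|exact: sop_bop|move=> x].
rewrite rhoop_ket0 // big_tuple_cons sop_ket //; apply: eq_bigr => l _.
rewrite (big_pred1 ([tuple] : 0.-tuple 'I_N)) ?wE //.
by move=> j; apply/esym/eqP/val_inj; case: j => [[]].
Qed.

Lemma D_bop k : D k `<=` @bounded_op R XX.
Proof. by move=> F [/B_bop]. Qed.

(** * The algebra D_hat and the grading of the C*-algebra *)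

Lemma D_hatE : D_hat R gamma XX = graded (fun k => D k).
Proof.
rewrite /D_hat /graded; congr closed_span; apply/seteqP; split=> _ [k _ [F DF <-]].
  by exists k => //; exists F => //; rewrite tensor_shiftE //; exact: D_bop DF.
by exists k => //; exists F => //; rewrite tensor_shiftE //; exact: D_bop DF.
Qed.

Lemma D_hat_cstar : cstar_subalgebra (D_hat R gamma XX).
Proof.
rewrite D_hatE; apply: graded_cstar; first exact: D_bop.
  move=> k l F G [BF dF] [BG dG]; split; first exact: B_comp.
  by have [] := diagonal_comp dF dG.
by move=> k F [BF dF]; split; [exact: B_adjoint|exact: diagonal_adjoint].
Qed.

Lemma D_hat_commutative : commutative_set (D_hat R gamma XX).
Proof.
rewrite D_hatE; apply: closed_span_commute; first exact: graded_gen_bop D_bop.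
move=> _ _ [k _ [F DF <-]] [l _ [G DG <-]].
have bF := D_bop DF; have bG := D_bop DG; case: DF DG => [_ dF] [_ dG].
have [_ FG] := diagonal_comp dF dG.
by rewrite !hat_comp // FG addrC.
Qed.

Lemma hat_rho_AE a : continuous a -> hat_rho_A (XX := XX) a = hat 0 (mulA a).
Proof.
move=> ca; have ca' := Cont ca.
by rewrite /hat_rho_A rho_AE // tensor_shiftE //; exact: mulA_bop.
Qed.

Lemma cont_graph_within f : {within ifs_graph gamma, continuous f} -> cont_graph f.
Proof.
move=> cf k; have cg : continuous (fun y : X => (gamma k y, y)).
  move=> y; have hk : gamma k z @[z --> y] --> gamma k y by exact: gamma_cont.
  have hi : z @[z --> y] --> y by exact: cvg_id.
  exact: (cvg_pair hk hi).
have h y : ifs_graph gamma (gamma k y, y) by exists k.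
by split; exact: (within_comp cf cg h).
Qed.

Lemma hat_rho_EE f : cont_graph f -> hat_rho_E gamma (XX := XX) f = hat 1 (sop f).
Proof.
move=> cf; rewrite /hat_rho_E rho_EE // tensor_shiftE //; exact: sop_bop.
Qed.

Lemma cstar_sub_graded : cstar_hat_rho R gamma XX `<=` graded (fun k => B k).
Proof.
apply: smallest_sub.
  by apply: graded_cstar; [exact: B_bop|exact: B_comp|exact: B_adjoint].
move=> _ [[a ca <-]|[f /cont_graph_within cf <-]].
  by rewrite hat_rho_AE //; apply: hat_graded; exact: B_mulA (Cont ca).
by rewrite hat_rho_EE //; apply: hat_graded; exact: B_sop.
Qed.

(** Degrees add under composition, so M (x) v_n, for a word M with n letters s, is a product of
    generators a (x) v_0 and s (x) v_1. Adjoints of such products give the negative degrees. *)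
Lemma graded_sub_cstar : graded (fun k => B k) `<=` cstar_hat_rho R gamma XX.
Proof.
move=> K gK A [[sA cA] VA]; have [subA compA adjA] := sA.
have closedA : closed_subspace A by [].
move: K gK; apply: closed_span_min => // _ [k _ [F + <-]].
rewrite B_E; apply: (closed_span_map (op_map_hat R XX k) closedA (@monoK_bop k)).
have hW n M : W n M -> A (hat n%:Z M).
  have hA a : cont a -> A (hat 0 (mulA a)).
    by move=> [ca]; apply: VA; left; exists a => //; exact: hat_rho_AE.
  have hs : A (hat 1 sone).
    apply: VA; right; exists (fun=> 1); last exact: hat_rho_EE cont_graph1.
    by apply: continuous_subspaceT => x; exact: cvg_cst.
  elim=> [a ca|{}n {}M a WM AM ca]; first exact: hA.
  have bM := W_bop WM; have bs := sone_bop; have ba := mulA_bop ca.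
  have -> : hat n.+1%:Z (M \o sone \o mulA a) = hat n%:Z M \o hat 1 sone \o hat 0 (mulA a).
    rewrite (hat_comp _ _ bM bs) (hat_comp _ _ (bop_comp bM bs) ba) addr0.
    by have -> : n.+1%:Z = n%:Z + 1 :> int by lia.
  exact: (compA _ _ (compA _ _ AM hs) (hA _ ca)).
move=> {}F [m [n [<- [M [L [WM WL ->]]]]]].
have bM := W_bop WM; have bL := W_bop WL.
rewrite -(hat_comp _ _ bM (adjoint_bop bL)) -(adjoint_hat _ bL).
exact: (compA _ _ (hW _ _ WM) (adjA _ (hW _ _ WL))).
Qed.

Lemma D_hat_sub : D_hat R gamma XX `<=` cstar_hat_rho R gamma XX.
Proof.
apply: subset_trans graded_sub_cstar; rewrite D_hatE.
apply: closed_span_mono; first exact: graded_gen_bop B_bop.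
move=> _ [k _ [F [BF _] <-]]; exact: hat_graded.
Qed.

Lemma hat_mulA_D_hat a : cont a -> D_hat R gamma XX (hat 0 (mulA a)).
Proof.
move=> ca; rewrite D_hatE; apply: hat_graded; split; first exact: B_mulA.
exact: diagonal_mulA.
Qed.

(** * Maximality of D_hat *)

Lemma slice_diagonal k K : bounded_op K ->
  (forall a w, cont a -> K (hat 0 (mulA a) w) = hat 0 (mulA a) (K w)) ->
  diagonal_op (slice k K).
Proof.
move=> bK cK; apply/diagonalP; split; first exact: slice_bop.
move=> x y xy; rewrite slice_entry.
have vxy : val x <> val y by move=> /val_inj.
have [a [ca _ ax ay]] := separating_function vxy.
have := congr1 (fun w : l2 R (XX * int)%type => w (x, k))
  (cK a (ket R ((y, 0) : XX * int)) ca).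
(* As a(y) = 0, the function kills e_y, so a K e_y = K a e_y = 0; as a(x) = 1, the entry of K e_y at
   x survives multiplication by a and must vanish. *)
have e1 : hat 0 (mulA a) (ket R ((y, 0) : XX * int)) = 0.
  apply: l2ext => -[z i]; rewrite (hat_ket 0 (mulA_bop ca) y 0 z i) mulA_ket //.
  by rewrite l2Z (nbhs_singleton ay) mul0r mulr0.
rewrite e1 (lin0 (bop_lin bK)) (hatE 0 (mulA_bop ca)) subr0 mulAE // rowE.
by rewrite (nbhs_singleton ax) mul1r.
Qed.

Lemma D_hat_masa : masa (D_hat R gamma XX) (cstar_hat_rho R gamma XX).
Proof.
have [starD _] := D_hat_cstar.
split; [exact: D_hat_sub|exact: starD|exact: D_hat_commutative|].
move=> A sA cA DA AC; apply/seteqP; split=> // T AT.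
have gT := cstar_sub_graded (AC _ AT).
have cT := fejer_conv_graded B_bop gT; have [bT _ _] := cT.
rewrite D_hatE; apply: fejer_in_span => // [k F /D_bop//|k].
split; first exact: (slice_graded B_bop (B_closed k) gT).
apply: slice_diagonal => // a w ca.
(* A contains D_hat and hence hat_rho_A(A); being commutative, it forces T to commute with these
   functions. *)
have h := cA _ _ AT (DA _ (hat_mulA_D_hat ca)).
by rewrite -[LHS]/((T \o hat 0 (mulA a)) w) h.
Qed.

Lemma hat_rho_A_sub : hat_rho_A_range R XX `<=` D_hat R gamma XX.
Proof.
by move=> _ [a ca <-]; rewrite hat_rho_AE //; exact: hat_mulA_D_hat (Cont ca).
Qed.

End Words.

Theorem theorem5p5p1 (R : realType) (X : topologicalType) (N : nat)
  (gamma : 'I_N -> X -> X) (XX : set X)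
  (X_compact : compact [set: X])
  (X_hausdorff : hausdorff_space X)
  (gamma_ifs : ifs gamma)
  (XX_dense : dense XX)
  (XX_invariant : completely_invariant gamma XX)
  (XX_disjoint : trivIset [set: 'I_N] (fun k => gamma k @` XX))
  (XX_inj : forall k, {in XX &, injective (gamma k)})
  (gamma_embedding : forall k, topological_embedding (gamma k))
  (gamma_open : exists U : set X,
    [/\ open U, dense U,
        trivIset [set: 'I_N] (fun k => gamma k @` U),
        forall k, open (gamma k @` U) /\ gamma k @` U `<=` U &
        XX `<=` U])
  (XX_comeager : comeager XX) :
  masa (D_hat R gamma XX) (cstar_hat_rho R gamma XX) /\
  hat_rho_A_range R XX `<=` D_hat R gamma XX.
Proof. by split; [exact: D_hat_masa|exact: hat_rho_A_sub]. Qed.
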